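(* Let $16n \leq m \leq 2^{o(\sqrt{n})}$. There is a deterministic algorithm running in time polynomial in $m$ and $n$ that outputs $m$ points $v_1, v_2, \dots, v_m \in S^{n-1}$ such that for all pairs $i \neq j$, \[\langle v_i, v_j\rangle \leq \sqrt{\frac{2\ln\frac{m}{n}}{n}}\cdot\left(1+O\left(\frac{1}{\log\frac{m}{n}}\right)\right).\] Moreover, taking the maximal radius $r$ such that the spherical caps of angular radius $r$ around the $v_i$ are pairwise disjoint produces a packing with density $\Omega\left(\frac{n}{2^n\sqrt{\log\frac{m}{n}}}\right)$.
   Context: $S^{n-1} = \{x \in \mathbb{R}^n : \|x\|_2 = 1\}$. The spherical cap with pole $v \in S^{n-1}$ and angular radius $\theta$ is $\{x \in S^{n-1} : \langle x, v\rangle \geq \cos\theta\}$; its normalized volume is the probability that a uniformly random point of $S^{n-1}$ lies in it. The density of a family of $m$ caps each of normalized volume $\delta$ is $m\delta$. Asymptotic notation is as $n \to \infty$ with $m$ a function of $n$; $\ln$ is natural log, $\log$ is base $2$. *)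

(* Defs.v *)
From HB Require Import structures.
From mathcomp Require Import all_boot all_order all_algebra.
From mathcomp Require Import all_classical all_reals all_analysis.

Set Implicit Arguments.
Unset Strict Implicit.
Unset Printing Implicit Defensive.

Import Order.TTheory GRing.Theory Num.Theory.
Import numFieldNormedType.Exports.

Local Open Scope classical_set_scope.
Local Open Scope ring_scope.

(** * Deterministic algorithms and their running time

   A deterministic random access machine under the logarithmic cost criterion,
   presented as a structured imperative language.  The memory consists of
   countably many integer arrays [0], [1], [2], ... (a scalar variable is an
   array used at index [0] only), and every evaluation step is charged the
   bit length of the integer it produces, addresses included.  Large integers
   must thus be paid for bit by bit, and running time agrees up to a polynomial
   with that of a Turing machine. *)

Inductive binop := Add | Sub | Mul | Div.

(* [Read a e] is the entry of array [a] at the index given by [e]. *)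
Inductive expr :=
  | Const of int
  | Read of nat & expr
  | Bin of binop & expr & expr.

(* [Write a e1 e2] is the assignment a[e1] := e2; a guard [e] holds when its
   value is positive. *)
Inductive cmd :=
  | Skip
  | Write of nat & expr & expr
  | Seq of cmd & cmd
  | If of expr & cmd & cmd
  | While of expr & cmd.

Definition memory := nat -> int -> int.

(* [Div] is Euclidean division, with quotient 0 for the divisor 0. *)
Definition eval_binop (o : binop) (x y : int) : int :=
  match o with
  | Add => x + y
  | Sub => x - y
  | Mul => x * y
  | Div => (x %/ y)%Z
  end.

Fixpoint eval (s : memory) (e : expr) : int :=
  match e with
  | Const z => z
  | Read a e => s a (eval s e)
  | Bin o e1 e2 => eval_binop o (eval s e1) (eval s e2)
  end.

Definition bitsize (z : int) : nat := (trunc_log 2 `|z|).+1.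

Fixpoint cost (s : memory) (e : expr) : nat :=
  (bitsize (eval s e) +
   match e with
   | Const _ => 0
   | Read _ e1 => cost s e1
   | Bin _ e1 e2 => cost s e1 + cost s e2
   end)%N.

Definition update (s : memory) (a : nat) (x y : int) : memory :=
  fun b z => if (b == a) && (z == x) then y else s b z.

(* [exec c s s' t]: started in [s], the program [c] halts in [s'], in time
   [t]. *)
Inductive exec : cmd -> memory -> memory -> nat -> Prop :=
  | exec_skip s : exec Skip s s 1
  | exec_write s a e1 e2 :
      exec (Write a e1 e2) s (update s a (eval s e1) (eval s e2))
           (cost s e1 + cost s e2)
  | exec_seq c1 c2 s s1 s2 t1 t2 :
      exec c1 s s1 t1 -> exec c2 s1 s2 t2 ->
      exec (Seq c1 c2) s s2 (t1 + t2)
  | exec_if_true e c1 c2 s s1 t1 :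
      0 < eval s e -> exec c1 s s1 t1 ->
      exec (If e c1 c2) s s1 (cost s e + t1)
  | exec_if_false e c1 c2 s s1 t1 :
      ~~ (0 < eval s e) -> exec c2 s s1 t1 ->
      exec (If e c1 c2) s s1 (cost s e + t1)
  | exec_while_true e c s s1 s2 t1 t2 :
      0 < eval s e -> exec c s s1 t1 -> exec (While e c) s1 s2 t2 ->
      exec (While e c) s s2 (cost s e + t1 + t2)
  | exec_while_false e c s :
      ~~ (0 < eval s e) -> exec (While e c) s s (cost s e).

Lemma exec_deterministic c s s1 s2 t1 t2 :
  exec c s s1 t1 -> exec c s s2 t2 -> s1 = s2 /\ t1 = t2.
Proof.
move=> h1; elim: h1 s2 t2 => {c s s1 t1}.
- by move=> s s2 t2 h; inversion h.
- by move=> s a e1 e2 s2 t2 h; inversion h.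
- move=> c1 c2 s s1 s2 t1 t2 _ IH1 _ IH2 s' t' h; inversion h; subst.
  match goal with H : exec c1 _ _ _ |- _ => case: (IH1 _ _ H) => ? ? end.
  subst.
  by match goal with H : exec c2 _ _ _ |- _ => case: (IH2 _ _ H) => -> -> end.
- move=> e c1 c2 s s1 t1 e0 _ IH s' t' h; inversion h; subst.
    by match goal with H : exec c1 _ _ _ |- _ => case: (IH _ _ H) => -> -> end.
  by match goal with H : is_true (~~ _) |- _ => rewrite e0 in H end.
- move=> e c1 c2 s s1 t1 e0 _ IH s' t' h; inversion h; subst.
    by match goal with H : is_true (0 < _) |- _ => rewrite H in e0 end.
  by match goal with H : exec c2 _ _ _ |- _ => case: (IH _ _ H) => -> -> end.
- move=> e c s s1 s2 t1 t2 e0 _ IH1 _ IH2 s' t' h; inversion h; subst.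
    match goal with H : exec c _ _ _ |- _ => case: (IH1 _ _ H) => ? ? end.
    subst.
    by match goal with H : exec (While _ _) _ _ _ |- _ =>
      case: (IH2 _ _ H) => -> -> end.
  by match goal with H : is_true (~~ _) |- _ => rewrite e0 in H end.
- move=> e c s e0 s' t' h; inversion h; subst => //.
  by match goal with H : is_true (0 < _) |- _ => rewrite H in e0 end.
Qed.

(* The input (m, n) is stored in array 0, all other entries being 0. *)
Definition input (m n : nat) : memory :=
  update (update (fun _ _ => 0) 0%N 0 m%:Z) 0%N 1 n%:Z.

(** * The sphere S^{n-1} and its caps *)

Section Sphere.
Context {R : realType}.

Definition dot {n : nat} (x y : 'rV[R]_n) : R := \sum_(i < n) x 0 i * y 0 i.

(* The library norm [`|x|] on row vectors is the sup norm. *)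
Definition norm2 {n : nat} (x : 'rV[R]_n) : R := Num.sqrt (dot x x).

Definition sphere {n : nat} : set 'rV[R]_n := [set x | norm2 x = 1].

Definition ball2 {n : nat} : set 'rV[R]_n := [set x | norm2 x <= 1].

Definition cap {n : nat} (v : 'rV[R]_n) (theta : R) : set 'rV[R]_n :=
  [set x | sphere x /\ cos theta <= dot x v].

(* n-dimensional Lebesgue measure of a Borel set, as the iterated product of
   the one-dimensional one: by Tonelli, the measure of A is the integral over
   the first coordinate x of the measure of the slice of A at x. *)
Fixpoint volume (n : nat) : set 'rV[R]_n -> \bar R :=
  match n return set 'rV[R]_n -> \bar R with
  | 0%N => fun A => (\1_A (0 : 'rV[R]_0))%:E
  | n'.+1 => fun A =>
      (\int[lebesgue_measure]_(x in [set: measurableTypeR R])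
         volume [set y : 'rV[R]_n' |
                   A (row_mx (const_mx x : 'rV[R]_1) y : 'rV[R]_(1 + n'))])%E
  end.

(* The uniform probability of a Borel subset A of the sphere (cone measure):
   the proportion of the unit ball filled by the cone {ty | 0 <= t <= 1, y in A}
   over A. *)
Definition normalized_volume {n : nat} (A : set 'rV[R]_n) : R :=
  fine (volume [set x | exists t y, 0 <= t <= 1 /\ A y /\ x = t *: y]) /
  fine (volume (@ball2 n)).

(* The caps being closed, the maximal radius is a supremum: caps of that radius
   may touch, but those of any smaller radius are pairwise disjoint. *)
Definition max_radius {m n : nat} (v : 'I_m -> 'rV[R]_n) : R :=
  sup [set r | 0 <= r <= pi /\ trivIset setT (fun i => cap (v i) r)].

(* Points of the sphere are output exactly: v_i is the normalisation w_i/|w_i|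
   of the integer vector w_i whose j-th coordinate is entry i * n + j of
   array 1.  If w_i = 0 then v_i = 0 is not on the sphere. *)
Definition outputs (c : cmd) (m n t : nat) (v : 'I_m -> 'rV[R]_n) : Prop :=
  exists s, exec c (input m n) s t /\
    forall i : 'I_m,
      let w : 'rV[R]_n := \row_(j < n) (s 1%N (i * n + j)%N%:Z)%:~R in
      v i = (norm2 w)^-1 *: w.

Definition log2 (x : R) : R := ln x / ln 2.

End Sphere.

(* Main.v *)
(* The vectors are constructed one after the other.  Given the previous ones,
   the new vector x is the end of a derandomised random walk of K rounds.  In
   each round, the previous vectors v whose inner product with x has become too
   large are frozen, and x moves by plus or minus each column of (an integer
   approximation of D times) the orthogonal projection P onto the complement of
   the frozen vectors.  The signs keep the total of multiplicative weights from
   growing: the weight of v follows exp(<v, x> / (g D^2)), and one more weight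
   decreases with |x|^2.  As the columns of P form a tight frame, the second
   order terms of the weights add up to Lambda = n K^2 / (2 g^2) over the walk.
   K is the number of rounds for which Lambda is about ln(m/n), so that few
   vectors are ever frozen, <v, x> <= g D^2 (2 Lambda + 5) for all v, and |x|^2
   is at least n K D^2 (1 - 3 / (2 Lambda)).

   For the density, the inner products tend to 0, so the caps have a radius
   close to pi/4 or more, and the volume of such a cap is exponentially larger
   than 2^-n: at least half of a cube around a multiple of the pole lies in
   the cone over the cap, while a Gaussian density bounds the volume of the
   ball. *)
Require Import Defs.
From HB Require Import structures.
From mathcomp Require Import all_boot all_order all_algebra.
From mathcomp Require Import all_classical all_reals all_analysis.
From mathcomp Require Import measurable_realfun.
From mathcomp Require Import ring lra zify.

Set Implicit Arguments.
Unset Strict Implicit.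
Unset Printing Implicit Defensive.

Import Order.TTheory GRing.Theory Num.Theory.
Import numFieldNormedType.Exports.

Local Open Scope classical_set_scope.
Local Open Scope ring_scope.

(** * Volume of caps *)

Section Volume.
Context {R : realType}.

(** The parameters follow from one quotient. Before normalisation two vectors have inner product at
    most g D^2 (2 Lambda + 5), against squared norms of about n K D^2. Since 2 Lambda = n K^2 / g^2,
    the quotient is K / g = sqrt(2 Lambda / n) up to a factor 1 + O(1 / Lambda). Each loss may
    therefore cost such a factor, and Lambda may exceed ln(m/n) by a constant. A walk is skipped
    from the moment |x|^2 reaches n K D^2: the second order terms are proportional to |v|^2, so the
    norms must be bounded above as well as below. All arithmetic is exact. A large g makes every
    single step tiny, so that ln(1 + u) is quadratic up to a negligible error, and a large D makes
    the rounding of the projections harmless; g = m^4 and D = m^6 do both. Weights are never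
    divided: they carry a common power of g^2 D^2, which cancels in every comparison and costs O(m)
    bits per step, hence polynomially many in all. *)

Lemma ge0_integral_mono d (T : measurableType d)
    (mu : {measure set T -> \bar R}) (f1 f2 : T -> \bar R) :
  (forall x, 0 <= f1 x)%E -> (forall x, f1 x <= f2 x)%E ->
  (\int[mu]_x f1 x <= \int[mu]_x f2 x)%E.
Proof.
move=> f10 f12; have f20 x : (0 <= f2 x)%E by exact: le_trans (f12 x).
(* The integral of a nonnegative function is a supremum over the simple functions below it.
   Monotonicity thus holds for arbitrary functions, as it must here: the slices of an arbitrary set
   may have a volume that is not measurable in [x]. *)
rewrite !ge0_integralTE//; apply: le_ereal_sup => _ [h hf1 <-].
by exists h => // x; exact: le_trans (f12 x).
Qed.

Lemma volume_ge0 n (A : set 'rV[R]_n) : (0 <= volume A)%E.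
Proof.
elim: n A => [|n IH] A /=; first by rewrite lee_fin indicE; case: (_ \in _).
by apply: integral_ge0 => x _; exact: IH.
Qed.

Lemma volume_le n (A B : set 'rV[R]_n) : A `<=` B -> (volume A <= volume B)%E.
Proof.
elim: n A B => [|n IH] A B AB /=.
  rewrite lee_fin !indicE; case: (boolP (0 \in A)) => [|_]; last by case: (_ \in _).
  by rewrite inE => /AB/mem_set ->.
apply: ge0_integral_mono => x; first exact: volume_ge0.
by apply: IH => y; exact: AB.
Qed.

Lemma cons_mx0 n (x : R) (y : 'rV[R]_n) :
  (row_mx (const_mx x : 'rV[R]_1) y : 'rV_(1 + n)) 0 (ord0 : 'I_n.+1) = x.
Proof.
rewrite (_ : ord0 = lshift n (ord0 : 'I_1)); last exact: val_inj.
by rewrite row_mxEl mxE.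
Qed.

Lemma cons_mxS n (x : R) (y : 'rV[R]_n) (i : 'I_n) :
  (row_mx (const_mx x : 'rV[R]_1) y : 'rV_(1 + n)) 0 (lift ord0 i : 'I_n.+1) =
  y 0 i.
Proof.
rewrite (_ : lift ord0 i = rshift 1 i); last exact: val_inj.
by rewrite row_mxEr.
Qed.

Lemma big_cons_mx (T : Type) (idx : T) (op : T -> T -> T) n (x : R)
    (y : 'rV[R]_n) (F : 'I_n.+1 -> R -> T) :
  \big[op/idx]_(i < n.+1) F i ((row_mx (const_mx x : 'rV[R]_1) y : 'rV_(1 + n)) 0 i)
  = op (F ord0 x) (\big[op/idx]_(i < n) F (lift ord0 i) (y 0 i)).
Proof.
rewrite big_ord_recl cons_mx0; congr op.
by apply: eq_bigr => i _; rewrite cons_mxS.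
Qed.

(** Integrating one coordinate at a time, the constant [C] absorbs the value of [phi] at the
    coordinate just fixed, and [phi] has total mass 1. *)
Lemma volume_le_density n (phi : R -> R) (C : R) (A : set 'rV[R]_n) :
  measurable_fun setT phi -> (forall x, 0 <= phi x) ->
  (\int[@lebesgue_measure R]_x (phi x)%:E = 1)%E ->
  0 <= C -> (forall y, A y -> 1 <= C * \prod_i phi (y 0 i)) ->
  (volume A <= C%:E)%E.
Proof.
move=> mphi phi0 phi1; elim: n C A => [|n IH] C A C0 hA /=.
  rewrite lee_fin indicE; case: (boolP (0 \in A)) => //; rewrite inE => /hA.
  by rewrite big_ord0 mulr1.
apply: (@le_trans _ _ (\int[@lebesgue_measure R]_x (C%:E * (phi x)%:E))%E).
  apply: ge0_integral_mono => x; first exact: volume_ge0.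
  rewrite -EFinM; apply: IH => [|y /hA]; first exact: mulr_ge0.
  by rewrite (big_cons_mx _ _ _ _ (fun _ => phi)) mulrA.
rewrite ge0_integralZl_EFin ?phi1 ?mule1//.
- by move=> x _; rewrite lee_fin.
- exact/measurable_EFinP.
Qed.

(** The bound of [volume_box_ge] is a polynomial of this shape in each coordinate; the linear term
    integrates to 0 by symmetry. *)
Lemma integral_quartic (c h k0 k1 k2 k4 : R) : 0 < h ->
  (\int[@lebesgue_measure R]_(x in `[(c - h)%R, (c + h)%R])
     (k0 + k1 * (x - c) + k2 * (x - c) ^+ 2 + k4 * (x - c) ^+ 4)%:E =
   (2 * h * (k0 + k2 * h ^+ 2 / 3 + k4 * h ^+ 4 / 5))%:E)%E.
Proof.
move=> h0.
pose G : {poly R} := k0 *: 'X + (k1 / 2) *: 'X^2 + (k2 / 3) *: 'X^3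
  + (k4 / 5) *: 'X^5.
pose F := G \Po ('X - c%:P).
have GE t : G.[t] = k0 * t + k1 / 2 * t ^+ 2 + k2 / 3 * t ^+ 3 + k4 / 5 * t ^+ 5.
  by rewrite /G !hornerE.
have FE x : F.[x] = G.[x - c] by rewrite /F horner_comp !hornerE.
have F'E x : F^`().[x] =
    k0 + k1 * (x - c) + k2 * (x - c) ^+ 2 + k4 * (x - c) ^+ 4.
  rewrite /F deriv_comp derivB derivX derivC subr0 mulr1 horner_comp !hornerE /G.
  rewrite !derivD !derivZ derivX !derivXn !hornerE/=.
  by field.
under eq_integral do rewrite -F'E.
rewrite (@continuous_FTC2 _ (horner F^`()) (horner F)).
- by rewrite -EFinB !FE !GE; congr (_%:E); field.
- lra.
- by apply: continuous_subspaceT => x; exact: continuous_horner.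
- split=> [x _||]; first exact: derivable_horner.
    by apply: cvg_at_right_filter; exact: continuous_horner.
  by apply: cvg_at_left_filter; exact: continuous_horner.
- by move=> x _; rewrite -derivE.
Qed.

(* Chebyshev's inequality for the two sums of independent centred variables
   appearing below, when y is uniform on the box of centre c and half-side h,
   carried out one coordinate at a time; p and q are the contributions of the
   coordinates already integrated. *)
Lemma volume_box_ge n (c v : 'rV[R]_n) (h p q a b : R) (A : set 'rV[R]_n) :
  0 < h -> 0 <= a -> 0 <= b ->
  (forall y : 'rV[R]_n, (forall i, `|y 0 i - c 0 i| <= h) ->
     a * (p + \sum_i (y 0 i - c 0 i) * v 0 i) ^+ 2 +
     b * (q + \sum_i ((y 0 i - c 0 i) ^+ 2 - h ^+ 2 / 3)) ^+ 2 < 1 -> A y) ->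
  (((2 * h) ^+ n *
    (1 - a * (p ^+ 2 + h ^+ 2 / 3 * \sum_i v 0 i ^+ 2)
       - b * (q ^+ 2 + n%:R * (h ^+ 4 * (4 / 45)))))%:E <= volume A)%E.
Proof.
move=> h0 a0 b0; elim: n c v p q A => [|n IH] c v p q A hA /=.
  rewrite lee_fin expr0 mul1r !big_ord0 mul0r mulr0 !addr0.
  have [lt1|ge1] := ltP (a * p ^+ 2 + b * q ^+ 2) 1.
    rewrite indicE mem_set/=; last first.
      by apply: hA => [[]//|]; rewrite !big_ord0 !addr0.
    have := mulr_ge0 a0 (sqr_ge0 p); have := mulr_ge0 b0 (sqr_ge0 q); lra.
  by rewrite indicE; apply: (@le_trans _ _ 0); [lra|case: (_ \in _)].
pose c' : 'rV[R]_n := \row_i c 0 (lift ord0 i).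
pose v' : 'rV[R]_n := \row_i v 0 (lift ord0 i).
pose c0 := c 0 ord0; pose v0 := v 0 ord0.
pose S := \sum_i v' 0 i ^+ 2; pose w := h ^+ 2 / 3.
pose f x := (2 * h) ^+ n *
  (1 - a * ((p + (x - c0) * v0) ^+ 2 + w * S)
     - b * ((q + ((x - c0) ^+ 2 - w)) ^+ 2 + n%:R * (h ^+ 4 * (4 / 45)))).
have slice x : `|x - c0| <= h ->
    ((f x)%:E <= volume [set y : 'rV[R]_n |
       A (row_mx (const_mx x : 'rV[R]_1) y : 'rV[R]_(1 + n))])%E.
  move=> xh; apply: (IH c' v') => y yh /= lt1; apply: hA.
    move=> i; case: (unliftP ord0 i) => [j ->|->]; last by rewrite cons_mx0.
    by rewrite cons_mxS; have := yh j; rewrite mxE.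
  rewrite (big_cons_mx _ _ _ _ (fun i t => (t - c 0 i) * v 0 i)).
  rewrite (big_cons_mx _ _ _ _ (fun i t => (t - c 0 i) ^+ 2 - h ^+ 2 / 3)).
  rewrite !addrA; move: lt1; rewrite !addrA.
  by under eq_bigr do rewrite !mxE; under [X in _ + b * (_ + X) ^+ 2]eq_bigr do rewrite !mxE.
pose J := `[c0 - h, c0 + h]%classic : set R.
have inJ x : J x -> `|x - c0| <= h.
  by rewrite /J/= in_itv/= => /andP[? ?]; rewrite ler_norml; lra.
apply: (@le_trans _ _ (\int[@lebesgue_measure R]_(x in J) (f x)%:E)%E).
  pose k := (2 * h) ^+ n.
  pose k0 := k * (1 - a * (p ^+ 2 + w * S)
    - b * ((q - w) ^+ 2 + n%:R * (h ^+ 4 * (4 / 45)))).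
  under eq_integral => x _.
    rewrite (_ : f x = k0 + (k * (- 2 * a * p * v0)) * (x - c0)
      + (k * (- a * v0 ^+ 2 - 2 * b * (q - w))) * (x - c0) ^+ 2
      + (- k * b) * (x - c0) ^+ 4); last by rewrite /f /k0 /k; ring.
    over.
  rewrite integral_quartic// lee_fin /k0 /k big_ord_recl -/v0.
  rewrite (_ : \sum_(i < n) v 0 (lift ord0 i) ^+ 2 = S); last first.
    by apply: eq_bigr => i _; rewrite mxE.
  rewrite exprS -/k le_eqVlt; apply/orP; left; apply/eqP.
  by rewrite -[n.+1]addn1 natrD /w; field.
(* [f] may be negative, so its integral is first raised to that of its positive part, which the
   volume of the slice still dominates. *)
rewrite integralE; apply: (@le_trans _ _ (\int[@lebesgue_measure R]_(x in J) ((EFin \o f)^\+ x))%E).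
  by rewrite geeDl// oppe_le0 integral_ge0.
rewrite integral_mkcond; apply: ge0_integral_mono => x.
  by apply: erestrict_ge0 => y _; exact: funepos_ge0.
rewrite patchE; case: ifPn => [|_]; last exact: volume_ge0.
rewrite inE => /inJ/slice fx; rewrite funeposE ge_max; apply/andP; split => //.
exact: volume_ge0.
Qed.

End Volume.

(** * Inner products, the volume of the ball and the cone over a cap *)

Section Caps.
Context {R : realType}.

Lemma dotC n (x y : 'rV[R]_n) : dot x y = dot y x.
Proof. by apply: eq_bigr => i _; rewrite mulrC. Qed.

Lemma dotDl n (x y z : 'rV[R]_n) : dot (x + y) z = dot x z + dot y z.
Proof. by rewrite -big_split; apply: eq_bigr => i _; rewrite mxE mulrDl. Qed.

Lemma dotDr n (x y z : 'rV[R]_n) : dot z (x + y) = dot z x + dot z y.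
Proof. by rewrite dotC dotDl !(dotC z). Qed.

Lemma dotZl n a (x y : 'rV[R]_n) : dot (a *: x) y = a * dot x y.
Proof. by rewrite mulr_sumr; apply: eq_bigr => i _; rewrite mxE mulrA. Qed.

Lemma dotZr n a (x y : 'rV[R]_n) : dot x (a *: y) = a * dot x y.
Proof. by rewrite dotC dotZl dotC. Qed.

Lemma dot0l n (y : 'rV[R]_n) : dot 0 y = 0.
Proof. by rewrite -(scale0r 0) dotZl mul0r. Qed.

Lemma dot_ge0 n (x : 'rV[R]_n) : 0 <= dot x x.
Proof. by apply: sumr_ge0 => i _; rewrite -expr2 sqr_ge0. Qed.

Lemma dot_eq0 n (x : 'rV[R]_n) : dot x x = 0 -> x = 0.
Proof.
move=> /psumr_eq0P x0; apply/rowP => i; rewrite mxE.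
have /eqP := x0 (fun j _ => sqr_ge0 (x 0 j)) i isT.
by rewrite mulf_eq0 orbb => /eqP.
Qed.

Lemma dot_CauchySchwarz n (x y : 'rV[R]_n) : dot x y ^+ 2 <= dot x x * dot y y.
Proof.
have [/dot_eq0->|y0] := eqVneq (dot y y) 0.
  by rewrite dotC !dot0l expr0n mulr0.
have yy : 0 < dot y y by rewrite lt_def y0 dot_ge0.
have := dot_ge0 (dot y y *: x + (- dot x y) *: y).
rewrite !(dotDl, dotDr, dotZl, dotZr) (dotC y x) => h.
have : 0 <= dot y y * (dot x x * dot y y - dot x y ^+ 2).
  by apply: le_trans h _; rewrite le_eqVlt; apply/orP; left; apply/eqP; ring.
by rewrite pmulr_rge0// subr_ge0.
Qed.

Lemma norm2_sqr n (x : 'rV[R]_n) : norm2 x ^+ 2 = dot x x.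
Proof. by rewrite sqr_sqrtr ?dot_ge0. Qed.

Lemma sphereP n (x : 'rV[R]_n) : sphere x <-> dot x x = 1.
Proof.
rewrite /sphere/= /norm2; split => [h|->]; last exact: sqrtr1.
by rewrite -(sqr_sqrtr (dot_ge0 x)) h expr1n.
Qed.

Lemma norm2_ge0 n (x : 'rV[R]_n) : 0 <= norm2 x.
Proof. exact: sqrtr_ge0. Qed.

Lemma norm2_le1 n (x : 'rV[R]_n) : (norm2 x <= 1) = (dot x x <= 1).
Proof. by rewrite -norm2_sqr expr_le1// norm2_ge0. Qed.

(* From [(1 - 1/16) ^ 16 <= e^-1] and [pi <= 4]. *)
Lemma twopie_le : 2 * (pi : R) * expR 1 <= 4 * (12 * (69 / 100) ^+ 2).
Proof.
have e1 : expR 1 * (15 / 16) ^+ 16 <= 1 :> R.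
  rewrite -ler_pdivlMl ?expR_gt0// mulr1 -expRN.
  have -> : - 1 = 16%:R * (- (1 / 16)) :> R by lra.
  rewrite expRM_natl lerXn2r ?nnegrE ?expR_ge0//.
  have := expR_ge1Dx (- (1 / 16) : R); lra.
have e2 : expR 1 <= 281 / 100 :> R.
  have : (100 / 281 : R) <= (15 / 16) ^+ 16 by lra.
  have := expR_gt0 (1 : R); set e := expR 1 in e1 *; set z := (_ ^+ 16) in e1 *.
  move=> e0 z0; have : e * (100 / 281) <= 1 by apply: le_trans e1; rewrite ler_pM2l.
  lra.
have p4 : (pi : R) <= 4 by have := @pihalf_lt2 R; lra.
have : (pi : R) * expR 1 <= 4 * (281 / 100).
  by apply: ler_pM => //; rewrite ?pi_ge0 ?expR_ge0.
lra.
Qed.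

(** A Gaussian vector with variance [1/n] in each coordinate has density at least
    [(n / (2 pi e))^(n/2)] at every point of the unit ball. *)
Lemma volume_ball_le n : (0 < n)%N ->
  (volume (@ball2 R n) <=
   (Num.sqrt (2 * pi * expR 1 / n%:R) ^+ n)%:E)%E.
Proof.
move=> n0; have nR : 0 < n%:R :> R by rewrite ltr0n.
pose s : R := Num.sqrt n%:R^-1.
have s2 : s ^+ 2 = n%:R^-1 by rewrite sqr_sqrtr// invr_ge0 ltW.
have s0 : s != 0 by rewrite gt_eqF// sqrtr_gt0 invr_gt0.
apply: (volume_le_density (phi := normal_pdf 0 s)).
- exact: measurable_normal_pdf.
- exact: normal_pdf_ge0.
- exact: integral_normal_pdf.
- by rewrite exprn_ge0 ?sqrtr_ge0.
move=> y; rewrite /ball2/= norm2_le1 => y1.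
set c := Num.sqrt _.
have cpdf t : c * normal_pdf 0 s t = expR ((1 - n%:R * t ^+ 2) / 2).
  rewrite normal_pdfE// /normal_fun /normal_peak s2 subr0.
  have -> : c = Num.sqrt (n%:R^-1 * pi *+ 2) * expR (1 / 2).
    have -> : expR (1 / 2) = Num.sqrt (expR 1) :> R.
      rewrite (_ : expR 1 = expR (1 / 2) ^+ 2) ?sqrtr_sqr ?ger0_norm ?expR_ge0//.
      by rewrite -expRM_natl; congr expR; lra.
    rewrite -sqrtrM; last by rewrite mulrn_wge0// mulr_ge0 ?pi_ge0// invr_ge0 ltW.
    by congr Num.sqrt; ring.
  set k := Num.sqrt (n%:R^-1 * _ *+ 2).
  have k0 : k != 0.
    by rewrite gt_eqF// sqrtr_gt0 mulrn_wgt0// mulr_gt0 ?pi_gt0// invr_gt0.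
  rewrite mulrACA divff// mul1r -expRD ?mul1r; congr expR.
  by field; rewrite gt_eqF.
have -> : c ^+ n = \prod_(i < n) c by rewrite prodr_const card_ord.
rewrite -big_split/=; under eq_bigr do rewrite cpdf.
rewrite -expR_sum -[leLHS]expR0 ler_expR -mulr_suml sumrB sumr_const card_ord -mulr_sumr.
rewrite (_ : \sum_i _ = dot y y); last by apply: eq_bigr => i _; rewrite expr2.
have : n%:R * dot y y <= n%:R by rewrite ler_piMr// ltW.
lra.
Qed.

Lemma sqr_le_itv (x e : R) : 0 <= e -> x ^+ 2 <= e ^+ 2 -> - e <= x <= e.
Proof. by move=> e0; rewrite -ler_norml -(real_normK (num_real x)) ler_sqr ?nnegrE. Qed.

(* A uniform point y of the box centred at (713/1000) v whose coordinates have
   variance 0.69^2 / n has <y, v> close to 0.713 and |y|^2 close to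
   0.713^2 + 0.69^2 < 1, hence <y, v> / |y| > 0.709. *)
Lemma cone_box n (v y : 'rV[R]_n) (k h : R) :
  (0 < n)%N -> dot v v = 1 -> k <= 709 / 1000 ->
  h ^+ 2 / 3 = (69 / 100) ^+ 2 / n%:R ->
  let u := y - (713 / 1000) *: v in
  (1000 / 3) ^+ 2 * (0 + \sum_i u 0 i * v 0 i) ^+ 2 +
  100 ^+ 2 * (0 + \sum_i (u 0 i ^+ 2 - h ^+ 2 / 3)) ^+ 2 < 1 ->
  exists t z, 0 <= t <= 1 /\ (sphere z /\ k <= dot z v) /\ y = t *: z.
Proof.
move=> n0 vv hk hh u; rewrite !add0r sumrB sumr_const card_ord hh.
rewrite -[\sum_i u 0 i * _]/(dot u v).
rewrite (_ : \sum_i u 0 i ^+ 2 = dot u u); last by apply: eq_bigr => i _; rewrite expr2.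
have nR : n%:R != 0 :> R by rewrite pnatr_eq0 -lt0n.
rewrite -[_ *+ n]mulr_natr divfK//.
set s := dot u v; set w := dot u u - _ => lt1.
have [s1 w1] : s ^+ 2 <= (3 / 1000) ^+ 2 /\ w ^+ 2 <= (1 / 100) ^+ 2.
  by have := sqr_ge0 s; have := sqr_ge0 w; split; lra.
have /andP[s3 s4] : - (3 / 1000) <= s <= 3 / 1000 by apply: sqr_le_itv s1; lra.
have /andP[w3 w4] : - (1 / 100) <= w <= 1 / 100 by apply: sqr_le_itv w1; lra.
have yE : y = (713 / 1000) *: v + u by rewrite addrC subrK.
clearbody u.
have yv : dot y v = 713 / 1000 + s by rewrite yE dotDl dotZl vv mulr1.
have yy : dot y y = (713 / 1000) ^+ 2 + 2 * (713 / 1000) * s + (w + (69 / 100) ^+ 2).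
  rewrite yE !(dotDl, dotDr, dotZl, dotZr) vv (dotC v u) -/s /w; lra.
have y1 : norm2 y <= 1 by rewrite norm2_le1 yy; lra.
have y0 : 0 < norm2 y.
  rewrite lt_def norm2_ge0 andbT; apply/eqP => N0.
  have : dot y y = 0 by rewrite -norm2_sqr N0 expr0n.
  by move/dot_eq0 => E; move: yv; rewrite E dot0l; lra.
exists (norm2 y), ((norm2 y)^-1 *: y); split; first by rewrite ltW.
split; last by rewrite scalerA divff ?gt_eqF// scale1r.
split; first by apply/sphereP; rewrite dotZl dotZr -norm2_sqr; field; rewrite gt_eqF.
rewrite dotZl yv mulrC ler_pdivlMr//; apply: (@le_trans _ _ (709 / 1000)); last lra.
by have [k0|k0] := leP 0 k; [apply: le_trans hk; rewrite ler_piMr|nra].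
Qed.

(** The centre [713/1000] and the standard deviation [69/100] obey two constraints. Their squares
    add up to less than 1, which keeps most of the box inside the ball, and
    [2 pi e <= 48 (69/100)^2], which gives [2 pi e / n <= (4 h)^2] and makes the box at least [2^-n]
    times as large as the ball. The condition [10^6 <= n] makes the Chebyshev error less than
    1/2. *)
Lemma normalized_volume_cap_ge n (v : 'rV[R]_n) (r : R) :
  (10 ^ 6 <= n)%N -> dot v v = 1 -> cos r <= 709 / 1000 ->
  2^-1 / 2 ^+ n <= normalized_volume (cap v r).
Proof.
move=> n6 vv cr.
have n0 : (0 < n)%N by exact: leq_trans n6.
have nR : 0 < n%:R :> R by rewrite ltr0n.
have n6R : 10 ^+ 6 <= n%:R :> R by rewrite -natrX ler_nat.
pose h : R := Num.sqrt (3 * ((69 / 100) ^+ 2 / n%:R)).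
have h2 : h ^+ 2 = 3 * ((69 / 100) ^+ 2 / n%:R).
  by rewrite sqr_sqrtr// mulr_ge0// divr_ge0 ?sqr_ge0// ltW.
have h0 : 0 < h by rewrite sqrtr_gt0 mulr_gt0// divr_gt0// exprn_gt0//; lra.
rewrite /normalized_volume; set K := [set x | _].
have KB : K `<=` @ball2 R n.
  move=> _ [t [y [/andP[t0 t1] [[/sphereP yy _] ->]]]].
  rewrite /ball2/= norm2_le1 dotZl dotZr yy mulr1.
  by rewrite -expr2 expr_le1.
have Kge : (((2 * h) ^+ n / 2)%:E <= volume K)%E.
  apply: le_trans (volume_box_ge (c := (713 / 1000) *: v) (v := v) (h := h)
    (p := 0) (q := 0) (a := (1000 / 3) ^+ 2) (b := 100 ^+ 2) h0 (sqr_ge0 _) (sqr_ge0 _) _).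
    rewrite lee_fin ler_pM2l; last by apply: exprn_gt0; lra.
    rewrite (_ : \sum_i v 0 i ^+ 2 = 1); last first.
      by rewrite -[RHS]vv; apply: eq_bigr => i _; rewrite expr2.
    have -> : n%:R * (h ^+ 4 * (4 / 45)) = 4 / 5 * (69 / 100) ^+ 4 / n%:R.
      by rewrite (exprM h 2 2) h2; field; rewrite gt_eqF.
    rewrite h2; have : n%:R^-1 <= 10 ^- 6 :> R by rewrite lef_pV2// posrE.
    lra.
  move=> y _ lt1; have := @cone_box n v y (cos r) h n0 vv cr.
  have -> : h ^+ 2 / 3 = (69 / 100) ^+ 2 / n%:R by rewrite h2; field; rewrite gt_eqF.
  move=> /(_ erefl) H.
  have [|t [z [t01 [zc ->]]]] := H.
    move: lt1; rewrite h2 => lt1; apply: le_lt_trans lt1.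
    rewrite le_eqVlt; apply/orP; left; apply/eqP; congr (_ * (_ + _) ^+ 2 + _ * (_ + _) ^+ 2).
      by apply: eq_bigr => i _; rewrite !mxE.
    by apply: eq_bigr => i _; rewrite !mxE; congr (_ - _); field; rewrite gt_eqF.
  by exists t, z.
have Ble := volume_ball_le n0.
set C := (X in (_ <= X%:E)%E) in Ble.
(* [fine] sends infinite volumes to 0, so finiteness has to be settled before any comparison. *)
have Bfin : volume (@ball2 R n) \is a fin_num.
  by rewrite ge0_fin_numE ?volume_ge0//; apply: le_lt_trans Ble _; rewrite ltry.
have Kfin : volume K \is a fin_num.
  rewrite ge0_fin_numE ?volume_ge0//; apply: le_lt_trans (volume_le KB) _.
  by apply: le_lt_trans Ble _; rewrite ltry.
have K1 : (2 * h) ^+ n / 2 <= fine (volume K) by rewrite -lee_fin fineK.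
have B1 : fine (volume (@ball2 R n)) <= C by rewrite -lee_fin fineK.
have KB1 : fine (volume K) <= fine (volume (@ball2 R n)).
  by rewrite -lee_fin !fineK// volume_le.
have hn0 : 0 < (2 * h) ^+ n by rewrite exprn_gt0// mulr_gt0.
have B0 : 0 < fine (volume (@ball2 R n)).
  by apply: lt_le_trans KB1; apply: lt_le_trans K1; rewrite divr_gt0.
rewrite ler_pdivlMr//; apply: le_trans K1.
apply: (@le_trans _ _ (2^-1 / 2 ^+ n * C)).
  by rewrite ler_pM2l// divr_gt0// ?invr_gt0// exprn_gt0.
rewrite mulrC [leRHS]mulrC mulrCA ler_pM2l ?invr_gt0// ler_pdivrMr ?exprn_gt0//.
rewrite /C -exprMn lerXn2r ?nnegrE ?sqrtr_ge0 ?mulr_ge0 ?(ltW h0)//.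
rewrite -ler_sqr ?nnegrE ?sqrtr_ge0 ?mulr_ge0 ?(ltW h0)// sqr_sqrtr; last first.
  by rewrite divr_ge0 ?mulr_ge0 ?pi_ge0 ?expR_ge0// ltW.
rewrite !exprMn h2 ler_pdivrMr//; have := twopie_le.
have : n%:R^-1 * n%:R = 1 :> R by rewrite mulVf// gt_eqF.
set e := n%:R^-1; nra.
Qed.

End Caps.

(** * Radius and density of the packing *)

Section Packing.
Context {R : realType}.

(** A common point [x] would satisfy [<x, v_i + v_j> >= 1.418], whereas [|v_i + v_j|^2 <= 2 + 2/200
    = 2.01 < 1.418^2]. This is why 0.709 lies slightly above [1 / sqrt 2]. *)
Lemma caps_disjoint m n (v : 'I_m -> 'rV[R]_n) :
  (forall i, sphere (v i)) ->
  (forall i j, i != j -> dot (v i) (v j) <= 1 / 200) ->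
  trivIset setT (fun i => cap (v i) (acos (709 / 1000))).
Proof.
move=> vS vij; apply/trivIsetP => i j _ _ /vij dij.
have k1 : 709 / 1000 \in `[-1, 1 : R] by rewrite in_itv/=; apply/andP; split; lra.
apply/seteqP; split => // x [[/sphereP xx xi] [_ xj]].
rewrite (acosK k1) in xi xj.
have vv k : dot (v k) (v k) = 1 by apply/sphereP.
have := dot_CauchySchwarz x (v i + v j).
rewrite !(dotDl, dotDr) xx !vv (dotC (v j) (v i)) mul1r.
set a := dot x (v i) in xi *; set b := dot x (v j) in xj *.
set c := dot _ _ in dij *; move: xi xj dij.
move=> xi xj dij h.
have ab : 1418 / 1000 <= a + b by lra.
have : (1418 / 1000) * (1418 / 1000) <= (a + b) * (a + b) by apply: ler_pM; lra.
lra.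
Qed.

Lemma cos_max_radius m n (v : 'I_m -> 'rV[R]_n) :
  (forall i, sphere (v i)) ->
  (forall i j, i != j -> dot (v i) (v j) <= 1 / 200) ->
  cos (max_radius v) <= 709 / 1000.
Proof.
move=> vS vij; have k1 : (-1 <= (709 / 1000 : R)) && ((709 / 1000 : R) <= 1).
  by apply/andP; split; lra.
set S := [set r | 0 <= r <= pi /\ trivIset setT (fun i => cap (v i) r)].
have S0 : S (acos (709 / 1000)).
  by split; [rewrite acos_ge0 ?acos_lepi|exact: caps_disjoint].
have ubS : ubound S pi by move=> r [/andP[]].
have hS : has_sup S by split; [exists (acos (709 / 1000))|exists pi].
have le1 : acos (709 / 1000) <= sup S by apply: ub_le_sup => //; exists pi.
have le2 : sup S <= pi by apply: ge_sup => //; exists (acos (709 / 1000)).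
rewrite -[leRHS]acosK ?in_itv//= /max_radius -/S leNgt ltr_cos -?leNgt//.
- by rewrite in_itv/= le2 andbT; apply: le_trans le1; rewrite acos_ge0.
- by rewrite in_itv/= acos_ge0 ?acos_lepi.
Qed.

(** The bound [m 2^-n / 2] is already enough: [m >= n], and the square root is at least 1 because
    [m / n >= 2]. *)
Lemma density_ge m n (v : 'I_m -> 'rV[R]_n) i :
  (10 ^ 6 <= n)%N -> (16 * n <= m)%N ->
  (forall i, sphere (v i)) ->
  (forall i j, i != j -> dot (v i) (v j) <= 1 / 200) ->
  2^-1 * (n%:R / (2 ^+ n * Num.sqrt (log2 (m%:R / n%:R)))) <=
    m%:R * normalized_volume (cap (v i) (max_radius v)).
Proof.
move=> n6 nm vS vij.
have n0 : (0 < n)%N by exact: leq_trans n6.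
have nR : 0 < n%:R :> R by rewrite ltr0n.
have vv : dot (v i) (v i) = 1 by apply/sphereP.
have := normalized_volume_cap_ge n6 vv (cos_max_radius vS vij).
set V := normalized_volume _ => V0.
have mn : 2 <= m%:R / n%:R :> R.
  rewrite ler_pdivlMr// -natrM ler_nat; apply: leq_trans nm.
  by rewrite leq_mul2r orbT.
have l1 : 1 <= Num.sqrt (log2 (m%:R / n%:R)) :> R.
  rewrite -[leLHS]sqrtr1 ler_wsqrtr// /log2 ler_pdivlMr; last first.
    by apply: ln_gt0; lra.
  by rewrite mul1r ler_ln// posrE; lra.
have p2 : 0 < 2 ^+ n :> R by rewrite exprn_gt0.
apply: (@le_trans _ _ (n%:R * (2^-1 / 2 ^+ n))).
  rewrite [leRHS]mulrCA ler_pM2l ?invr_gt0// ler_pM2l// lef_pV2 ?posrE//.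
    by rewrite ler_peMr// ltW.
  by rewrite mulr_gt0// (lt_le_trans ltr01).
have c0 : 0 <= 2^-1 / 2 ^+ n :> R by rewrite divr_ge0 ?invr_ge0// ltW.
have nm1 : (n <= m)%N by apply: leq_trans nm; exact: leq_pmull.
by apply: ler_pM V0; rewrite ?ler0n ?ler_nat.
Qed.

End Packing.

(** * Integer projections *)

Section Gram.
Context {F : fieldType}.

Definition gram n k (V : 'M[F]_(n, k)) : 'M[F]_k := V^T *m V.

Definition gram_proj n k (V : 'M[F]_(n, k)) : 'M[F]_n :=
  1%:M - V *m invmx (gram V) *m V^T.

Lemma tr_gram n k (V : 'M[F]_(n, k)) : (gram V)^T = gram V.
Proof. by rewrite trmx_mul trmxK. Qed.

Lemma tr_gram_proj n k (V : 'M[F]_(n, k)) : (gram_proj V)^T = gram_proj V.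
Proof.
by rewrite /gram_proj linearB/= trmx1 !trmx_mul trmxK trmx_inv tr_gram mulmxA.
Qed.

Lemma gram_proj_mul n k (V : 'M[F]_(n, k)) :
  gram V \in unitmx -> gram_proj V *m V = 0.
Proof.
by move=> Vu; rewrite mulmxBl mul1mx -!mulmxA -/(gram V) mulVmx// mulmx1 subrr.
Qed.

(** The hypotheses give [P Q = P] and [Q P = Q], and transposing the second turns it into
    [P Q = Q]. *)
Lemma proj_unique n k (V : 'M[F]_(n, k)) (P Q : 'M[F]_n) C C' :
  P^T = P -> Q^T = Q -> P *m V = 0 -> Q *m V = 0 ->
  P = 1%:M - V *m C -> Q = 1%:M - V *m C' -> P = Q.
Proof.
move=> Pt Qt PV QV PE QE.
have PQ : P *m Q = P by rewrite {1}QE mulmxBr mulmx1 mulmxA PV mul0mx subr0.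
have QP : Q *m P = Q by rewrite {1}PE mulmxBr mulmx1 mulmxA QV mul0mx subr0.
by rewrite -PQ -{1}Pt -Qt -trmx_mul QP.
Qed.

Lemma det_schur k (G : 'M[F]_k) (b : 'M[F]_(k, 1)) (c : 'M[F]_(1, k)) (a : 'M[F]_1) :
  G \in unitmx ->
  \det (block_mx G b c a) = \det G * (a - c *m invmx G *m b) 0 0.
Proof.
move=> Gu.
have -> : block_mx G b c a = block_mx 1%:M 0 (c *m invmx G) 1%:M *m
    block_mx G b 0 (a - c *m invmx G *m b).
  rewrite mulmx_block !mul1mx !mul0mx !addr0.
  by rewrite mulmxKV// addrC subrK.
by rewrite det_mulmx det_lblock det_ublock !det1 !mul1r det_mx11.
Qed.

Lemma gram_row_mx n k (V : 'M[F]_(n, k)) (v : 'cV[F]_n) :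
  gram (row_mx V v) = block_mx (gram V) (V^T *m v) (v^T *m V) (v^T *m v).
Proof. by rewrite /gram tr_row_mx mul_col_row. Qed.

Lemma det_gram_row_mx n k (V : 'M[F]_(n, k)) (v : 'cV[F]_n) :
  gram V \in unitmx ->
  \det (gram (row_mx V v)) = \det (gram V) * (v^T *m gram_proj V *m v) 0 0.
Proof.
move=> Vu; rewrite gram_row_mx det_schur//; congr (_ * _).
by rewrite /gram_proj mulmxBr mulmx1 mulmxBl !mulmxA.
Qed.

(** A Gram-Schmidt step: the direction [P v] is removed. As [P v] lies in the span of the columns of
    [V] and [v], with coefficients [w], the right-hand side has the form required by
    [proj_unique]. *)
Lemma gram_proj_row_mx n k (V : 'M[F]_(n, k)) (v : 'cV[F]_n) :
  let P := gram_proj V in let e := (v^T *m P *m v) 0 0 in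
  gram V \in unitmx -> e != 0 ->
  gram_proj (row_mx V v) = P - e^-1 *: (P *m v *m (P *m v)^T).
Proof.
move=> P e Vu e0.
have V'u : gram (row_mx V v) \in unitmx.
  by rewrite unitmxE det_gram_row_mx// unitrM -unitmxE Vu unitfE.
have PV : P *m V = 0 by exact: gram_proj_mul.
have Pt : P^T = P by exact: tr_gram_proj.
have VP : V^T *m P = 0 by rewrite -Pt -trmx_mul PV trmx0.
pose c := col_mx (invmx (gram V) *m V^T) (0 : 'rV[F]_n).
pose w := col_mx (- (invmx (gram V) *m (V^T *m v))) (1%:M : 'M[F]_1).
have PvE : P *m v = row_mx V v *m w.
  by rewrite mul_row_col mulmx1 mulmxN /P /gram_proj mulmxBl mul1mx !mulmxA [RHS]addrC.
apply: (@proj_unique n _ (row_mx V v) _ _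
  (invmx (gram (row_mx V v)) *m (row_mx V v)^T)
  (c + e^-1 *: (w *m (P *m v)^T))).
- exact: tr_gram_proj.
- by rewrite linearB linearZ/= Pt (trmx_mul (P *m v)) trmxK.
- exact: gram_proj_mul.
- have E (q : nat) (X : 'M[F]_(n, q)) : (P - e^-1 *: (P *m v *m (P *m v)^T)) *m X =
      P *m X - e^-1 *: (P *m v *m (v^T *m (P *m X))).
    by rewrite mulmxBl -scalemxAl trmx_mul Pt !mulmxA.
  rewrite E mul_mx_row PV mul_mx_row mulmx0 mul_mx_row mulmx0.
  rewrite scale_row_mx scaler0 opp_row_mx add_row_mx oppr0 addr0.
  rewrite (_ : v^T *m (P *m v) = e%:M); last first.
    by rewrite mulmxA [LHS]mx11_scalar.
  by rewrite mul_mx_scalar scalerA mulVf// scale1r subrr row_mx0.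
- by rewrite /gram_proj -mulmxA.
- rewrite mulmxDr -scalemxAr mulmxA -PvE opprD addrA; congr (_ - _).
  by rewrite mul_row_col mulmx0 addr0 /P /gram_proj mulmxA.
Qed.

End Gram.

Section IntegerProjection.

(* (N, d) represents the orthogonal projection d^-1 N onto the orthogonal
   complement of the columns of V, where d is their Gram determinant: in this
   form all entries are integers of polynomial bit length. *)
Definition gram_rep n (S : 'M[int]_n * int) : Prop :=
  exists k (V : 'M[int]_(n, k)),
    [/\ S.2 = \det (V^T *m V), 0 < S.2 &
        S.1 = S.2%:M - V *m \adj (V^T *m V) *m V^T].

Definition idot n (x y : 'rV[int]_n) : int := \sum_(k < n) x 0 k * y 0 k.

Definition proj_vec n (N : 'M[int]_n) (v : 'rV[int]_n) : 'rV[int]_n :=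
  \row_k \sum_(l < n) N k l * v 0 l.

(** The fraction-free form of [gram_proj_row_mx], as in Bareiss elimination: [e] is the new Gram
    determinant, and the division by the old one is exact. If [e] is 0, then [v] is already in the
    span and the projection does not change. *)
Definition proj_step n (S : 'M[int]_n * int) (v : 'rV[int]_n) :
    'M[int]_n * int :=
  let u := proj_vec S.1 v in let e := idot u v in
  if 0 < e then
    (\matrix_(k, l) divz (e * S.1 k l - u 0 k * u 0 l) S.2, e)
  else S.

Lemma gram_rep1 n : gram_rep (1%:M : 'M[int]_n, 1).
Proof.
exists 0%N, 0; split => //=; first by rewrite det_mx00.
by rewrite mul0mx mul0mx subr0.
Qed.

Context {F : numFieldType}.

Definition rproj n (S : 'M[int]_n * int) : 'M[F]_n :=
  (S.2%:~R)^-1 *: map_mx intr S.1.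

Lemma gram_map n k (V : 'M[int]_(n, k)) :
  gram (map_mx intr V : 'M[F]_(n, k)) = map_mx intr (V^T *m V).
Proof. by rewrite /gram map_trmx -map_mxM. Qed.

Lemma rproj_gram n (S : 'M[int]_n * int) k (V : 'M[int]_(n, k)) :
  S.2 = \det (V^T *m V) -> 0 < S.2 ->
  S.1 = S.2%:M - V *m \adj (V^T *m V) *m V^T ->
  gram (map_mx intr V : 'M[F]_(n, k)) \in unitmx /\
  rproj S = gram_proj (map_mx intr V).
Proof.
move=> dE d0 NE.
have dF : S.2%:~R != 0 :> F by rewrite intr_eq0 gt_eqF.
have dG : \det (gram (map_mx intr V : 'M[F]_(n, k))) = S.2%:~R.
  by rewrite gram_map det_map_mx dE.
have Vu : gram (map_mx intr V : 'M[F]_(n, k)) \in unitmx.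
  by rewrite unitmxE dG unitfE.
split => //; rewrite /rproj NE map_mxB map_scalar_mx !map_mxM map_mx_adj -map_trmx.
rewrite scalerBr scale_scalar_mx mulVf// /gram_proj; congr (_ - _).
by rewrite /invmx Vu dG -gram_map -scalemxAr -scalemxAl.
Qed.

Lemma gram_rep_proj n (S : 'M[int]_n * int) : gram_rep S ->
  (rproj S)^T = rproj S /\ rproj S *m rproj S = rproj S.
Proof.
move=> [k [V [dE d0 NE]]]; have [Vu ->] := rproj_gram dE d0 NE.
split; first exact: tr_gram_proj.
by rewrite {2}/gram_proj mulmxBr mulmx1 !mulmxA gram_proj_mul// !mul0mx subr0.
Qed.

Lemma rank1_updateE n (A : 'M[F]_n) c (x : 'cV[F]_n) i j :
  (A - c *: (x *m x^T)) i j = A i j - c * (x i 0 * x j 0).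
Proof. by rewrite !mxE big_ord1 !mxE. Qed.

Lemma proj_vecE n (S : 'M[int]_n * int) v : 0 < S.2 ->
  map_mx intr (proj_vec S.1 v)^T = S.2%:~R *: (rproj S *m (map_mx intr v)^T) :> 'cV[F]_n.
Proof.
move=> d0; have dF : S.2%:~R != 0 :> F by rewrite intr_eq0 gt_eqF.
rewrite /rproj -scalemxAl scalerA divff// scale1r.
apply/colP => i; rewrite !mxE rmorph_sum/=; apply: eq_bigr => j _.
by rewrite rmorphM/= !mxE.
Qed.

Lemma proj_step_spec n (S : 'M[int]_n * int) (v : 'rV[int]_n) :
  let P := rproj S in let w : 'cV[F]_n := (map_mx intr v)^T in
  let e := (w^T *m P *m w) 0 0 in
  gram_rep S ->
  [/\ gram_rep (proj_step S v),
      (idot (proj_vec S.1 v) v)%:~R = S.2%:~R * e,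
      e = 0 -> proj_step S v = S &
      0 < e -> rproj (proj_step S v) = P - e^-1 *: (P *m w *m (P *m w)^T)
        /\ (proj_step S v).2%:~R = S.2%:~R * e].
Proof.
move=> P w e Sg; have [Pt PP] := gram_rep_proj Sg.
have [k [V [dE d0 NE]]] := Sg; have [Vu PE] := rproj_gram dE d0 NE.
have dF : 0 < S.2%:~R :> F by rewrite ltr0z.
set u := proj_vec S.1 v; set ei := idot u v.
have uE := proj_vecE v d0.
have eiE : ei%:~R = S.2%:~R * e.
  have -> : ei%:~R = (map_mx intr v *m (map_mx intr u)^T) 0 0 :> F.
    rewrite mxE /ei /idot rmorph_sum/=; apply: eq_bigr => i _.
    by rewrite rmorphM/= !mxE mulrC.
  by rewrite map_trmx uE -scalemxAr mxE /e /w trmxK mulmxA.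
have [e0|ne0] := eqVneq e 0.
  have ei0 : ei = 0 by apply: (@intr_inj F); rewrite eiE e0 mulr0.
  have St : proj_step S v = S by rewrite /proj_step -/u -/ei ei0.
  by split; rewrite ?St// => h; rewrite e0 ltxx in h.
have eP : e = \sum_i (P *m w) i 0 * (P *m w) i 0.
  have -> : e = ((P *m w)^T *m (P *m w)) 0 0.
    by rewrite trmx_mul Pt mulmxA -(mulmxA _ P P) PP.
  by rewrite mxE; apply: eq_bigr => i _; rewrite mxE.
(* In a [numFieldType] squares are known to be nonnegative only for real elements; these come from
   integers. *)
have wR i : (P *m w) i 0 \is Num.real.
  by rewrite mxE rpred_sum// => j _; rewrite !mxE rpredM ?rpredV ?realz// rpredM ?rpredV ?realz.
have egt0 : 0 < e.
  rewrite lt_def ne0 eP sumr_ge0// => i _.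
  by rewrite -expr2 real_exprn_even_ge0.
have ei0 : 0 < ei by rewrite -(@ltr0z F) eiE mulr_gt0.
pose V' := row_mx V v^T.
have mV' : map_mx intr V' = row_mx (map_mx intr V) w :> 'M[F]_(n, k + 1).
  by rewrite map_row_mx -map_trmx.
have detV' : ei = \det (V'^T *m V').
  apply: (@intr_inj F); rewrite -det_map_mx -gram_map mV' det_gram_row_mx//.
  by rewrite -PE -/P eiE gram_map det_map_mx dE.
pose N' := ei%:M - V' *m \adj (V'^T *m V') *m V'^T.
have [V'u P'E] := @rproj_gram n (N', ei) _ V' detV' ei0 erefl.
rewrite mV' gram_proj_row_mx// in P'E; last by rewrite -PE.
rewrite -PE -/P -/e in P'E.
have eiF : ei%:~R != 0 :> F by rewrite intr_eq0 gt_eqF.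
have hP i j : (S.1 i j)%:~R = S.2%:~R * P i j by rewrite !mxE mulVKf// gt_eqF.
have hN i j : (N' i j)%:~R = ei%:~R * rproj (N', ei) i j by rewrite !mxE mulVKf.
have hu i : (u 0 i)%:~R = S.2%:~R * (P *m w) i 0.
  by move/colP/(_ i): uE; rewrite !mxE => ->; congr (_ * _); rewrite mxE.
(* [N'] is an integer matrix by its expression through the adjugate, which is what makes the
   division in [proj_step] exact. *)
have N'E i j : S.2 * N' i j = ei * S.1 i j - u 0 i * u 0 j.
  apply: (@intr_inj F); rewrite intrM intrB !intrM hN hP !hu P'E eiE.
  by rewrite rank1_updateE; field.
have stE : proj_step S v = (N', ei).
  rewrite /proj_step -/u -/ei ei0; congr pair; apply/matrixP => i j.
  by rewrite mxE -N'E mulKz// gt_eqF.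
split => //.
- by rewrite stE; exists (k + 1)%N, V'.
- by move=> e0; rewrite e0 eqxx in ne0.
- by rewrite stE.
Qed.

End IntegerProjection.

(** * The walk *)

Section Weights.
Context {R : realType}.

Lemma ln_MVT (q : {poly R}) (a b : R) : 0 < a -> a <= b ->
  exists2 c, a <= c <= b &
    (ln b - q.[b]) - (ln a - q.[a]) = (c^-1 - q^`().[c]) * (b - a).
Proof.
move=> a0 ab; have [||c] := @MVT_segment R (fun y => ln y - q.[y])
    (fun y => y^-1 - q^`().[y]) a b ab.
- move=> y; rewrite in_itv/= => /andP[ay _].
  have y0 : 0 < y by exact: lt_trans ay.
  by apply: is_deriveB; exact: is_derive1_ln.
- move=> y; apply: continuous_in_subspaceT => {}y; rewrite inE/= in_itv/= => /andP[ay _].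
  apply: cvgB; last exact: continuous_horner.
  by apply: continuous_ln; exact: lt_le_trans ay.
by rewrite in_itv/= => cab E; exists c.
Qed.

(** The mean value theorem for [ln] minus a polynomial [q]. For [z >= 0] the quadratic Taylor
    polynomial is a lower bound. For [z < 0] the cubic term gets coefficient 1 instead of 1/3, so
    that the derivative of the difference, [(c - 1)^2 (1/c - 3)], keeps its sign on [[1/2, 1]]; then
    [|z|^3 <= e z^2]. *)
Lemma ln1D_ge (z e : R) : `|z| <= e -> e <= 1 / 2 ->
  z - (1 / 2 + e) * z ^+ 2 <= ln (1 + z).
Proof.
move=> ze e2; have [z0|z0] := leP 0 z.
  pose q : {poly R} := ('X - 1%:P) - 2^-1 *: ('X - 1%:P) ^+ 2.
  have qE y : q.[y] = (y - 1) - (y - 1) ^+ 2 / 2 by rewrite /q !(hornerE, horner_exp)/=; field.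
  have q'E y : q^`().[y] = 2 - y.
    rewrite /q derivB derivZ derivXsubC expr2 derivM derivXsubC.
    by rewrite !(hornerE, horner_exp)/=; field.
  have z1 : 1 <= 1 + z by rewrite lerDl.
  have [c /andP[c1 _]] := ln_MVT q ltr01 z1.
  rewrite !qE q'E ln1 => E.
  have c0 : 0 < c by exact: lt_le_trans c1.
  have : 0 <= (c^-1 - (2 - c)) * (1 + z - 1).
    apply: mulr_ge0; last lra.
    rewrite (_ : c^-1 - (2 - c) = (c - 1) ^+ 2 / c); last by field; rewrite gt_eqF.
    by rewrite divr_ge0 ?sqr_ge0// ltW.
  rewrite -E; have := sqr_ge0 z; have := normr_ge0 z; nra.
pose q : {poly R} := ('X - 1%:P) - 2^-1 *: ('X - 1%:P) ^+ 2 + ('X - 1%:P) ^+ 3.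
have qE y : q.[y] = (y - 1) - (y - 1) ^+ 2 / 2 + (y - 1) ^+ 3.
  by rewrite /q !(hornerE, horner_exp)/=; field.
have q'E y : q^`().[y] = 2 - y + 3 * (y - 1) ^+ 2.
  rewrite /q derivD derivB derivZ !exprS expr0 mulr1 !(derivM, derivXsubC).
  by rewrite !(hornerE, horner_exp)/=; field.
have z1 : 1 + z <= 1 by lra.
have nz : `|z| = - z by rewrite ltr0_norm.
have z2 : 0 < 1 + z by lra.
have [c /andP[c1 c2]] := ln_MVT q z2 z1.
rewrite !qE q'E ln1 => E.
have c0 : 0 < c by exact: lt_le_trans c1.
have : (c^-1 - (2 - c + 3 * (c - 1) ^+ 2)) * (1 - (1 + z)) <= 0.
  rewrite (_ : c^-1 - _ = (c - 1) ^+ 2 * (c^-1 - 3)); last by field; rewrite gt_eqF.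
  apply: mulr_le0_ge0; last lra.
  apply: mulr_ge0_le0; first exact: sqr_ge0.
  have : c^-1 <= 3 by rewrite -[3]invrK lef_pV2 ?posrE ?invr_gt0//; lra.
  lra.
rewrite -E nz in ze *.
have : (- z) * z ^+ 2 <= e * z ^+ 2 by rewrite ler_wpM2r ?sqr_ge0.
lra.
Qed.

Lemma expR_le1D (z e : R) : `|z| <= e -> e <= 1 / 2 ->
  expR (z - (1 / 2 + e) * z ^+ 2) <= 1 + z.
Proof.
move=> ze e2; have z0 : 0 < 1 + z by move: ze; rewrite ler_norml => /andP[? ?]; lra.
by rewrite -[leRHS]lnK ?posrE// ler_expR ln1D_ge.
Qed.

(** A step multiplies the total by at most [G], because the weighted sum of the [u] is not positive,
    and each single weight by at least [G exp(u - (1/2 + e) u^2)]. Comparing a weight with the total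
    then bounds its exponent. *)
Lemma multiplicative_weights (n J : nat) (W u : nat -> nat -> R) (G e : R) :
  0 < G -> e <= 1 / 2 ->
  (forall l j, (l < n)%N -> (j < J)%N -> W l.+1 j = G * (W l j * (1 + u l j))) ->
  (forall l j, (l < n)%N -> (j < J)%N -> `|u l j| <= e) ->
  (forall l, (l < n)%N -> \sum_(j < J) W l j * u l j <= 0) ->
  (forall j, (j < J)%N -> 0 < W 0%N j) ->
  (forall j, (j < J)%N -> 0 < W n j) /\
  (forall j, (j < J)%N ->
     G ^+ n * (W 0%N j * expR (\sum_(l < n) u l j - (1 / 2 + e) * \sum_(l < n) u l j ^+ 2))
       <= W n j) /\
  \sum_(j < J) W n j <= G ^+ n * \sum_(j < J) W 0%N j.
Proof.
move=> G0 e2; elim: n => [|n IH] WE ue Wu W0.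
  split => //; split; last by rewrite expr0 mul1r.
  by move=> j jJ; rewrite !big_ord0 mulr0 subr0 expR0 expr0 !mulr1 mul1r.
have [||||Wn0 [Wn WS]] := IH.
- by move=> l j ln; apply: WE; exact: ltnW.
- by move=> l j ln; apply: ue; exact: ltnW.
- by move=> l ln; apply: Wu; exact: ltnW.
- by [].
have u1 j : (j < J)%N -> 0 < 1 + u n j.
  by move=> jJ; have := ue n j (ltnSn n) jJ; rewrite ler_norml => /andP[? ?]; lra.
split; [|split].
- by move=> j jJ; rewrite WE// mulr_gt0// mulr_gt0 ?Wn0 ?u1.
- move=> j jJ; rewrite WE// exprS -mulrA ler_pM2l//.
  have := Wn j jJ; set w := W 0%N j; rewrite !big_ord_recr/=.
  set U := \sum_(l < n) _; set Q := \sum_(l < n) _ => h.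
  rewrite (_ : U + u n j - _ = (U - (1 / 2 + e) * Q) +
    (u n j - (1 / 2 + e) * u n j ^+ 2)); last by ring.
  rewrite expRD (mulrA w) (mulrA (G ^+ n)); apply: ler_pM.
  + by apply: mulr_ge0; [rewrite exprn_ge0 ?ltW|rewrite mulr_ge0 ?expR_ge0 ?ltW ?W0].
  + exact: expR_ge0.
  + exact: h.
  + exact: (expR_le1D (ue _ _ (ltnSn n) jJ) e2).
- have -> : \sum_(j < J) W n.+1 j =
      G * (\sum_(j < J) W n j + \sum_(j < J) W n j * u n j).
    rewrite -big_split mulr_sumr/=; apply: eq_bigr => j _.
    by rewrite WE// mulrDr mulr1.
  rewrite exprS -mulrA ler_pM2l//; apply: le_trans WS.
  by rewrite gerDl Wu.
Qed.

End Weights.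

(** * The construction on integer vectors *)

Section Algorithm.
Variables (n K g D : nat).

(* The condition <v, x> > g D^2 (2 Lambda + 4), multiplied by g to be
   integral. *)
Definition frozen (v x : 'rV[int]_n) : bool :=
  0 < g%:Z * idot v x - (K%:Z * K%:Z * n%:Z + 4 * (g%:Z * g%:Z)) * (D%:Z * D%:Z).

Definition frozen_proj (V : nat -> 'rV[int]_n) (i : nat) (x : 'rV[int]_n) :
    'M[int]_n * int :=
  iteri i (fun j S => if frozen (V j) x then proj_step S (V j) else S) (1%:M, 1).

(** The index is a natural number because the substeps are iterated by [iteri]; out of range the
    column is 0. *)
Definition column (S : 'M[int]_n * int) (l : nat) : 'rV[int]_n :=
  oapp (fun l' : 'I_n => \row_k divz (D%:Z * S.1 k l') S.2) 0 (insub l).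

(* Index i carries the weight that controls the norm of the new vector x. *)
Definition gain (V : nat -> 'rV[int]_n) (i : nat) (x y : 'rV[int]_n) (j : nat) : int :=
  if j == i then - K%:Z * idot x y else g%:Z * idot (V j) y.

(** The common factor that keeps the weights integral. A gain divided by it is the relative change
    of a weight: [<V_j, y> / (g D^2)] for a vector and [- K <x, y> / (g^2 D^2)] for the norm. *)
Definition scale : int := g%:Z * g%:Z * (D%:Z * D%:Z).

Definition substep (V : nat -> 'rV[int]_n) (i : nat) (S : 'M[int]_n * int)
    (l : nat) (st : 'rV[int]_n * (nat -> int)) : 'rV[int]_n * (nat -> int) :=
  let z := gain V i st.1 (column S l) in
  let s := if 0 < \sum_(j < i.+1) st.2 j * z j then -1 else 1 : int in
  (st.1 + s *: column S l, fun j => st.2 j * (scale + s * z j)).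

(** The guard is tested only between rounds, so the norm can exceed [sqrt(n K) D] by the [n] columns
    of one round. *)
Definition round (V : nat -> 'rV[int]_n) (i : nat)
    (st : 'rV[int]_n * (nat -> int)) : 'rV[int]_n * (nat -> int) :=
  if 0 < n%:Z * K%:Z * (D%:Z * D%:Z) - idot st.1 st.1
  then iteri n (substep V i (frozen_proj V i st.1)) st else st.

Definition walk (V : nat -> 'rV[int]_n) (i m : nat) : 'rV[int]_n * (nat -> int) :=
  iter K (round V i) (0, fun j => if j == i then m%:Z else 1).

(** The basis vector is a fallback that keeps the output on the sphere for every [m] and [n], even
    where the analysis of the walk does not apply. *)
Definition new_vector (V : nat -> 'rV[int]_n) (i m : nat) : 'rV[int]_n :=
  let x := (walk V i m).1 in
  if 0 < idot x x then x else \row_k ((k : nat) == 0)%:Z.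

Definition code (m : nat) : nat -> nat -> 'rV[int]_n :=
  fun i => iteri i (fun i V j => if j == i then new_vector V i m else V j)
             (fun=> 0).

End Algorithm.

(** * Rounded columns of an orthogonal projection *)

Section Projection.
Context {R : realType}.

Lemma dot_le_norm2 n (x y : 'rV[R]_n) : `|dot x y| <= norm2 x * norm2 y.
Proof.
rewrite -ler_sqr ?nnegrE ?mulr_ge0 ?norm2_ge0// real_normK ?num_real//.
by rewrite exprMn !norm2_sqr dot_CauchySchwarz.
Qed.

Lemma norm2D n (x y : 'rV[R]_n) : norm2 (x + y) <= norm2 x + norm2 y.
Proof.
rewrite -ler_sqr ?nnegrE ?addr_ge0 ?norm2_ge0// norm2_sqr sqrrD !norm2_sqr.
rewrite !(dotDl, dotDr) (dotC y x).
by have := dot_le_norm2 x y; rewrite ler_norml => /andP[_ ?]; lra.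
Qed.

Lemma norm2Z n (a : R) (x : 'rV[R]_n) : norm2 (a *: x) = `|a| * norm2 x.
Proof. by rewrite /norm2 dotZl dotZr mulrA -expr2 sqrtrM ?sqr_ge0// sqrtr_sqr. Qed.

Lemma sqrD_weighted (a b s t : R) : 0 < s -> 0 < t ->
  (a + b) ^+ 2 <= (1 + t / s) * a ^+ 2 + (1 + s / t) * b ^+ 2.
Proof.
move=> s0 t0; rewrite -subr_ge0.
rewrite (_ : _ - _ = (t * a - s * b) ^+ 2 / (s * t)); last first.
  by field; rewrite !gt_eqF.
by rewrite divr_ge0 ?sqr_ge0// mulr_ge0// ltW.
Qed.

Variables (n : nat) (P : 'M[R]_n) (Y : 'I_n -> 'rV[R]_n) (D : R).
Hypothesis n0 : (0 < n)%N.
Hypothesis D0 : 0 < D.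
Hypothesis Pt : P^T = P.
Hypothesis PP : P *m P = P.
Hypothesis YP : forall l k, `|Y l 0 k - D * P k l| <= 1.

Let nR : 0 < n%:R :> R. Proof. by rewrite ltr0n. Qed.

Lemma proj_diag l : \sum_k P k l ^+ 2 = P l l.
Proof.
rewrite -[in RHS]PP mxE; apply: eq_bigr => k _.
by rewrite -{2}Pt mxE expr2.
Qed.

Lemma proj_diag_le1 l : 0 <= P l l <= 1.
Proof.
have h : P l l ^+ 2 <= P l l.
  rewrite -[leRHS]proj_diag (bigD1 l)//= lerDl sumr_ge0// => k _.
  exact: sqr_ge0.
have h0 : 0 <= P l l by rewrite -proj_diag sumr_ge0// => k _; exact: sqr_ge0.
by rewrite h0/=; nra.
Qed.

Lemma proj_entry_le1 k l : `|P k l| <= 1.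
Proof.
rewrite -(@expr_le1 _ 2)// real_normK ?num_real//.
apply: (@le_trans _ _ (P l l)); last by case/andP: (proj_diag_le1 l).
rewrite -[leRHS]proj_diag (bigD1 k)//= lerDl sumr_ge0// => j _.
exact: sqr_ge0.
Qed.

Lemma proj_norm_le (v : 'rV[R]_n) : \sum_l (v *m P) 0 l ^+ 2 <= dot v v.
Proof.
have E (a b : 'rV[R]_n) : dot a b = (a *m b^T) 0 0.
  by rewrite mxE; apply: eq_bigr => i _; rewrite mxE.
have -> : \sum_l (v *m P) 0 l ^+ 2 = dot (v *m P) (v *m P).
  by apply: eq_bigr => i _; rewrite expr2.
have vPv : dot (v *m P) v = dot (v *m P) (v *m P).
  by rewrite !E trmx_mul Pt mulmxA -(mulmxA v P P) PP.
have := dot_ge0 (v + (-1) *: (v *m P)).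
rewrite !(dotDl, dotDr, dotZl, dotZr) (dotC v) vPv; lra.
Qed.

Let err l := Y l - D *: (\row_k P k l).

Let Yerr l : Y l = D *: (\row_k P k l) + err l.
Proof. by rewrite addrC subrK. Qed.

Let err_le1 l k : `|err l 0 k| <= 1.
Proof. by have := YP l k; rewrite !mxE. Qed.

Let dot_err l : dot (err l) (err l) <= n%:R.
Proof.
rewrite -[leRHS]mulr1 -[n in n%:R]card_ord mulr_natl -sumr_const.
apply: ler_sum => k _; rewrite -expr2 -[leRHS](expr1n _ 2) -(real_normK (num_real (err l 0 k))).
by rewrite lerXn2r ?nnegrE.
Qed.

Let dot_row v l : dot v (\row_k P k l) = (v *m P) 0 l.
Proof. by rewrite mxE; apply: eq_bigr => k _; rewrite !mxE. Qed.

(** The exact columns form a tight frame, so their squared inner products with [v] add up to at most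
    [D^2 |v|^2]; the rounding errors have squared length at most [n] each. The weights [D] and [n]
    in [sqrD_weighted] combine both contributions to exactly [(D + n)^2]. *)
Lemma sum_dot_column v : \sum_l dot v (Y l) ^+ 2 <= dot v v * (D + n%:R) ^+ 2.
Proof.
have vv := dot_ge0 v.
apply: (@le_trans _ _ (\sum_l ((1 + n%:R / D) * (D ^+ 2 * (v *m P) 0 l ^+ 2) +
   (1 + D / n%:R) * (dot v v * n%:R)))).
  apply: ler_sum => l _; rewrite {1}Yerr dotDr dotZr dot_row.
  apply: le_trans (sqrD_weighted _ _ D0 nR) _.
  rewrite exprMn lerD2l ler_pM2l; last by rewrite addr_gt0// divr_gt0.
  apply: le_trans (dot_CauchySchwarz _ _) _.
  by rewrite ler_wpM2l.
rewrite big_split/= -!mulr_sumr sumr_const card_ord -(mulr_natr n%:R n).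
have h := proj_norm_le v.
set s := \sum_l _ in h *.
apply: (@le_trans _ _ ((1 + n%:R / D) * (D ^+ 2 * dot v v) +
  (1 + D / n%:R) * (dot v v * (n%:R * n%:R)))).
  by rewrite lerD2r ler_pM2l ?addr_gt0 ?divr_gt0// ler_pM2l// exprn_gt0.
rewrite le_eqVlt; apply/orP; left; apply/eqP; field.
by rewrite !gt_eqF.
Qed.

(** For a frozen vector only the rounding error changes the inner product. *)
Lemma dot_column_ker v l : v *m P = 0 -> dot v (Y l) ^+ 2 <= dot v v * n%:R.
Proof.
move=> vP; rewrite {1}Yerr dotDr dotZr dot_row vP mxE mulr0 add0r.
by apply: le_trans (dot_CauchySchwarz _ _) _; rewrite ler_wpM2l ?dot_ge0.
Qed.

Lemma norm2_column l : norm2 (Y l) <= D + n%:R.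
Proof.
rewrite Yerr; apply: le_trans (norm2D _ _) _; apply: lerD.
  rewrite norm2Z gtr0_norm// ler_piMr ?(ltW D0)// norm2_le1.
  rewrite (_ : dot _ _ = P l l); first by case/andP: (proj_diag_le1 l).
  by rewrite -proj_diag; apply: eq_bigr => k _; rewrite !mxE expr2.
rewrite -ler_sqr ?nnegrE ?norm2_ge0// norm2_sqr.
apply: le_trans (dot_err l) _; rewrite -natrX ler_nat.
by rewrite -mulnn leq_pmulr.
Qed.

(** The exact columns have squared lengths [D^2 P_ll], which add up to a multiple of the trace. The
    cross term with the rounding error costs at most [2 D n] per column, since the entries of [P]
    are at most 1. *)
Lemma sum_norm_column :
  D ^+ 2 * \tr P - 2 * D * n%:R ^+ 2 <= \sum_l dot (Y l) (Y l).
Proof.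
apply: (@le_trans _ _ (\sum_l (D ^+ 2 * P l l - 2 * D * n%:R))).
  rewrite sumrB -mulr_sumr sumr_const card_ord -(mulr_natr (_ * _) n).
  by rewrite -!mulrA -expr2 lexx.
apply: ler_sum => l _; have := err_le1 l; have := Yerr l.
move: (err l) => e -> e1; rewrite !(dotDl, dotDr, dotZl, dotZr).
rewrite (dotC e).
have -> : dot (\row_k P k l) (\row_k P k l) = P l l.
  by rewrite -[RHS]proj_diag; apply: eq_bigr => k _; rewrite !mxE expr2.
have h : - n%:R <= dot (\row_k P k l) e.
  have : `|dot (\row_k P k l) e| <= n%:R.
    rewrite -[leRHS]mulr1 -[n in n%:R]card_ord mulr_natl -sumr_const.
    apply: le_trans (ler_norm_sum _ _ _) _; apply: ler_sum => k _.
    rewrite normrM -[leRHS]mulr1; apply: ler_pM => //.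
    by rewrite !mxE proj_entry_le1.
  by rewrite ler_norml => /andP[].
have := dot_ge0 e; have : D * (- n%:R) <= D * dot (\row_k P k l) e.
  by rewrite ler_pM2l.
move: (dot _ e) (dot e _) => a b; lra.
Qed.

End Projection.

Section FrozenProjection.
Context {R : realType}.
Variables (n K g D : nat).

Definition cst_mx (x : 'rV[int]_n) : 'rV[R]_n := map_mx intr x.

Lemma dot_intr (x y : 'rV[int]_n) : dot (cst_mx x) (cst_mx y) = (idot x y)%:~R.
Proof.
by rewrite rmorph_sum; apply: eq_bigr => k _; rewrite !mxE rmorphM.
Qed.

Lemma cst_mxD (x y : 'rV[int]_n) : cst_mx (x + y) = cst_mx x + cst_mx y.
Proof. by apply/rowP => k; rewrite !mxE rmorphD. Qed.

Lemma cst_mxZ (a : int) (x : 'rV[int]_n) : cst_mx (a *: x) = a%:~R *: cst_mx x.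
Proof. by apply/rowP => k; rewrite !mxE rmorphM. Qed.

Definition nfrozen (V : nat -> 'rV[int]_n) i x : nat :=
  (\sum_(j < i) frozen K g D (V j) x)%N.

Lemma quad_proj_ge0 (P : 'M[R]_n) (w : 'cV[R]_n) : P^T = P -> P *m P = P ->
  (w^T *m P *m w) 0 0 = dot (P *m w)^T (P *m w)^T.
Proof.
move=> Pt PP; have -> : w^T *m P *m w = (P *m w)^T *m (P *m w).
  by rewrite trmx_mul Pt mulmxA -(mulmxA _ P P) PP.
by rewrite mxE; apply: eq_bigr => i _; rewrite !mxE.
Qed.

Lemma mxtrace_col (y : 'cV[R]_n) : \tr (y^T *m y) = dot y^T y^T.
Proof.
by rewrite /mxtrace big_ord1 mxE; apply: eq_bigr => k _; rewrite !mxE.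
Qed.

(** Each frozen vector subtracts a rank one matrix of trace 1, or nothing when it depends on the
    earlier ones. *)
Lemma frozen_projP (V : nat -> 'rV[int]_n) i x :
  let S := frozen_proj K g D V i x in let P : 'M[R]_n := rproj S in
  [/\ gram_rep S,
      forall j, (j < i)%N -> frozen K g D (V j) x -> cst_mx (V j) *m P = 0 &
      n%:R - (nfrozen V i x)%:R <= \tr P].
Proof.
rewrite /frozen_proj /nfrozen; elim: i => [|i [IHg IHk IHt]].
  split => //=; first exact: gram_rep1.
  rewrite big_ord0 subr0 /rproj map_scalar_mx/= invr1 scale1r mxtrace_scalar.
  by rewrite lexx.
rewrite big_ord_recr/=; case: ifPn => [fr|nfr]; last first.
  rewrite addn0; split => // j; rewrite ltnS leq_eqVlt => /orP[/eqP ->|ji fr].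
    by rewrite (negbTE nfr).
  exact: IHk.
move: IHg IHk IHt; set S := iteri _ _ _ => IHg IHk IHt.
have [Pt PP] := gram_rep_proj (F := R) IHg.
have [S'g _ e0S egt0S] := proj_step_spec (F := R) (V i) IHg.
move: e0S egt0S; set P := rproj S in Pt PP IHt IHk *; set w : 'cV[R]_n := _^T.
set e := (w^T *m P *m w) 0 0 => e0S egt0S.
have eE : e = dot (P *m w)^T (P *m w)^T by exact: quad_proj_ge0.
have wP : w^T *m P = (P *m w)^T by rewrite trmx_mul Pt.
have wE : w^T = cst_mx (V i) by rewrite trmxK.
have [e0|ne0] := eqVneq e 0.
  rewrite (e0S e0); have Pw0 : w^T *m P = 0.
    by rewrite wP; apply: dot_eq0; rewrite -eE.
  split => //.
    move=> j; rewrite ltnS leq_eqVlt => /orP[/eqP -> _|ji fr']; last exact: IHk.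
    by rewrite -wE.
  by apply: le_trans IHt; rewrite lerD2l lerN2 ler_nat leq_addr.
have egt0 : 0 < e by rewrite lt_def ne0 eE dot_ge0.
have [P'E _] := egt0S egt0.
split => //.
  move=> j; rewrite P'E mulmxBr -[_ *m (e^-1 *: _)]scalemxAr mulmxA ltnS leq_eqVlt.
  move=> /orP[/eqP -> _|ji frj].
    rewrite -wE (mulmxA w^T) [w^T *m P *m w]mx11_scalar -/e.
    by rewrite mul_scalar_mx scalerA mulVf// scale1r wP subrr.
  by rewrite (mulmxA _ P w) (IHk _ ji frj) !mul0mx scaler0 subrr.
rewrite P'E linearB/= [\tr (e^-1 *: _)]mxtraceZ mxtrace_mulC.
rewrite mxtrace_col -eE.
by rewrite mulVf// natrD opprD addrA lerD2r.
Qed.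

Lemma column_close (S : 'M[int]_n * int) (l k : 'I_n) : 0 < S.2 ->
  `|cst_mx (column D S l) 0 k - D%:R * (rproj S : 'M[R]_n) k l| <= 1.
Proof.
move=> d0; rewrite /column valK/= !mxE.
set a := D%:Z * S.1 k l; have dR : 0 < S.2%:~R :> R by rewrite ltr0z.
have aE : D%:R * (S.2%:~R^-1 * (S.1 k l)%:~R) = a%:~R / S.2%:~R :> R.
  by rewrite /a intrM -pmulrn mulrCA mulrC.
have dn0 : S.2 != 0 by rewrite gt_eqF.
rewrite aE {2}(divz_eq a S.2) intrD intrM mulrDl mulfK ?gt_eqF// opprD addrA subrr.
rewrite add0r normrN ger0_norm; last by rewrite divr_ge0 ?ler0z ?modz_ge0 ?ltW.
by rewrite ler_pdivrMr// mul1r ler_int ltW// ltz_pmod.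
Qed.

End FrozenProjection.

(** * One round of the walk *)

Section Round.
Context {R : realType}.
Variables (n K g D : nat) (V : nat -> 'rV[int]_n) (i : nat).
Variables (x0 : 'rV[int]_n) (W0 : nat -> int) (U e : R).
Hypothesis n0 : (0 < n)%N.
Hypothesis g0 : (0 < g)%N.
Hypothesis nD : (n <= D)%N.
Hypothesis Kg : (K <= g)%N.
Hypothesis VU : forall j, (j < i)%N -> norm2 (cst_mx (V j) : 'rV[R]_n) <= U * D%:R.
Hypothesis x0U : norm2 (cst_mx x0 : 'rV[R]_n) + 2 * n%:R * D%:R <= U * D%:R.
Hypothesis x0K : dot (cst_mx x0) (cst_mx x0) <= n%:R * K%:R * D%:R ^+ 2 :> R.
Hypothesis Ue : 2 * U / g%:R <= e.
Hypothesis e2 : e <= 1 / 2.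
Hypothesis W00 : forall j, (j <= i)%N -> 0 < W0 j.

Let S := frozen_proj K g D V i x0.
Let P : 'M[R]_n := rproj S.
Let st l := iteri l (substep K g D V i S) (x0, W0).
Let X l : 'rV[R]_n := cst_mx (st l).1.
Let Y l : 'rV[R]_n := cst_mx (column D S l).
Let z l j := gain K g V i (st l).1 (column D S l) j.
Let s l : int := if 0 < \sum_(j < i.+1) (st l).2 j * z l j then -1 else 1.
Let G : R := (scale g D)%:~R.
Let u l j : R := (s l * z l j)%:~R / G.
Let nR : R := n%:R.
Let KR : R := K%:R.
Let gR : R := g%:R.
Let DR : R := D%:R.

Let D0N : (0 < D)%N. Proof. exact: leq_trans nD. Qed.
Let nR0 : 0 < nR. Proof. by rewrite ltr0n. Qed.
Let gR0 : 0 < gR. Proof. by rewrite ltr0n. Qed.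
Let DR0 : 0 < DR. Proof. by rewrite ltr0n. Qed.
Let KR0 : 0 <= KR. Proof. by rewrite ler0n. Qed.
Let nDR : nR <= DR. Proof. by rewrite ler_nat. Qed.
Let KgR : KR <= gR. Proof. by rewrite ler_nat. Qed.
Let GE : G = gR ^+ 2 * DR ^+ 2.
Proof. by rewrite /G /scale !intrM -!pmulrn !expr2. Qed.
Let G0 : 0 < G. Proof. by rewrite GE mulr_gt0// exprn_gt0. Qed.
Let U0 : 0 <= U.
Proof.
rewrite -(@pmulr_lge0 _ DR)//; apply: le_trans x0U.
by rewrite addr_ge0 ?norm2_ge0// !mulr_ge0// ltW.
Qed.

Let stS l : st l.+1 = substep K g D V i S l (st l). Proof. by []. Qed.

Let XS l : X l.+1 = X l + (s l)%:~R *: Y l.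
Proof. by rewrite /X stS cst_mxD cst_mxZ. Qed.

Let s1 l : (s l)%:~R ^+ 2 = 1 :> R.
Proof. by rewrite /s; case: ifP => _; rewrite ?rmorphN ?sqrrN expr1n. Qed.

Let normsE l : `|(s l)%:~R| = 1 :> R.
Proof. by rewrite /s; case: ifP => _; rewrite ?rmorphN ?normrN normr1. Qed.

Let Sg : gram_rep S. Proof. by case: (frozen_projP (R := R) K g D V i x0). Qed.
Let Pt : P^T = P. Proof. by case: (gram_rep_proj (F := R) Sg). Qed.
Let PP : P *m P = P. Proof. by case: (gram_rep_proj (F := R) Sg). Qed.

Let YP (l k : 'I_n) : `|Y l 0 k - DR * P k l| <= 1.
Proof. by apply: column_close; case: Sg => ? [? []]. Qed.

Let normY (l : 'I_n) : norm2 (Y l) <= DR + nR.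
Proof. exact: (norm2_column (Y := fun l : 'I_n => Y l) n0 DR0 Pt PP YP). Qed.

Let uE l j : (j < i)%N -> u l j = (s l)%:~R * dot (cst_mx (V j)) (Y l) / (gR * DR ^+ 2).
Proof.
move=> ji; rewrite /u /z /gain (ltn_eqF ji) !intrM dot_intr GE -pmulrn -/gR.
by field; rewrite !gt_eqF.
Qed.

Let uiE l : u l i = - (KR / G) * ((s l)%:~R * dot (X l) (Y l)).
Proof.
rewrite /u /z /gain eqxx !intrM dot_intr mulrNz -pmulrn -/KR.
by field; rewrite !gt_eqF.
Qed.

Let normX l : (l <= n)%N -> norm2 (X l - X 0) <= l%:R * (2 * DR).
Proof.
elim: l => [|l IH] ln; first by rewrite subrr /norm2 dot0l sqrtr0 mul0r.
rewrite XS addrAC; apply: le_trans (norm2D _ _) _.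
rewrite -(addn1 l) natrD mulrDl mul1r; apply: lerD; first by apply: IH; exact: ltnW.
rewrite norm2Z normsE mul1r; apply: le_trans (normY (Ordinal ln)) _.
by move: nDR; lra.
Qed.

Let normX0 l : (l <= n)%N -> norm2 (X l - X 0) <= 2 * nR * DR.
Proof.
move=> ln; apply: le_trans (normX ln) _; rewrite mulrCA mulrA ler_pM2r//.
by rewrite ler_pM2l// ler_nat.
Qed.

Let normXU l : (l <= n)%N -> norm2 (X l) <= U * DR.
Proof.
move=> ln; apply: le_trans x0U; rewrite -[X l](subrK (X 0)).
by apply: le_trans (norm2D _ _) _; rewrite addrC lerD2l normX0.
Qed.

Let W_rec l j : (l < n)%N -> (j < i.+1)%N ->
  ((st l.+1).2 j)%:~R = G * (((st l).2 j)%:~R * (1 + u l j)).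
Proof.
move=> ln ji; rewrite stS /substep/= -/(z l) -/(s l) intrM intrD -/G.
have h (a b c : R) : c != 0 -> a * (c + b) = c * (a * (1 + b / c)).
  by move=> c0; field.
by apply: h; rewrite gt_eqF.
Qed.

Let u_le l j : (l < n)%N -> (j < i.+1)%N -> `|u l j| <= e.
Proof.
move=> ln; rewrite ltnS leq_eqVlt => /orP[/eqP ->|ji]; apply: le_trans Ue.
  rewrite uiE normrM normrN (normrM (s l)%:~R) normsE mul1r.
  have K0 : 0 <= KR / G by rewrite divr_ge0// ltW.
  rewrite (ger0_norm K0).
  apply: (@le_trans _ _ (KR / G * (U * DR * (2 * DR)))).
    rewrite ler_wpM2l//; apply: le_trans (dot_le_norm2 _ _) _.
    apply: ler_pM; rewrite ?norm2_ge0// ?normXU 1?ltnW//.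
    by apply: le_trans (normY (Ordinal ln)) _; move: nDR; lra.
  rewrite GE (_ : _ * _ = KR / gR * (2 * U / gR)); last by field; rewrite !gt_eqF.
  by rewrite ler_piMl ?divr_ge0 ?mulr_ge0 ?(ltW gR0)// ler_pdivrMr// mul1r.
have c0 : 0 < gR * DR ^+ 2 by rewrite mulr_gt0 ?exprn_gt0.
rewrite uE// normrM normfV (gtr0_norm c0) normrM normsE mul1r ler_pdivrMr//.
apply: le_trans (dot_le_norm2 _ _) _.
apply: (@le_trans _ _ (U * DR * (2 * DR))).
  apply: ler_pM; rewrite ?norm2_ge0// ?VU//.
  by apply: le_trans (normY (Ordinal ln)) _; move: nDR; lra.
by rewrite le_eqVlt; apply/orP; left; apply/eqP; field; rewrite gt_eqF.
Qed.

Let Wu_le0 l : (l < n)%N -> \sum_(j < i.+1) ((st l).2 j)%:~R * u l j <= 0.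
Proof.
move=> ln; rewrite (_ : \sum_(j < _) _ =
    (s l * \sum_(j < i.+1) (st l).2 j * z l j)%:~R / G); last first.
  rewrite mulr_sumr rmorph_sum mulr_suml; apply: eq_bigr => j _.
  by rewrite /= /u !intrM; ring.
rewrite pmulr_lle0 ?invr_gt0// lerz0 /s.
by case: ifPn => h; [rewrite mulN1r oppr_le0 ltW|rewrite mul1r leNgt].
Qed.

Let sum_u j q : (j < i)%N -> \sum_(l < q) u l j =
  (dot (cst_mx (V j)) (X q) - dot (cst_mx (V j)) (X 0)) / (gR * DR ^+ 2).
Proof.
move=> ji; elim: q => [|l IH]; first by rewrite big_ord0 subrr mul0r.
by rewrite big_ord_recr/= IH uE// XS dotDr dotZr -mulrDl addrAC.
Qed.

(** Telescoping of [|x + s y|^2 = |x|^2 + 2 s <x, y> + |y|^2]: low gain of the norm weight means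
    growth of [|x|^2] by the squared lengths of the columns. *)
Let sum_ui q : \sum_(l < q) u l i =
  - (KR / (2 * G)) * (dot (X q) (X q) - dot (X 0) (X 0) - \sum_(l < q) dot (Y l) (Y l)).
Proof.
elim: q => [|l IH]; first by rewrite !big_ord0 subr0 subrr mulr0.
rewrite 2!big_ord_recr/= IH uiE XS !(dotDl, dotDr, dotZl, dotZr) (dotC (Y l) (X l)).
have := s1 l; rewrite expr2 => h.
rewrite (mulrA _ _ (dot (Y l) (Y l))) h mul1r.
by field; rewrite !gt_eqF.
Qed.

Let sum_u2 j : (j < i)%N ->
  \sum_(l < n) u l j ^+ 2 <= U ^+ 2 * (DR + nR) ^+ 2 / (gR ^+ 2 * DR ^+ 2).
Proof.
move=> ji; have h := sum_dot_column (Y := fun l : 'I_n => Y l) n0 DR0 Pt PP YP (cst_mx (V j)).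
have -> : \sum_(l < n) u l j ^+ 2 =
    (\sum_(l < n) dot (cst_mx (V j)) (Y l) ^+ 2) / (gR * DR ^+ 2) ^+ 2.
  by rewrite mulr_suml; apply: eq_bigr => l _; rewrite uE// expr_div_n exprMn s1 mul1r.
rewrite ler_pdivrMr ?exprn_gt0 ?mulr_gt0 ?exprn_gt0//.
apply: le_trans h _.
rewrite (_ : _ / _ * _ = (U * DR) ^+ 2 * (DR + nR) ^+ 2); last first.
  by field; rewrite !gt_eqF.
rewrite ler_wpM2r ?sqr_ge0// -norm2_sqr lerXn2r ?nnegrE ?norm2_ge0 ?VU//.
by rewrite mulr_ge0// ltW.
Qed.

(** The vector [x] changes during the round, so the frame bound is applied to its initial value; the
    displacement, at most [2 n D], is treated by Cauchy-Schwarz. *)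
Let sum_ui2 : \sum_(l < n) u l i ^+ 2 <=
  (KR / gR ^+ 2) ^+ 2 * (8 * nR * KR + 32 * nR ^+ 3).
Proof.
have h := sum_dot_column (Y := fun l : 'I_n => Y l) n0 DR0 Pt PP YP (X 0).
have -> : \sum_(l < n) u l i ^+ 2 = (KR / G) ^+ 2 * \sum_(l < n) dot (X l) (Y l) ^+ 2.
  rewrite mulr_sumr; apply: eq_bigr => l _.
  by rewrite uiE exprMn sqrrN (exprMn _ (s l)%:~R) s1 mul1r.
have D4 : (DR + nR) ^+ 2 <= 4 * DR ^+ 2.
  rewrite (_ : 4 * _ = (2 * DR) ^+ 2); last by ring.
  by rewrite lerXn2r ?nnegrE; move: nDR DR0 nR0; lra.
have : \sum_(l < n) dot (X l) (Y l) ^+ 2 <= DR ^+ 4 * (8 * nR * KR + 32 * nR ^+ 3).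
  apply: (@le_trans _ _ (\sum_(l < n) (2 * dot (X 0) (Y l) ^+ 2 + 32 * nR ^+ 2 * DR ^+ 4))).
    apply: ler_sum => l _; rewrite -[X l](subrK (X 0)) dotDl.
    set a := dot (X l - X 0) (Y l); set b := dot (X 0) (Y l).
    have : a ^+ 2 <= (2 * nR * DR * (2 * DR)) ^+ 2.
      rewrite -(real_normK (num_real a)) lerXn2r ?nnegrE//.
        by rewrite !mulr_ge0// ltW.
      apply: le_trans (dot_le_norm2 _ _) _.
      apply: ler_pM; rewrite ?norm2_ge0// ?normX0 1?ltnW//.
      by apply: le_trans (normY l) _; move: nDR; lra.
    have := sqr_ge0 (a - b); move: (a) (b) => a' b'.
    rewrite (_ : (2 * nR * DR * (2 * DR)) ^+ 2 = 16 * nR ^+ 2 * DR ^+ 4); last by ring.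
    lra.
  rewrite big_split/= -mulr_sumr sumr_const card_ord -(mulr_natr (_ * _ * _) n) -/nR.
  apply: (@le_trans _ _ (2 * (nR * KR * DR ^+ 2 * (4 * DR ^+ 2)) + 32 * nR ^+ 2 * DR ^+ 4 * nR)).
    rewrite lerD2r ler_pM2l//; apply: le_trans h _.
    by apply: ler_pM; rewrite ?dot_ge0 ?sqr_ge0.
  by rewrite le_eqVlt; apply/orP; left; apply/eqP; ring.
move=> h'; apply: (@le_trans _ _ ((KR / G) ^+ 2 * (DR ^+ 4 * (8 * nR * KR + 32 * nR ^+ 3)))).
  by rewrite ler_wpM2l ?sqr_ge0.
by rewrite GE le_eqVlt; apply/orP; left; apply/eqP; field; rewrite !gt_eqF.
Qed.

(** The first order terms of [multiplicative_weights] telescope and the second order terms are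
    controlled by the frame bound. In the last clause a frozen vector moves by rounding errors only,
    while any other vector can move by at most the total length of [n] columns times its own
    norm. *)
Lemma round_active : let st' := iteri n (substep K g D V i S) (x0, W0) in
  let x : 'rV[R]_n := cst_mx st'.1 in
  [/\ (forall j, (j <= i)%N -> 0 < st'.2 j) /\
      \sum_(j < i.+1) (st'.2 j)%:~R <= G ^+ n * \sum_(j < i.+1) (W0 j)%:~R,
      forall j, (j < i)%N -> G ^+ n * ((W0 j)%:~R * expR (
        (dot (cst_mx (V j)) x - dot (cst_mx (V j)) (cst_mx x0)) / (gR * DR ^+ 2)
         - (1 / 2 + e) * (U ^+ 2 * (DR + nR) ^+ 2 / (gR ^+ 2 * DR ^+ 2))))
         <= (st'.2 j)%:~R,
      G ^+ n * ((W0 i)%:~R * expR (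
        - (KR / (2 * G)) * (dot x x - dot (cst_mx x0) (cst_mx x0)
           - (DR ^+ 2 * (nR - (nfrozen K g D V i x0)%:R) - 2 * DR * nR ^+ 2))
        - (1 / 2 + e) * ((KR / gR ^+ 2) ^+ 2 * (8 * nR * KR + 32 * nR ^+ 3))))
         <= (st'.2 i)%:~R,
      norm2 x <= U * DR &
      forall j, (j < i)%N -> dot (cst_mx (V j)) x <=
        dot (cst_mx (V j)) (cst_mx x0) +
        nR * (if frozen K g D (V j) x0 then nR * U * DR else 2 * U * DR ^+ 2)].
Proof.
move=> st' x.
have e20 : 0 <= 1 / 2 + e.
  have : 0 <= 2 * U / gR by rewrite divr_ge0 ?mulr_ge0// ltW.
  by move: Ue; lra.
have [|Wpos [Wge Wsum]] := @multiplicative_weights R n i.+1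
    (fun l j => ((st l).2 j)%:~R) u G e G0 e2 W_rec u_le Wu_le0.
  by move=> j ji; rewrite ltr0z W00.
split.
- by split => // j ji; rewrite -(@ltr0z R); exact: Wpos.
- move=> j ji; apply: le_trans (Wge j (leqW ji)).
  rewrite ler_pM2l ?exprn_gt0// ler_pM2l ?ltr0z ?W00 1?ltnW//.
  by rewrite ler_expR sum_u// lerD2l lerN2 ler_wpM2l// sum_u2.
- apply: le_trans (Wge i (ltnSn i)).
  rewrite ler_pM2l ?exprn_gt0// ler_pM2l ?ltr0z ?W00//.
  rewrite ler_expR sum_ui; apply: lerD; last by rewrite lerN2 ler_wpM2l// sum_ui2.
  rewrite !mulNr lerN2 ler_wpM2l ?divr_ge0 ?mulr_ge0 ?(ltW G0)//.
  rewrite lerD2l lerN2.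
  have := sum_norm_column (Y := fun l : 'I_n => Y l) DR0 Pt PP YP.
  apply: le_trans; rewrite lerD2r ler_pM2l ?exprn_gt0//.
  by case: (frozen_projP (R := R) K g D V i x0).
- exact: normXU.
- move=> j ji; rewrite -lerBlDl.
  have -> : dot (cst_mx (V j)) x - dot (cst_mx (V j)) (cst_mx x0) =
      \sum_(l < n) (s l)%:~R * dot (cst_mx (V j)) (Y l).
    rewrite -[x]/(X n) -[cst_mx x0]/(X 0).
    have sum_dot q : dot (cst_mx (V j)) (X q) - dot (cst_mx (V j)) (X 0) =
        \sum_(l < q) (s l)%:~R * dot (cst_mx (V j)) (Y l).
      elim: q => [|l IH]; first by rewrite big_ord0 subrr.
      by rewrite big_ord_recr/= -IH XS dotDr dotZr addrAC.
    exact: sum_dot.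
  set B := (X in _ <= nR * X); have -> : nR * B = \sum_(l < n) B.
    by rewrite sumr_const card_ord mulr_natl.
  rewrite {}/B.
  apply: ler_sum => l _; apply: le_trans (ler_norm _) _.
  rewrite normrM normsE mul1r; case: ifP => fr.
    have vP : cst_mx (V j) *m P = 0.
      by case: (frozen_projP (R := R) K g D V i x0) => _ + _; apply.
    have := dot_column_ker (Y := fun l : 'I_n => Y l) YP l vP => h.
    rewrite -ler_sqr ?nnegrE// ?mulr_ge0 ?(ltW nR0) ?(ltW DR0)//.
    rewrite real_normK ?num_real//; apply: le_trans h _.
    apply: (@le_trans _ _ ((U * DR) ^+ 2 * nR)).
      rewrite ler_pM2r// -norm2_sqr lerXn2r ?nnegrE ?norm2_ge0 ?VU//.
      by rewrite mulr_ge0// ltW.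
    rewrite (_ : (nR * U * DR) ^+ 2 = (U * DR) ^+ 2 * (nR * nR)); last by ring.
    by rewrite ler_wpM2l ?sqr_ge0// ler_peMl ?(ltW nR0)// ler1n.
  apply: le_trans (dot_le_norm2 _ _) _.
  rewrite (_ : 2 * U * _ = U * DR * (2 * DR)); last by ring.
  apply: ler_pM; rewrite ?norm2_ge0 ?VU//.
  by apply: le_trans (normY l) _; move: nDR; lra.
Qed.

End Round.

(** * The complete walk *)

Section Walk.
Context {R : realType}.
Variables (n K g D m : nat) (V : nat -> 'rV[int]_n) (i : nat) (e : R).
Let nR : R := n%:R.
Let KR : R := K%:R.
Let gR : R := g%:R.
Let DR : R := D%:R.
(** Up to the factor [D]: the norm allowed by the guard, plus [n] columns of length at most
    [2 D]. *)
Let U : R := Num.sqrt (nR * KR) + 2 * nR.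
Let Lam : R := nR * KR ^+ 2 / (2 * gR ^+ 2).
(** The second order losses per round in the exponents of an ordinary weight ([q]) and of the norm
    weight ([q']). Over [K] rounds the former amounts to about [Lam], the latter only to a
    constant. *)
Let q : R := (1 / 2 + e) * (U ^+ 2 * (DR + nR) ^+ 2 / (gR ^+ 2 * DR ^+ 2)).
Let q' : R := (1 / 2 + e) * ((KR / gR ^+ 2) ^+ 2 * (8 * nR * KR + 32 * nR ^+ 3)).
Hypothesis n0 : (0 < n)%N.
Hypothesis g0 : (0 < g)%N.
Hypothesis K0 : (0 < K)%N.
Hypothesis nD : (n <= D)%N.
Hypothesis Kg : (K <= g)%N.
Hypothesis im : (i < m)%N.
Hypothesis VU : forall j, (j < i)%N -> norm2 (cst_mx (V j) : 'rV[R]_n) <= U * DR.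
Hypothesis Ue : 2 * U / gR <= e.
Hypothesis e2 : e <= 1 / 2.
Hypothesis qK : q * KR <= Lam + 1 / 2.
Hypothesis q'K : q' * KR <= 1 / 10.
Hypothesis mn : m%:R <= nR * expR Lam.
Hypothesis LD : 20 * nR * Lam <= DR.
Hypothesis drift : 2 * nR * U * DR ^+ 2 + KR * nR ^+ 2 * U * DR <= gR * DR ^+ 2.

Let nR0 : 0 < nR. Proof. by rewrite ltr0n. Qed.
Let gR0 : 0 < gR. Proof. by rewrite ltr0n. Qed.
Let KR0 : 0 < KR. Proof. by rewrite ltr0n. Qed.
Let DR0 : 0 < DR. Proof. by rewrite ltr0n; apply: leq_trans nD. Qed.
Let mR0 : 0 < m%:R :> R. Proof. by rewrite ltr0n; apply: leq_ltn_trans im. Qed.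
Let U0 : 0 <= U. Proof. by rewrite addr_ge0 ?sqrtr_ge0// mulr_ge0// ltW. Qed.
Let e0 : 0 <= e.
Proof. by apply: le_trans Ue; rewrite divr_ge0 ?mulr_ge0// ltW. Qed.
Let L0 : 0 < Lam.
Proof. by rewrite divr_gt0 ?mulr_gt0 ?exprn_gt0// mulr_gt0. Qed.
Let q0 : 0 <= q.
Proof.
by rewrite mulr_ge0 ?addr_ge0// divr_ge0// mulr_ge0 ?sqr_ge0.
Qed.
Let G : R := gR ^+ 2 * DR ^+ 2.
Let G0 : 0 < G. Proof. by rewrite mulr_gt0 ?exprn_gt0. Qed.
Let GE : (scale g D)%:~R = G.
Proof. by rewrite /scale !intrM -!pmulrn /G !expr2. Qed.

(* A bound for the number of frozen vectors in round t. *)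
Let kappa (t : nat) : R := 9 / 20 * (nR * expR (- Lam * (1 - t%:R / KR))).

(* A lower bound for the drift of |x|^2 in the first t rounds. *)
Let A (t : nat) : R :=
  \sum_(s < t) (DR ^+ 2 * (nR - kappa s) - 2 * DR * nR ^+ 2).

(** [c] stands for the accumulated powers of [G]. The norm weight is followed only while the walk
    has not stopped, since a skipped round does not make [|x|^2] grow. In the last clause,
    [2 n U D^2] is the overshoot in a round that starts below the freezing threshold, and the term
    in [t] is the rounding drift in the rounds spent frozen. *)
Let inv (t : nat) (st : 'rV[int]_n * (nat -> int)) : Prop :=
  let x : 'rV[R]_n := cst_mx st.1 in
  [/\ forall j, (j <= i)%N -> 0 < st.2 j,
      exists2 c, 0 < c &
        [/\ \sum_(j < i.+1) (st.2 j)%:~R <= c * (2 * m%:R),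
          forall j, (j < i)%N ->
            c * expR (dot (cst_mx (V j)) x / (gR * DR ^+ 2) - q * t%:R) <= (st.2 j)%:~R &
          dot x x < nR * KR * DR ^+ 2 ->
            c * (m%:R * expR (- (KR / (2 * G)) * (dot x x - A t) - q' * t%:R)) <= (st.2 i)%:~R],
      norm2 x <= U * DR &
      forall j, (j < i)%N -> dot (cst_mx (V j)) x <=
        gR * DR ^+ 2 * (2 * Lam + 4) + 2 * nR * U * DR ^+ 2 + t%:R * (nR ^+ 2 * U * DR)].

Let frozenE (v x : 'rV[int]_n) : frozen K g D v x =
  (gR * DR ^+ 2 * (2 * Lam + 4) < dot (cst_mx v) (cst_mx x)).
Proof.
rewrite dot_intr /frozen -(@ltr0z R) intrB subr_gt0 !(intrM, intrD) -!pmulrn.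
rewrite -/nR -/KR -/gR -/DR -[RHS](ltr_pM2l gR0).
congr (_ < _); rewrite /Lam; field.
by rewrite gt_eqF.
Qed.

Let expR_7_2 : 9 / 2 <= expR (7 / 2) :> R.
Proof. by apply: le_trans (expR_ge1Dx _); lra. Qed.

(** Each frozen vector has weight at least [c exp(2 Lam + 4 - q t)], while the total is at most
    [2 c m <= 2 c n exp(Lam)]. The 4 in the threshold, less the 1/2 of [qK], leaves
    [exp(7/2) >= 9/2], and [2 <= 9/20 * 9/2]. *)
Let nfrozen_le t st : (t <= K)%N -> inv t st ->
  (nfrozen K g D V i st.1)%:R <= kappa t.
Proof.
move=> tK [Wpos [c c0 [Wsum Wge _]] _ _].
pose Y := expR (2 * Lam + 4 - q * t%:R).
have : c * ((nfrozen K g D V i st.1)%:R * Y) <= c * (2 * m%:R).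
  apply: le_trans Wsum; rewrite big_ord_recr/=.
  apply: (@le_trans _ _ (\sum_(j < i) (st.2 j)%:~R)); last first.
    by rewrite lerDl ler0z ltW// Wpos.
  rewrite /nfrozen natr_sum mulr_suml mulr_sumr; apply: ler_sum => j _.
  case: (boolP (frozen _ _ _ _ _)) => [|_]; last first.
    by rewrite mul0r mulr0 ler0z ltW// Wpos// ltnW.
  rewrite frozenE mul1r => fr; apply: le_trans (Wge j (ltn_ord j)).
  rewrite ler_pM2l// ler_expR lerD2r ler_pdivlMr; last by rewrite mulr_gt0 ?exprn_gt0.
  by rewrite mulrC ltW.
rewrite ler_pM2l// => h.
have Y0 : 0 < Y by exact: expR_gt0.
rewrite -(ler_pM2r Y0); apply: le_trans h _.
have qt : q * t%:R <= Lam * (t%:R / KR) + 1 / 2.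
  have t1 : t%:R / KR <= 1 by rewrite ler_pdivrMr// mul1r ler_nat.
  have t0 : 0 <= t%:R / KR by rewrite divr_ge0// ltW.
  have : q * KR * (t%:R / KR) <= (Lam + 1 / 2) * (t%:R / KR) by rewrite ler_wpM2r.
  rewrite (_ : q * KR * _ = q * t%:R); last by field; rewrite gt_eqF.
  by nra.
apply: (@le_trans _ _ (2 * (nR * expR Lam))); first by rewrite ler_pM2l.
apply: (@le_trans _ _ (9 / 20 * (nR * (expR Lam * expR (7 / 2))))).
  have := expR_gt0 Lam; move: expR_7_2; set a := expR Lam; set b := expR (7 / 2).
  move=> h1 h2; have : nR * a * (9 / 2) <= nR * a * b.
    by rewrite ler_wpM2l// mulr_ge0// ltW.
  have : 0 <= nR * a by rewrite mulr_ge0// ltW.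
  lra.
rewrite /kappa /Y -(mulrA (9 / 20)) ler_pM2l; last by lra.
by rewrite -mulrA ler_pM2l// -!expRD ler_expR; lra.
Qed.

(** The norm weight starts at [m], half of the bound [2 m] on the total, so the final comparison for
    the norm loses only a factor 2. *)
Let inv0 : inv 0 (0, fun j => if j == i then m%:Z else 1).
Proof.
have c0 : cst_mx (0 : 'rV[int]_n) = 0 :> 'rV[R]_n by apply/rowP => k; rewrite !mxE.
have m0 : (0 < m)%N by exact: leq_ltn_trans im.
split => /=.
- by move=> j _; case: ifP => // _; rewrite ltz_nat.
- exists 1 => //; split.
  + rewrite mul1r big_ord_recr/= eqxx -pmulrn mulrDl -/(1 * _) !mul1r.
    rewrite lerD2r (eq_bigr (fun=> 1)); last first.
      by move=> j _; rewrite (ltn_eqF (ltn_ord j)).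
    by rewrite sumr_const card_ord ler_nat ltnW.
  + move=> j ji; rewrite c0 dotC dot0l mul0r mulr0 subr0 expR0 mul1r.
    by rewrite (ltn_eqF ji).
  + move=> _; rewrite c0 dot0l /A big_ord0 subr0 !mulr0 subr0 expR0 mul1r mulr1.
    by rewrite eqxx -pmulrn.
- by rewrite c0 /norm2 dot0l sqrtr0 mulr_ge0// ltW.
- move=> j ji; rewrite c0 dotC dot0l mul0r addr0 addr_ge0 ?mulr_ge0 ?sqr_ge0 ?(ltW gR0) ?(ltW nR0)//.
  by rewrite addr_ge0// mulr_ge0 ?(ltW L0).
Qed.

Let driftU : 0 <= nR ^+ 2 * U * DR.
Proof. by rewrite !mulr_ge0 ?sqr_ge0// ltW. Qed.

Let inv_stopped t st : ~~ (dot (cst_mx st.1) (cst_mx st.1) < nR * KR * DR ^+ 2) ->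
  inv t st -> inv t.+1 st.
Proof.
move=> stop [Wpos [c c0 [Wsum Wge _]] xU Vx]; split => //.
  exists c => //; split => //; last by move=> h; rewrite h in stop.
  move=> j ji; apply: le_trans (Wge j ji); rewrite ler_pM2l// ler_expR lerD2l lerN2.
  by rewrite ler_wpM2l// ler_nat.
move=> j ji; apply: le_trans (Vx j ji) _.
by rewrite lerD2l ler_wpM2r// ler_nat.
Qed.

Let guardE (x : 'rV[int]_n) :
  (0 < n%:Z * K%:Z * (D%:Z * D%:Z) - idot x x) =
  (dot (cst_mx x) (cst_mx x) < nR * KR * DR ^+ 2).
Proof.
by rewrite dot_intr -(@ltr0z R) intrB subr_gt0 !intrM -!pmulrn expr2.
Qed.

Let inv_round t st : (t < K)%N -> inv t st -> inv t.+1 (round K g D V i st).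
Proof.
move=> tK I; rewrite /round guardE; case: ifPn => [act|]; last first.
  by move=> stop; exact: inv_stopped.
have nf := nfrozen_le (ltnW tK) I.
case: st I act nf => x0 W0 [/= Wpos [c c0 [Wsum Wge Wi]] xU Vx] act nf.
have x0U : norm2 (cst_mx x0 : 'rV[R]_n) + 2 * nR * DR <= U * DR.
  rewrite /U [leRHS]mulrDl lerD2r -ler_sqr ?nnegrE ?norm2_ge0//; last first.
    by rewrite mulr_ge0 ?sqrtr_ge0// ltW.
  rewrite norm2_sqr exprMn sqr_sqrtr; last by rewrite mulr_ge0// ltW.
  exact: ltW.
have := round_active n0 g0 nD Kg VU x0U (ltW act) Ue e2 Wpos.
rewrite -/nR -/KR -/gR -/DR GE.
set st' := iteri n _ _; case=> -[W'pos W'sum] W'ge W'i x'U V'x.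
have Gn : 0 < G ^+ n by rewrite exprn_gt0.
split => //.
- exists (G ^+ n * c); first by rewrite mulr_gt0.
  split.
  + by apply: le_trans W'sum _; rewrite -(mulrA (G ^+ n)) ler_pM2l.
  + move=> j ji; apply: le_trans (W'ge j ji); rewrite -(mulrA (G ^+ n)) ler_pM2l//.
    have := Wge j ji; set w : R := (W0 j)%:~R => wge.
    apply: (@le_trans _ _ (c * expR (dot (cst_mx (V j)) (cst_mx x0) / (gR * DR ^+ 2) - q * t%:R) *
        expR ((dot (cst_mx (V j)) (cst_mx st'.1) - dot (cst_mx (V j)) (cst_mx x0)) / (gR * DR ^+ 2) - q))).
      rewrite -(mulrA c) ler_pM2l// -expRD ler_expR -(natr1 t) mulrDl.
      rewrite le_eqVlt; apply/orP; left; apply/eqP.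
      by rewrite mulNr; ring.
    by rewrite ler_wpM2r// expR_ge0.
  + move=> _; apply: le_trans W'i; rewrite -(mulrA (G ^+ n)) ler_pM2l//.
    have := Wi act; set w : R := (W0 i)%:~R => wge.
    set b := KR / (2 * G) in wge *.
    have b0 : 0 <= b by rewrite divr_ge0 ?mulr_ge0 ?(ltW G0)// ltW.
    set x' := dot (cst_mx st'.1) _; set x := dot (cst_mx x0) _ in wge *.
    set f : R := (nfrozen _ _ _ _ _ _)%:R in nf *.
    apply: (@le_trans _ _ (c * (m%:R * expR (- b * (x - A t) - q' * t%:R)) *
        expR (- b * (x' - x - (DR ^+ 2 * (nR - f) - 2 * DR * nR ^+ 2)) - q'))).
      rewrite -(mulrA c) -(mulrA m%:R) ler_pM2l// ler_pM2l// -expRD ler_expR -(natr1 t).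
      rewrite /A big_ord_recr/= -/(A t).
      have : b * (DR ^+ 2 * f) <= b * (DR ^+ 2 * kappa t).
        by rewrite ler_wpM2l// ler_wpM2l// ?sqr_ge0.
      move: (A t) (kappa t) => a k; lra.
    by rewrite ler_wpM2r// expR_ge0.
- move=> j ji; apply: le_trans (V'x j ji) _; case: ifPn => fr.
    rewrite -(natr1 t) (mulrDl t%:R) mul1r addrA; apply: lerD; first exact: Vx.
    by rewrite le_eqVlt; apply/orP; left; apply/eqP; ring.
  rewrite frozenE -leNgt in fr.
  apply: (@le_trans _ _ (gR * DR ^+ 2 * (2 * Lam + 4) + 2 * nR * U * DR ^+ 2)).
    by apply: lerD => //; rewrite le_eqVlt; apply/orP; left; apply/eqP; ring.
  by rewrite lerDl mulr_ge0.
Qed.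

(** A geometric series: the number of frozen vectors matters only in about the last [K / Lam]
    rounds, a fraction [1 / Lam] of the walk. The induction rests on [1 + a <= exp a]. *)
Let sum_kappa : \sum_(s < K) kappa s <= 9 / 20 * (nR * KR / Lam).
Proof.
pose a := Lam / KR; have a0 : 0 < a by rewrite divr_gt0.
have H t : \sum_(s < t) expR (a * s%:R) <= expR (a * t%:R) / a.
  elim: t => [|t IH]; first by rewrite big_ord0 divr_ge0 ?expR_ge0// ltW.
  rewrite big_ord_recr/=; apply: (@le_trans _ _ (expR (a * t%:R) / a + expR (a * t%:R))).
    by rewrite lerD2r.
  rewrite -[t.+1]addn1 natrD mulrDr expRD mulr1.
  rewrite (_ : _ + _ = expR (a * t%:R) * (1 + a) / a); last by field; rewrite gt_eqF.
  by rewrite ler_pM2r ?invr_gt0// ler_pM2l ?expR_gt0// expR_ge1Dx.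
rewrite /kappa -mulr_sumr ler_pM2l; last by lra.
rewrite -mulr_sumr -mulrA ler_pM2l//.
have -> : \sum_(s < K) expR (- Lam * (1 - s%:R / KR)) =
    expR (- Lam) * \sum_(s < K) expR (a * s%:R).
  rewrite mulr_sumr; apply: eq_bigr => s _; rewrite -expRD; congr expR.
  by rewrite /a; field; rewrite gt_eqF.
apply: (@le_trans _ _ (expR (- Lam) * (expR (a * KR) / a))).
  by rewrite ler_pM2l ?expR_gt0.
rewrite mulrA -expRD (_ : - Lam + a * KR = 0); last by rewrite /a; field; rewrite gt_eqF.
by rewrite expR0 /a le_eqVlt; apply/orP; left; apply/eqP; field; rewrite !gt_eqF.
Qed.

Lemma expR_3_4 : 2 <= expR (3 / 4) :> R.
Proof.
have -> : 3 / 4 = 8%:R * (3 / 32) :> R by lra.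
rewrite expRM_natl; have h : 35 / 32 <= expR (3 / 32) :> R.
  by apply: le_trans (expR_ge1Dx _); lra.
apply: (@le_trans _ _ ((35 / 32) ^+ 8)); first by lra.
by rewrite lerXn2r ?nnegrE ?expR_ge0//; lra.
Qed.

Lemma walkP : let x : 'rV[R]_n := cst_mx (walk K g D V i m).1 in
  [/\ norm2 x <= U * DR,
      nR * KR * DR ^+ 2 * (1 - 3 / (2 * Lam)) <= dot x x &
      forall j, (j < i)%N -> dot (cst_mx (V j)) x <= gR * DR ^+ 2 * (2 * Lam + 5)].
Proof.
move=> x; have : inv K (walk K g D V i m).
  have H t : (t <= K)%N ->
      inv t (iter t (round K g D V i) (0, fun j => if j == i then m%:Z else 1)).
    by elim: t => [_|t IH tK]; [exact: inv0|apply: inv_round => //; apply: IH; exact: ltnW].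
  exact: H.
case=> Wpos [c c0 [Wsum _ Wi]] xU Vx; split => //; last first.
  by move=> j ji; apply: le_trans (Vx j ji) _; move: drift; rewrite -/nR -/KR; lra.
pose T := nR * KR * DR ^+ 2; have T0 : 0 < T by rewrite !mulr_gt0// exprn_gt0.
have [lt|ge] := ltP (dot x x) T; last first.
  apply: le_trans ge; rewrite -/T ler_piMr ?(ltW T0)// lerBlDr lerDl.
  by rewrite divr_ge0// mulr_ge0// ltW.
have wi : ((walk K g D V i m).2 i)%:~R <= c * (2 * m%:R) :> R.
  apply: le_trans Wsum; rewrite big_ord_recr/= lerDr sumr_ge0// => j _.
  by rewrite ler0z ltW// Wpos// ltnW.
have := le_trans (Wi lt) wi; rewrite ler_pM2l// mulrC ler_pM2r//.
move=> /le_trans /(_ expR_3_4); rewrite ler_expR => h.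
have TL : T / Lam = 2 * G / KR by rewrite /T /Lam /G; field; rewrite !gt_eqF.
have AK : T - 9 / 20 * (T / Lam) - 1 / 10 * (T / Lam) <= A K.
  rewrite /A sumrB sumr_const card_ord -mulr_sumr sumrB sumr_const card_ord.
  have h1 : DR ^+ 2 * \sum_(s < K) kappa s <= 9 / 20 * (T / Lam).
    apply: le_trans (_ : DR ^+ 2 * (9 / 20 * (nR * KR / Lam)) <= _).
      by rewrite ler_pM2l ?exprn_gt0.
    by rewrite le_eqVlt; apply/orP; left; apply/eqP; rewrite /T; field; rewrite gt_eqF.
  have h2 : (2 * DR * nR ^+ 2) * KR <= 1 / 10 * (T / Lam).
    rewrite [leRHS]mulrA ler_pdivlMr//.
    have : (DR * nR * KR) * (20 * nR * Lam) <= (DR * nR * KR) * DR.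
      by rewrite ler_pM2l// !mulr_gt0.
    rewrite /T; lra.
  rewrite -(mulr_natr nR) -(mulr_natr (_ * _)) -/KR mulrBr.
  rewrite (_ : DR ^+ 2 * (nR * KR) = T); last by rewrite /T; ring.
  lra.
have h3 : KR / (2 * G) * (A K - dot x x) <= 17 / 20.
  by move: q'K h; rewrite -/x -/KR; lra.
have h4 : A K - dot x x <= 17 / 20 * (T / Lam).
  rewrite TL; have := ler_wpM2l (_ : 0 <= 2 * G / KR) h3.
  rewrite divr_ge0 ?mulr_ge0 ?(ltW G0) ?(ltW KR0)// => /(_ isT).
  rewrite mulrA (_ : 2 * G / KR * _ = 1) ?mul1r 1?mulrC//.
  by field; rewrite !gt_eqF.
rewrite -/T mulrBr mulr1 (_ : T * (3 / (2 * Lam)) = 3 / 2 * (T / Lam)); last first.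
  by field; rewrite gt_eqF.
have : 0 <= T / Lam by rewrite divr_ge0// ltW.
lra.
Qed.

End Walk.

(** * The number of rounds and the size of the inner products *)

Section RoundCount.
Variables (m n g : nat).

(** Comparing numerator [a] with denominator [b] avoids logarithms and divisions. The state stays
    put once the product is large enough, so a loop of fixed length [g] computes the least [k]. *)
Definition kstep (s : nat * nat * nat) : nat * nat * nat :=
  let: (a, b, k) := s in
  if (a < b)%N
  then (a * (2 * (g * g) + (2 * k + 1) * n), b * (2 * (g * g)), k.+1)%N else s.

(* The least k with n * prod_(i < k) (1 + (2 i + 1) n / (2 g^2)) >= m, the
   product being close to exp(n k^2 / (2 g^2)). *)
Definition round_count : nat := (iter g kstep (n, m, 0%N)).2.

Let num (k : nat) : nat := (n * \prod_(i < k) (2 * (g * g) + (2 * i + 1) * n))%N.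
Let den (k : nat) : nat := (m * (2 * (g * g)) ^ k)%N.

Lemma kstepP t : exists2 k, (k <= t)%N &
  [/\ iter t kstep (n, m, 0%N) = (num k, den k, k),
      forall i, (i < k)%N -> (num i < den i)%N &
      (k < t)%N -> (den k <= num k)%N].
Proof.
elim: t => [|t [k kt [kE klt kge]]].
  by exists 0%N => //; rewrite /num /den big_ord0 muln1 expn0 muln1.
rewrite iterS kE /=; case: ltnP => h; last first.
  by exists k; [exact: leqW|split].
exists k.+1.
  by rewrite ltnS.
split.
- by rewrite /num /den big_ord_recr/= expnSr !mulnA.
- by move=> i; rewrite ltnS leq_eqVlt => /orP[/eqP ->|]; [|exact: klt].
- by rewrite ltnS => /kge; rewrite leqNgt h.
Qed.

Lemma round_count_le : (round_count <= g)%N.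
Proof. by rewrite /round_count; case: (kstepP g) => k kg [-> _ _]. Qed.

Context {R : realType}.
Let L : R := ln (m%:R / n%:R).
Let c : R := n%:R / (2 * g%:R ^+ 2).
Hypothesis n0 : (0 < n)%N.
Hypothesis nm : (n < m)%N.
Hypothesis ng : (8 * (n * n) <= g)%N.
Hypothesis Ln : 16 * L + 4 <= n%:R.

Let nR0 : 0 < n%:R :> R. Proof. by rewrite ltr0n. Qed.
Let mR0 : 0 < m%:R :> R. Proof. by rewrite ltr0n; apply: leq_ltn_trans nm. Qed.
Let n1 : 1 <= n%:R :> R. Proof. by rewrite ler1n. Qed.
Let ngR : 8 * n%:R ^+ 2 <= g%:R :> R.
Proof. by rewrite expr2 -!natrM ler_nat. Qed.
Let gR0 : 0 < g%:R :> R.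
Proof. by apply: lt_le_trans ngR; rewrite mulr_gt0 ?exprn_gt0. Qed.
Let c0 : 0 < c. Proof. by rewrite divr_gt0// mulr_gt0 ?exprn_gt0. Qed.
Let P (k : nat) : R := \prod_(i < k) (1 + (2 * i%:R + 1) * c).

Let numE k : (num k)%:R / (den k)%:R = n%:R / m%:R * P k :> R.
Proof.
elim: k => [|k IH].
  by rewrite /num /den /P !big_ord0 expn0 !muln1 mulr1.
have numS : num k.+1 = (num k * (2 * (g * g) + (2 * k + 1) * n))%N.
  by rewrite /num big_ord_recr/= mulnA.
have denS : den k.+1 = (den k * (2 * (g * g)))%N by rewrite /den expnSr mulnA.
have dk : (den k)%:R != 0 :> R.
  by rewrite /den natrM natrX !natrM mulf_neq0 ?expf_neq0 ?mulf_neq0 ?gt_eqF.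
rewrite numS denS /P big_ord_recr/= -/(P k) mulrA -IH.
clear numS denS IH; move: (num k) (den k) dk => a b b0.
by rewrite !(natrM, natrD) /c; field; rewrite b0 gt_eqF.
Qed.

Let den0 k : 0 < (den k)%:R :> R.
Proof. by rewrite /den natrM natrX !natrM !mulr_gt0 ?exprn_gt0 ?mulr_gt0. Qed.

Let num_ltE k : (num k < den k)%N = (P k < m%:R / n%:R).
Proof.
rewrite -(ltr_nat R) -[RHS](@ltr_pM2l _ (n%:R / m%:R)) ?divr_gt0// -numE.
rewrite (_ : n%:R / m%:R * (m%:R / n%:R) = 1); last by field; rewrite !gt_eqF.
by rewrite ltr_pdivrMr ?mul1r.
Qed.

Let P_le k : P k <= expR (c * k%:R ^+ 2).
Proof.
elim: k => [|k IH]; first by rewrite /P big_ord0 expr0n mulr0 expR0.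
rewrite /P big_ord_recr/= -/(P k) -(addn1 k) natrD.
rewrite (_ : c * (k%:R + 1) ^+ 2 = c * k%:R ^+ 2 + (2 * k%:R + 1) * c); last by ring.
rewrite expRD; apply: ler_pM => //; last exact: expR_ge1Dx.
- by apply: prodr_ge0 => i _; rewrite addr_ge0// mulr_ge0 ?addr_ge0 ?mulr_ge0// ltW.
- by rewrite addr_ge0// mulr_ge0 ?addr_ge0 ?mulr_ge0// ltW.
Qed.

Let cg : c * g%:R ^+ 2 = n%:R / 2.
Proof. by rewrite /c; field; rewrite gt_eqF. Qed.

Let small k : (k < g)%N -> (2 * k%:R + 1) * c <= n%:R / g%:R.
Proof.
move=> kg; have : 2 * k%:R + 1 <= 2 * g%:R :> R.
  by rewrite -natrM -mulrSr -natrM ler_nat; move: kg; lia.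
move=> h; apply: (@le_trans _ _ (2 * g%:R * c)); first by rewrite ler_pM2r.
by rewrite le_eqVlt; apply/orP; left; apply/eqP; rewrite /c; field; rewrite gt_eqF.
Qed.

Let ng8 : n%:R / g%:R <= 1 / 8 :> R.
Proof.
rewrite ler_pdivrMr//; apply: (@le_trans _ _ (1 / 8 * (8 * n%:R ^+ 2))); last first.
  by rewrite ler_pM2l.
have : n%:R * 1 <= n%:R * n%:R :> R by rewrite ler_pM2l.
lra.
Qed.

Let P_ge k : (k <= g)%N -> expR (c * k%:R ^+ 2 - k%:R * (n%:R / g%:R) ^+ 2) <= P k.
Proof.
elim: k => [|k IH] kg; first by rewrite /P big_ord0 expr0n mulr0 mul0r subr0 expR0.
rewrite /P big_ord_recr/= -/(P k) -(addn1 k) natrD.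
set d := n%:R / g%:R; set z := (2 * k%:R + 1) * c.
rewrite (_ : _ - _ = c * k%:R ^+ 2 - k%:R * d ^+ 2 + (z - d ^+ 2)); last by rewrite /z; ring.
rewrite expRD; apply: ler_pM; rewrite ?expR_ge0//; first exact: IH (ltnW kg).
have z0 : 0 <= z by rewrite mulr_ge0 ?addr_ge0 ?mulr_ge0// ltW.
have zd : z <= d by exact: small.
have z1 : `|z| <= 1 / 2 by rewrite ger0_norm//; apply: le_trans zd _; apply: le_trans ng8 _; lra.
apply: le_trans (expR_le1D z1 (lexx _)); rewrite ler_expR lerD2l lerN2.
rewrite (_ : 1 / 2 + 1 / 2 = 1); last by lra.
by rewrite mul1r lerXn2r ?nnegrE//; apply: le_trans zd.
Qed.

Let gd2 k : (k <= g)%N -> k%:R * (n%:R / g%:R) ^+ 2 <= 1 / 8 :> R.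
Proof.
move=> kg; apply: (@le_trans _ _ (g%:R * (n%:R / g%:R) ^+ 2)).
  by rewrite ler_wpM2r ?sqr_ge0// ler_nat.
rewrite (_ : _ * _ = n%:R ^+ 2 / g%:R); last by field; rewrite gt_eqF.
by rewrite ler_pdivrMr//; move: ngR; lra.
Qed.

(** The product [P k] lies between [exp(c k^2 - 1/8)] and [exp(c k^2)], because the odd numbers add
    up to [k^2]. The first [k] with [P k >= m / n] overshoots by one factor, whose exponent is at
    most [n / g <= 1/8]. *)
Lemma round_countP :
  [/\ (0 < round_count)%N, L <= c * round_count%:R ^+ 2 &
      c * round_count%:R ^+ 2 <= L + 1 / 2].
Proof.
have mnL : m%:R / n%:R = expR L by rewrite lnK// posrE divr_gt0.
have [K Kg [KE Klt Kge]] := kstepP g.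
rewrite /round_count KE/= {KE}.
have up k : (k < K)%N -> c * k%:R ^+ 2 < L + 1 / 8.
  move=> kK; have kg : (k <= g)%N by exact: leq_trans (ltnW kK) Kg.
  have := Klt k kK; rewrite num_ltE mnL => h.
  have := le_lt_trans (P_ge kg) h; rewrite ltr_expR.
  by have := gd2 kg; lra.
(* Otherwise the product would still be below [m / n] at [g - 1 >= g / 2], which forces
   [n / 8 < L + 1/8], against [Ln]. *)
have Klg : (K < g)%N.
  rewrite ltn_neqAle Kg andbT; apply/eqP => Kg'.
  have g1 : (0 < g)%N by rewrite -(ltr0n R).
  have := up g.-1; rewrite Kg' ltn_predL g1 => /(_ isT).
  have : g%:R / 2 <= g.-1%:R :> R.
    rewrite ler_pdivrMr// -natrM ler_nat; move: ng n0.
    by case: (n) => // n'; case: (g) => [|[|g']] //; lia.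
  move=> h1; have : c * (g%:R / 2) ^+ 2 <= c * g.-1%:R ^+ 2.
    by rewrite ler_pM2l// lerXn2r ?nnegrE ?divr_ge0.
  rewrite (_ : c * _ = n%:R / 8); last by rewrite expr_div_n mulrA cg; lra.
  have L0 : 0 <= L.
    by rewrite ln_ge0// ler_pdivlMr// mul1r ler_nat ltnW.
  by move: Ln; lra.
have K0 : (0 < K)%N.
  rewrite lt0n; apply/eqP => K0; have := Kge Klg.
  by rewrite K0 /num /den big_ord0 expn0 !muln1 leqNgt nm.
split => //.
  have := Kge Klg; rewrite leqNgt num_ltE -leNgt mnL => /le_trans /(_ (P_le K)).
  by rewrite ler_expR.
have := up K.-1; rewrite ltn_predL K0 => /(_ isT) h.
have k1 : (K.-1 < g)%N by apply: leq_ltn_trans Klg; exact: leq_pred.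
have := small k1; have := ng8.
rewrite -[in c * _](prednK K0) -(addn1 K.-1) natrD.
rewrite (_ : c * _ ^+ 2 = c * K.-1%:R ^+ 2 + (2 * K.-1%:R + 1) * c); last by ring.
lra.
Qed.

End RoundCount.

(** * Numerical conditions on the parameters, for g = M^4 and D = M^6 *)

Section Tuning.
Context {R : realType}.
Variables (M N k : R).
Let Lam : R := N * k ^+ 2 / (2 * (M ^+ 4) ^+ 2).
Let U : R := Num.sqrt (N * k) + 2 * N.
Let e : R := (4 * M)^-1.
Hypothesis N1 : 1 <= N.
Hypothesis NM : 16 * N <= M.
Hypothesis k0 : 0 < k.
Hypothesis kM : k <= M ^+ 4.
Hypothesis L1 : 1 <= Lam.
Hypothesis LN : 400 * Lam ^+ 2 <= N.

Let M16 : 16 <= M. Proof. by move: NM N1; lra. Qed.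
Let M0 : 0 < M. Proof. by move: M16; lra. Qed.
Let N0 : 0 < N. Proof. by move: N1; lra. Qed.
Let r : R := Num.sqrt (N * k).
Let r2 : r ^+ 2 = N * k. Proof. by rewrite sqr_sqrtr// mulr_ge0// ltW. Qed.
Let r0 : 0 <= r. Proof. exact: sqrtr_ge0. Qed.
Let t : R := M^-1.
Let t0 : 0 < t. Proof. by rewrite invr_gt0. Qed.
Let t16 : t <= 1 / 16. Proof. by rewrite div1r lef_pV2 ?posrE. Qed.
Let NMt : N / M <= 1 / 16.
Proof. by rewrite ler_pdivrMr//; move: NM; lra. Qed.

Let r_le : r <= N * M ^+ 2.
Proof.
rewrite -ler_sqr ?nnegrE ?mulr_ge0 ?exprn_ge0 ?(ltW N0) ?(ltW M0)// r2 exprMn.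
rewrite expr2 -mulrA ler_pM2l// -exprM; apply: le_trans kM _.
by rewrite ler_peMl ?exprn_ge0 ?(ltW M0).
Qed.

Let U_le : U <= 2 * (N * M ^+ 2).
Proof.
have : N * 2 <= N * M ^+ 2 by rewrite ler_pM2l// expr2; move: M16; nra.
by move: r_le; rewrite /U -/r; lra.
Qed.

Let U0 : 0 <= U. Proof. by rewrite addr_ge0// mulr_ge0// ltW. Qed.

Lemma param_e : 2 * U / M ^+ 4 <= e.
Proof.
rewrite ler_pdivrMr ?exprn_gt0//; apply: (@le_trans _ _ (2 * (2 * (N * M ^+ 2)))).
  by rewrite ler_pM2l.
rewrite (_ : e * _ = M * M ^+ 2 / 4); last by rewrite /e; field; rewrite gt_eqF.
have : 16 * N * M ^+ 2 <= M * M ^+ 2 by rewrite ler_pM2r ?exprn_gt0.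
by lra.
Qed.

Let eE : e = t / 4. Proof. by rewrite /e /t; field; rewrite gt_eqF. Qed.

Lemma param_e2 : e <= 1 / 2.
Proof. by rewrite eE; move: t16; lra. Qed.

(** The square of the main part of [U] is [N k], which contributes exactly [Lam]; the cross terms
    are small since [r <= N M^2] and [16 N <= M]. *)
Let U2 : U ^+ 2 * k / (2 * (M ^+ 4) ^+ 2) <= Lam + 1 / 64.
Proof.
have -> : U ^+ 2 * k / (2 * (M ^+ 4) ^+ 2) =
    Lam + (4 * N * r + 4 * N ^+ 2) * k / (2 * (M ^+ 4) ^+ 2).
  by rewrite /U -/r sqrrD r2 /Lam; field; rewrite gt_eqF.
rewrite lerD2l.
apply: (@le_trans _ _ ((4 * N * (N * M ^+ 2) + 4 * N ^+ 2) * M ^+ 4 / (2 * (M ^+ 4) ^+ 2))).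
  rewrite ler_pM2r ?invr_gt0 ?mulr_gt0 ?exprn_gt0//.
  apply: ler_pM => //; try exact: ltW.
    by rewrite addr_ge0// !mulr_ge0 ?exprn_ge0// ltW.
  by rewrite lerD2r ler_pM2l// mulr_gt0.
rewrite [leLHS](_ : _ = (N / M) ^+ 2 * (2 + 2 * t ^+ 2)); last first.
  by rewrite /t; field; rewrite gt_eqF.
have h1 : (N / M) ^+ 2 <= (1 / 16) ^+ 2.
  by rewrite lerXn2r ?nnegrE ?divr_ge0 ?(ltW N0) ?(ltW M0).
have h2 : t ^+ 2 <= 1 by rewrite expr_le1 ?(ltW t0)//; move: t16; lra.
apply: (@le_trans _ _ ((1 / 16) ^+ 2 * 4)); last by lra.
by apply: ler_pM h1 _; [exact: sqr_ge0|have := sqr_ge0 t; lra|lra].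
Qed.

Let LamN : Lam * 400 <= N.
Proof.
apply: le_trans LN; have : Lam <= Lam * Lam by rewrite ler_peMl//; move: L1; lra.
by rewrite expr2; lra.
Qed.

Lemma param_q : (1 / 2 + e) * (U ^+ 2 * (M ^+ 6 + N) ^+ 2 /
    ((M ^+ 4) ^+ 2 * (M ^+ 6) ^+ 2)) * k <= Lam + 1 / 2.
Proof.
have -> : (1 / 2 + e) * (U ^+ 2 * (M ^+ 6 + N) ^+ 2 /
    ((M ^+ 4) ^+ 2 * (M ^+ 6) ^+ 2)) * k =
    (1 + t / 2) * (1 + N / M * t ^+ 5) ^+ 2 * (U ^+ 2 * k / (2 * (M ^+ 4) ^+ 2)).
  by rewrite /e /t; field; rewrite gt_eqF.
have s0 : 0 <= N / M * t ^+ 5.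
  by rewrite mulr_ge0 ?exprn_ge0 ?(ltW t0)// divr_ge0 ?(ltW N0) ?(ltW M0).
have s1 : N / M * t ^+ 5 <= t / 16.
  apply: (@le_trans _ _ (1 / 16 * t)); last by lra.
  apply: ler_pM; rewrite ?exprn_ge0 ?divr_ge0 ?(ltW t0) ?(ltW N0) ?(ltW M0)//.
  rewrite exprS ler_piMr ?(ltW t0)//.
  by rewrite exprn_ile1 ?(ltW t0)//; move: t16; lra.
set s := N / M * _ in s0 s1 *.
have h : (1 + t / 2) * (1 + s) ^+ 2 <= 1 + t.
  apply: (@le_trans _ _ ((1 + t / 2) * (1 + t / 16) ^+ 2)).
    rewrite ler_pM2l; last by move: t0; lra.
    by rewrite lerXn2r ?nnegrE; move: s0 s1 t0; lra.
  have : t * t <= t * (1 / 16) by rewrite ler_pM2l.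
  have : t * (t * t) <= t * (1 / 16).
    rewrite ler_pM2l//; apply: (@le_trans _ _ (1 * (1 / 16))); last by lra.
    by apply: ler_pM; move: t0 t16; lra.
  by move: t0; lra.
apply: (@le_trans _ _ ((1 + t) * (Lam + 1 / 64))).
  apply: ler_pM => //.
    by rewrite mulr_ge0 ?sqr_ge0//; move: t0; lra.
  by rewrite divr_ge0 ?mulr_ge0 ?exprn_ge0 ?(ltW k0) ?(ltW M0).
have h1 : t * (Lam * 400) <= t * N by rewrite ler_pM2l.
have h2 : t * N <= 1 / 16 by rewrite mulrC.
by move: t16; lra.
Qed.

(** The first term equals [32 Lam^2 / N]. This is where [Lam] has to be small against the square
    root of the dimension, that is, where [m] must be subexponential in [sqrt n]. *)
Lemma param_q' : (1 / 2 + e) * ((k / (M ^+ 4) ^+ 2) ^+ 2 *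
    (8 * N * k + 32 * N ^+ 3)) * k <= 1 / 10.
Proof.
apply: (@le_trans _ _ (1 * ((k / (M ^+ 4) ^+ 2) ^+ 2 * (8 * N * k + 32 * N ^+ 3)) * k)).
  rewrite ler_pM2r// ler_wpM2r//; last by move: param_e2; lra.
  by rewrite mulr_ge0 ?sqr_ge0// addr_ge0// !mulr_ge0 ?exprn_ge0 ?(ltW N0) ?(ltW k0).
have -> : 1 * ((k / (M ^+ 4) ^+ 2) ^+ 2 * (8 * N * k + 32 * N ^+ 3)) * k =
    32 * (Lam ^+ 2 / N) + 32 * (N / M) ^+ 3 * (k / M ^+ 4) ^+ 3 * t.
  by rewrite /Lam /t; field; rewrite !gt_eqF.
have h1 : Lam ^+ 2 / N <= 1 / 400 by rewrite ler_pdivrMr//; move: LN; lra.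
have a0 : 0 <= N / M by rewrite divr_ge0 ?(ltW N0) ?(ltW M0).
have b0 : 0 <= k / M ^+ 4 by rewrite divr_ge0 ?exprn_ge0 ?(ltW k0) ?(ltW M0).
have b1 : k / M ^+ 4 <= 1 by rewrite ler_pdivrMr ?exprn_gt0// mul1r.
move: NMt a0 b0 b1; move: (N / M) (k / M ^+ 4) => a b a1 a0 b0 b1.
have h2 : a ^+ 3 <= (1 / 16) ^+ 3 by rewrite lerXn2r ?nnegrE.
have h3 : b ^+ 3 <= 1 by rewrite exprn_ile1.
have h4 : a ^+ 3 * b ^+ 3 <= (1 / 16) ^+ 3 * 1 by apply: ler_pM; rewrite ?exprn_ge0.
have h5 : a ^+ 3 * b ^+ 3 * t <= (1 / 16) ^+ 3 * 1 * 1.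
  apply: ler_pM; rewrite ?mulr_ge0 ?exprn_ge0 ?(ltW t0)//.
  by move: t16; lra.
by lra.
Qed.

Lemma param_D : 20 * N * Lam <= M ^+ 6.
Proof.
have h : N * (Lam * 400) <= N * N by rewrite ler_pM2l.
have h1 : N * N <= M * M by apply: ler_pM; move: NM N0; lra.
have h2 : M * M <= M ^+ 6.
  rewrite -expr2 ler_weXn2l//; by move: M16; lra.
by move: (mulr_ge0 (ltW N0) (ltW N0)); lra.
Qed.

Lemma param_drift : 2 * N * U * (M ^+ 6) ^+ 2 + k * N ^+ 2 * U * M ^+ 6 <=
  M ^+ 4 * (M ^+ 6) ^+ 2.
Proof.
apply: (@le_trans _ _ (2 * N * (2 * (N * M ^+ 2)) * (M ^+ 6) ^+ 2 +
    M ^+ 4 * N ^+ 2 * (2 * (N * M ^+ 2)) * M ^+ 6)).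
  apply: lerD.
    by rewrite ler_pM2r ?exprn_gt0// ler_pM2l// mulr_gt0.
  rewrite ler_pM2r ?exprn_gt0//; apply: ler_pM => //.
    by rewrite mulr_ge0 ?sqr_ge0// ltW.
  by rewrite ler_pM2r ?exprn_gt0.
have -> : 2 * N * (2 * (N * M ^+ 2)) * (M ^+ 6) ^+ 2 +
    M ^+ 4 * N ^+ 2 * (2 * (N * M ^+ 2)) * M ^+ 6 =
    (4 * (N / M) ^+ 2 + 2 * (N / M) ^+ 3 * t) * (M ^+ 4 * (M ^+ 6) ^+ 2).
  by rewrite /t; field; rewrite gt_eqF.
rewrite ler_piMl ?mulr_ge0 ?exprn_ge0 ?(ltW M0)//.
have h2 : (N / M) ^+ 2 <= (1 / 16) ^+ 2.
  by rewrite lerXn2r ?nnegrE ?divr_ge0 ?(ltW N0) ?(ltW M0).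
have h3 : (N / M) ^+ 3 <= (1 / 16) ^+ 3.
  by rewrite lerXn2r ?nnegrE ?divr_ge0 ?(ltW N0) ?(ltW M0).
have : (N / M) ^+ 3 * t <= (1 / 16) ^+ 3 * 1.
  apply: ler_pM => //; rewrite ?exprn_ge0 ?divr_ge0 ?(ltW N0) ?(ltW M0) ?(ltW t0)//.
  by move: t16; lra.
by lra.
Qed.

End Tuning.

(** * Inner products of the constructed points *)

Section CodeBounds.
Variables (m n : nat).

Definition rounds : nat := round_count m n (m ^ 4).

Definition vectors (i : nat) : 'rV[int]_n :=
  new_vector rounds (m ^ 4) (m ^ 6) (code n rounds (m ^ 4) (m ^ 6) m i) i m.

Definition code_point (R : realType) (i : nat) : 'rV[R]_n :=
  (norm2 (cst_mx (vectors i) : 'rV[R]_n))^-1 *: cst_mx (vectors i).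

Lemma codeE i j : (j < i)%N ->
  code n rounds (m ^ 4) (m ^ 6) m i j = vectors j.
Proof.
rewrite /vectors /code; elim: i => // i IH.
rewrite ltnS leq_eqVlt => /orP[/eqP ->|ji] /=; first by rewrite eqxx.
by rewrite (ltn_eqF ji) IH.
Qed.

Context {R : realType}.

(** The constant is used twice: [4 * 27/40 = 27/10] bounds [ln(m/n)] from below when [m / n >= 16],
    and [20 ln 2 >= 12] converts the error term to base 2. *)
Lemma ln2_ge : 27 / 40 <= ln 2 :> R.
Proof.
rewrite -[leLHS]expRK ler_ln ?posrE ?expR_gt0//.
have h : expR (27 / 40) * (613 / 640) ^+ 16 <= 1 :> R.
  rewrite -ler_pdivlMl ?expR_gt0// mulr1 -expRN.
  have -> : - (27 / 40) = 16%:R * (- (27 / 640)) :> R by lra.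
  rewrite expRM_natl; apply: lerXn2r; rewrite ?nnegrE ?expR_ge0; [lra|by []|].
  by have := expR_ge1Dx (- (27 / 640) : R); lra.
have h2 : 1 / 2 <= (613 / 640) ^+ 16 :> R by lra.
have : expR (27 / 40) * (1 / 2) <= 1 :> R.
  by apply: le_trans h; rewrite ler_pM2l ?expR_gt0.
lra.
Qed.

(** Inequalities between polynomials in [a = 1 / Lam] and [b = 1 / L], with [a <= b <= 10/27]. The
    second amounts to [5 a >= 27/2 a^2], that is [a <= 10/27]. In the last, the right-hand side is
    [2 L (1 + 1 / (2 L))^2]. *)
Lemma ratio_bounds (L Lam : R) : 27 / 10 <= L -> L <= Lam -> Lam <= L + 1 / 2 ->
  [/\ 0 <= 1 + 5 / (2 * Lam),
      1 + 5 / (2 * Lam) <= (1 + 9 / Lam) * (1 - 3 / (2 * Lam)),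
      (1 + 1 / (2 * L)) * (1 + 9 / Lam) <= 1 + 12 / L &
      2 * Lam <= 2 * L + 2 + 1 / (2 * L)].
Proof.
move=> L1 kL kU; have L0 : 0 < L by lra.
have LL0 : 0 < Lam by lra.
have -> : 5 / (2 * Lam) = 5 / 2 * Lam^-1 by field; rewrite gt_eqF.
have -> : 3 / (2 * Lam) = 3 / 2 * Lam^-1 by field; rewrite gt_eqF.
have -> : 1 / (2 * L) = 1 / 2 * L^-1 by field; rewrite gt_eqF.
have iL : Lam^-1 <= L^-1 by rewrite lef_pV2 ?posrE.
have iL0 : 0 < Lam^-1 by rewrite invr_gt0.
have iL1 : L^-1 <= 10 / 27.
  by rewrite -[10 / 27]invrK lef_pV2 ?posrE ?invr_gt0//; lra.
move: iL iL0 iL1; move: (Lam^-1) (L^-1) => a b ab a0 b1.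
have h1 : a * a <= a * (10 / 27) by rewrite ler_pM2l//; apply: le_trans b1.
have b0 : 0 < b by exact: lt_le_trans ab.
have h2 : b * b <= b * (10 / 27) by rewrite ler_pM2l.
have h3 : b * a <= b * b by rewrite ler_pM2l.
by split; lra.
Qed.

Let L : R := ln (m%:R / n%:R).
Let N : R := n%:R.
Let M : R := m%:R.
Let k : R := rounds%:R.
Let Lam : R := N * k ^+ 2 / (2 * (M ^+ 4) ^+ 2).
Hypothesis n0 : (0 < n)%N.
Hypothesis nm : (16 * n <= m)%N.
Hypothesis hL : 10 ^+ 7 * L ^+ 2 <= N.

Let N0 : 0 < N. Proof. by rewrite ltr0n. Qed.
Let N1 : 1 <= N. Proof. by rewrite ler1n. Qed.
Let NM : 16 * N <= M. Proof. by rewrite -natrM ler_nat. Qed.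
Let m0 : (0 < m)%N. Proof. by apply: leq_trans nm; rewrite muln_gt0. Qed.
Let M0 : 0 < M. Proof. by rewrite ltr0n. Qed.
Let MN : m%:R / n%:R = expR L :> R.
Proof. by rewrite lnK// posrE divr_gt0. Qed.

Lemma log_ratio_ge : 27 / 10 <= L.
Proof.
apply: (@le_trans _ _ (ln (2 ^+ 4))); first by rewrite lnXn//; have := ln2_ge; lra.
rewrite ler_ln ?posrE ?exprn_gt0 ?divr_gt0//.
rewrite ler_pdivlMr//; move: NM; lra.
Qed.

Let L1 := log_ratio_ge.

Let LN : 10 ^+ 7 * L <= N.
Proof.
apply: le_trans hL; have : L <= L * L by rewrite ler_peMl//; move: L1; lra.
rewrite expr2; lra.
Qed.

Let nltm : (n < m)%N.
Proof. by apply: leq_trans nm; rewrite ltn_Pmull. Qed.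

Let n16 : (8 * (n * n) <= m ^ 4)%N.
Proof.
have h : (16 * n * (16 * n) <= m * m)%N by exact: leq_mul.
apply: (@leq_trans (m * m)); first by apply: leq_trans h; rewrite mulnACA leq_mul2r orbT.
by rewrite mulnn leq_pexp2l.
Qed.

Let roundsP : [/\ (0 < rounds)%N, L <= Lam & Lam <= L + 1 / 2].
Proof.
have h : 16 * ln (m%:R / n%:R) + 4 <= n%:R :> R.
  by move: LN L1; rewrite /L /N; set l := ln _; move: l (n%:R) => a b; lra.
have [k0 kL kU] := round_countP (R := R) n0 nltm n16 h.
have E : Lam = n%:R / (2 * (m ^ 4)%:R ^+ 2) * rounds%:R ^+ 2.
  by rewrite /Lam /N /M /k natrX; field; rewrite gt_eqF.
by rewrite E.
Qed.

Let U : R := Num.sqrt (N * k) + 2 * N.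

Lemma vectorsP i : (i < m)%N ->
  let w j : 'rV[R]_n := cst_mx (vectors j) in
  [/\ norm2 (w i) <= U * (m ^ 6)%:R,
      N * k * (m ^ 6)%:R ^+ 2 * (1 - 3 / (2 * Lam)) <= dot (w i) (w i) &
      forall j, (j < i)%N ->
        dot (w j) (w i) <= (m ^ 4)%:R * (m ^ 6)%:R ^+ 2 * (2 * Lam + 5)].
Proof.
have [k0 kL kU] := roundsP.
have kR0 : 0 < k by rewrite ltr0n.
have kg : (rounds <= m ^ 4)%N by exact: round_count_le.
have kM : k <= M ^+ 4 by rewrite -natrX ler_nat.
have Lam1 : 1 <= Lam by move: L1 kL; lra.
have LamN : 400 * Lam ^+ 2 <= N.
  apply: le_trans hL; have : Lam ^+ 2 <= (2 * L) ^+ 2.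
    by rewrite lerXn2r ?nnegrE; move: L1 kL kU; lra.
  by have := sqr_ge0 L; rewrite exprMn; lra.
elim/ltn_ind: i => i IH im w.
have VU j : (j < i)%N -> norm2 (cst_mx
    (code n rounds (m ^ 4) (m ^ 6) m i j) : 'rV[R]_n) <= U * (m ^ 6)%:R.
  by move=> ji; rewrite codeE//; case: (IH j ji (ltn_trans ji im)).
have [|||||||||xU xN xV] := @walkP R n rounds (m ^ 4) (m ^ 6) m
    (code n rounds (m ^ 4) (m ^ 6) m i) i ((4 * M)^-1) n0 _ k0 _ kg im VU.
- by rewrite expn_gt0 m0.
- apply: leq_trans (ltnW nltm) _; rewrite -{1}(expn1 m); exact: leq_pexp2l.
- by rewrite natrX; apply: param_e.
- exact: param_e2 N1 NM.
- by rewrite !natrX; apply: param_q.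
- by rewrite !natrX; apply: param_q'.
- apply: (@le_trans _ _ (N * expR L)); first by rewrite -MN mulrCA divff ?mulr1 ?gt_eqF.
  by rewrite natrX ler_pM2l// ler_expR.
- by rewrite !natrX; apply: param_D.
- by rewrite !natrX; apply: param_drift.
(* The lower bound on the squared norm is positive, so the fallback of [new_vector] is not taken. *)
have wE : vectors i = (walk rounds (m ^ 4) (m ^ 6)
    (code n rounds (m ^ 4) (m ^ 6) m i) i m).1.
  rewrite /vectors /new_vector; case: ifPn => //; rewrite -(@ltr0z R) -dot_intr.
  case/negP; apply: lt_le_trans xN.
  rewrite !natrX -/N -/M -/k -/Lam; apply: mulr_gt0.
    by rewrite !mulr_gt0 ?exprn_gt0.
  have L2 : 0 < 2 * Lam by move: Lam1; lra.
  by rewrite subr_gt0 (ltr_pdivrMr _ _ L2); move: L1 kL; lra.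
rewrite /w wE; split.
- exact: xU.
- by move: xN; rewrite !natrX.
- by move=> j ji; have := xV j ji; rewrite codeE// !natrX.
Qed.

(** The walk of the later vector bounds the inner product by
    [B = n K D^2 (K / g) (1 + 5 / (2 Lam))], and both squared norms are at least [T]. Then
    [K / g = sqrt(2 Lam / n)] is compared with [sqrt(2 L / n)], using [Lam <= L + 1/2]. *)
Lemma code_dot_le i j : (i < m)%N -> (j < m)%N -> i != j ->
  dot (code_point R i) (code_point R j) <= Num.sqrt (2 * L / N) * (1 + 12 / L).
Proof.
have [k0 kL kU] := roundsP.
have L0 : 0 < L by move: L1; lra.
have LL0 : 0 < Lam by lra.
wlog ji : i j / (j < i)%N.
  move=> H im jm; rewrite neq_ltn => /orP[ij|ji].
    by rewrite dotC; apply: H => //; rewrite gtn_eqF.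
  by apply: H => //; rewrite gtn_eqF.
move=> im jm _; pose w l : 'rV[R]_n := cst_mx (vectors l).
have [_ wi wij] := vectorsP im; have [_ wj _] := vectorsP jm.
have {}wij := wij j ji; rewrite -/(w i) -/(w j) in wi wj wij.
set T := N * k * _ * _ in wi wj; set B := _ * (2 * Lam + 5) in wij.
have D0 : 0 < (m ^ 6)%:R :> R by rewrite ltr0n expn_gt0 m0.
have g0 : 0 < (m ^ 4)%:R :> R by rewrite ltr0n expn_gt0 m0.
have kR0 : 0 < k by rewrite ltr0n.
have frac : 0 < 1 - 3 / (2 * Lam).
  have L2 : 0 < 2 * Lam by rewrite mulr_gt0.
  by rewrite subr_gt0 (ltr_pdivrMr _ _ L2); move: L1 kL; lra.
have T0 : 0 < T by rewrite !mulr_gt0 ?exprn_gt0.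
have B0 : 0 <= B by rewrite !mulr_ge0 ?exprn_ge0 ?(ltW D0) ?(ltW g0)//; lra.
have sT l : T <= dot (w l) (w l) -> Num.sqrt T <= norm2 (w l).
  by move=> h; rewrite ler_wsqrtr.
have vE : dot (code_point R i) (code_point R j) = dot (w j) (w i) / (norm2 (w i) * norm2 (w j)).
  by rewrite /code_point dotZl dotZr dotC -/(w i) -/(w j) mulrA -invfM mulrC.
have rhs0 : 0 <= Num.sqrt (2 * L / N) * (1 + 12 / L).
  by rewrite mulr_ge0 ?sqrtr_ge0// addr_ge0 ?divr_ge0 ?(ltW L0).
have nT : T <= norm2 (w i) * norm2 (w j).
  rewrite -(sqr_sqrtr (ltW T0)) expr2; apply: ler_pM; rewrite ?sqrtr_ge0//; exact: sT.
have nn0 := lt_le_trans T0 nT.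
rewrite vE ler_pdivrMr//; apply: le_trans wij _.
apply: (@le_trans _ _ (Num.sqrt (2 * L / N) * (1 + 12 / L) * T)); last first.
  by rewrite ler_wpM2l.
have kg : k / (m ^ 4)%:R <= Num.sqrt (2 * L / N) * (1 + 1 / (2 * L)).
  have p0 : 0 <= 2 * L / N by rewrite divr_ge0 ?mulr_ge0 ?(ltW L0) ?(ltW N0).
  have q0 : 0 <= 1 + 1 / (2 * L) by rewrite addr_ge0 ?divr_ge0 ?mulr_ge0 ?(ltW L0).
  rewrite -ler_sqr ?nnegrE ?mulr_ge0 ?sqrtr_ge0 ?divr_ge0 ?(ltW kR0) ?(ltW g0)//.
  rewrite [leRHS]exprMn sqr_sqrtr//.
  have -> : (k / (m ^ 4)%:R) ^+ 2 = 2 * Lam / N.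
    by rewrite /Lam natrX; field; rewrite !gt_eqF.
  have -> : 2 * L / N * (1 + 1 / (2 * L)) ^+ 2 = (2 * L + 2 + 1 / (2 * L)) / N.
    by field; rewrite !gt_eqF.
  rewrite ler_pM2r ?invr_gt0//.
  by case: (ratio_bounds L1 kL kU).
have BE : B = N * k * (m ^ 6)%:R ^+ 2 * (k / (m ^ 4)%:R) * (1 + 5 / (2 * Lam)).
  by rewrite /B /Lam natrX natrX; field; rewrite !gt_eqF.
have c0 : 0 < N * k * (m ^ 6)%:R ^+ 2 by rewrite !mulr_gt0 ?exprn_gt0.
rewrite BE /T; move: c0; set c := N * k * _ => c0.
have [f0 f1 f2 _] := ratio_bounds L1 kL kU.
have s0 := sqrtr_ge0 (2 * L / N); set s := Num.sqrt _ in kg s0 rhs0 *.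
apply: (@le_trans _ _ (c * (s * (1 + 1 / (2 * L))) * ((1 + 9 / Lam) * (1 - 3 / (2 * Lam))))).
  apply: ler_pM => //.
  - by rewrite mulr_ge0 ?divr_ge0 ?(ltW c0) ?(ltW kR0) ?(ltW g0).
  - by rewrite ler_pM2l.
have -> : c * (s * (1 + 1 / (2 * L))) * ((1 + 9 / Lam) * (1 - 3 / (2 * Lam))) =
  s * ((1 + 1 / (2 * L)) * (1 + 9 / Lam)) * (c * (1 - 3 / (2 * Lam))) by ring.
rewrite -mulrA [leRHS](_ : _ = s * ((1 + 12 / L) * (c * (1 - 3 / (2 * Lam))))); last by ring.
by rewrite ler_wpM2l// ler_wpM2r// ltW// mulr_gt0.
Qed.

End CodeBounds.

(** * Programs with bounded loops *)

(** With bounded loops only, the final memory and the running time become functions defined by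
    recursion, and correctness needs no reasoning about derivations of [exec]. *)
Inductive prog :=
  | PWrite of nat & expr & expr
  | PSeq of prog & prog
  | PIf of expr & prog
  | PFor of nat & expr & prog.

Definition var (a : nat) : expr := Read a (Const 0).

Fixpoint compile (p : prog) : cmd :=
  match p with
  | PWrite a e1 e2 => Write a e1 e2
  | PSeq p1 p2 => Seq (compile p1) (compile p2)
  | PIf e p1 => If e (compile p1) Skip
  | PFor v e p1 =>
      Seq (Write v (Const 0) (Const 0))
        (While (Bin Defs.Sub e (var v))
          (Seq (compile p1) (Write v (Const 0) (Bin Defs.Add (var v) (Const 1)))))
  end.

Definition loop_count (s : memory) (e : expr) : nat := absz (Num.max 0 (Defs.eval s e)).

(** A loop sets its counter to [k + 1] after iteration [k], where the compiled program increments
    it; the two agree for programs satisfying [wf]. *)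
Fixpoint run (p : prog) (s : memory) : memory :=
  match p with
  | PWrite a e1 e2 => update s a (Defs.eval s e1) (Defs.eval s e2)
  | PSeq p1 p2 => run p2 (run p1 s)
  | PIf e p1 => if 0 < Defs.eval s e then run p1 s else s
  | PFor v e p1 =>
      iteri (loop_count s e) (fun k s' => update (run p1 s') v 0 k.+1%:Z)
        (update s v 0 0)
  end.

Definition loop_state (v : nat) (p : prog) (s : memory) (k : nat) : memory :=
  iteri k (fun k s' => update (run p s') v 0 k.+1%:Z) (update s v 0 0).

Fixpoint reads (e : expr) : seq nat :=
  match e with
  | Const _ => [::]
  | Read a e1 => a :: reads e1
  | Bin _ e1 e2 => reads e1 ++ reads e2
  end.

Fixpoint writes (p : prog) : seq nat :=
  match p with
  | PWrite a _ _ => [:: a]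
  | PSeq p1 p2 => writes p1 ++ writes p2
  | PIf _ p1 => writes p1
  | PFor v _ p1 => v :: writes p1
  end.

(** The body of a loop changes neither the counter nor an array read by the bound, so the guard of
    the compiled loop, evaluated anew each time, keeps the same bound. *)
Fixpoint wf (p : prog) : bool :=
  match p with
  | PWrite _ _ _ => true
  | PSeq p1 p2 => wf p1 && wf p2
  | PIf _ p1 => wf p1
  | PFor v e p1 =>
      [&& v \notin writes p1, all (fun a => a \notin v :: writes p1) (reads e) & wf p1]
  end.

Fixpoint time (p : prog) (s : memory) : nat :=
  match p with
  | PWrite a e1 e2 => cost s e1 + cost s e2
  | PSeq p1 p2 => time p1 s + time p2 (run p1 s)
  | PIf e p1 => cost s e + (if (0 < Defs.eval s e)%R then time p1 s else 1)
  | PFor v e p1 =>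
      let st k := loop_state v p1 s k in
      cost s (Const 0) + cost s (Const 0) +
      (\sum_(k < loop_count s e)
         (cost (st k) (Bin Defs.Sub e (var v)) +
          (time p1 (st k) +
           (cost (run p1 (st k)) (Const 0) +
            cost (run p1 (st k)) (Bin Defs.Add (var v) (Const 1))))) +
       cost (st (loop_count s e)) (Bin Defs.Sub e (var v)))
  end%N.

Lemma updateE s a x y : update s a x y a x = y.
Proof. by rewrite /update !eqxx. Qed.

Lemma update_array s a b x y : b != a -> update s a x y b = s b.
Proof.
by move=> /negbTE ba; apply/funext => z; rewrite /update ba.
Qed.

Lemma run_frame p s a : a \notin writes p -> run p s a = s a.
Proof.
elim: p s => [b e1 e2|p1 IH1 p2 IH2|e p1 IH|v e p1 IH] s /=.
- by rewrite inE => /update_array.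
- by rewrite mem_cat negb_or => /andP[/IH1 h1 /IH2 h2]; rewrite h2 h1.
- by move=> /IH h; case: ifP.
- rewrite inE negb_or => /andP[av /IH h].
  elim: (loop_count s e) => [|k IHk] /=; first exact: update_array.
  by rewrite update_array// h IHk.
Qed.

Lemma eval_ext s s' e : {in reads e, s =1 s'} -> Defs.eval s e = Defs.eval s' e.
Proof.
elim: e => [z|a e IH|o e1 IH1 e2 IH2] //= h.
  rewrite IH; first by rewrite h// inE eqxx.
  by move=> b be; apply: h; rewrite inE be orbT.
by rewrite IH1 ?IH2// => b be; apply: h; rewrite mem_cat be ?orbT.
Qed.

Lemma loop_state_frame v p s k a :
  a \notin v :: writes p -> loop_state v p s k a = s a.
Proof.
rewrite inE negb_or => /andP[av ap]; rewrite /loop_state.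
elim: k => [|k IH] /=; first exact: update_array.
by rewrite update_array// run_frame.
Qed.

Lemma loop_state_counter v p s k : v \notin writes p ->
  loop_state v p s k v 0 = k%:Z.
Proof. by case: k => [|k] vp; rewrite /loop_state/= updateE. Qed.

Lemma exec_compile p s : wf p -> exec (compile p) s (run p s) (time p s).
Proof.
elim: p s => [a e1 e2|p1 IH1 p2 IH2|e p1 IH|v e p1 IH] s /=.
- by move=> _; exact: exec_write.
- by move=> /andP[w1 w2]; apply: exec_seq; [exact: IH1|exact: IH2].
- move=> w; case: (boolP (0 < Defs.eval s e)) => h.
    by apply: exec_if_true => //; exact: IH.
  by apply: exec_if_false => //; exact: exec_skip.
- move=> /and3P[vp /allP re w1].
  apply: exec_seq; first exact: exec_write.
  set N := loop_count s e.
  have evE k : Defs.eval (loop_state v p1 s k) e = Defs.eval s e.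
    apply: eval_ext => a /re av.
    by rewrite loop_state_frame.
  pose tm k := (cost (loop_state v p1 s k) (Bin Defs.Sub e (var v)) +
     (time p1 (loop_state v p1 s k) +
      (cost (run p1 (loop_state v p1 s k)) (Const 0) +
       cost (run p1 (loop_state v p1 s k)) (Bin Defs.Add (var v) (Const 1)))))%N.
  rewrite -[iteri _ _ _]/(loop_state v p1 s N) -[update s _ _ _]/(loop_state v p1 s 0).
  suff H d k : (k + d)%N = N -> exec (While (Bin Defs.Sub e (var v))
      (Seq (compile p1) (Write v (Const 0) (Bin Defs.Add (var v) (Const 1)))))
      (loop_state v p1 s k) (loop_state v p1 s N)
      (\sum_(k <= j < N) tm j + cost (loop_state v p1 s N) (Bin Defs.Sub e (var v)))%N.
    by have := H N 0%N (add0n N); rewrite big_mkord.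
  elim: d k => [|d IHd] k.
    rewrite addn0 => ->; rewrite big_geq// add0n; apply: exec_while_false.
    rewrite /= evE loop_state_counter// -leNgt subr_le0 /N /loop_count.
    by rewrite gez0_abs ?le_max ?lexx// orbT.
  move=> kN; have klt : (k < N)%N by rewrite -kN addnS ltnS leq_addr.
  rewrite big_ltn// -addnA.
  apply: (@exec_while_true _ _ _ (loop_state v p1 s k.+1)).
  - rewrite /= evE loop_state_counter// subr_gt0.
    move: klt; rewrite /N /loop_count -ltz_nat gez0_abs ?le_max ?lexx//.
    by rewrite lt_max ltNge lez_nat leq0n.
  - apply: exec_seq; first exact: IH.
    have -> : loop_state v p1 s k.+1 = update (run p1 (loop_state v p1 s k)) v
        (Defs.eval (run p1 (loop_state v p1 s k)) (Const 0))
        (Defs.eval (run p1 (loop_state v p1 s k)) (Bin Defs.Add (var v) (Const 1))).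
      rewrite /loop_state/= -/(loop_state v p1 s k) run_frame//.
      by rewrite loop_state_counter// -addn1 PoszD.
    exact: exec_write.
  - by apply: IHd; rewrite addSnnS.
Qed.

(** * Cost *)

Definition bounded (b : nat) (z : int) : bool := (`|z| <= 2 ^ b)%N.

Definition bounded_memory (b : nat) (s : memory) : Prop := forall a z, bounded b (s a z).

(** The constant in the O(b) bits of a value computed from entries of [b] bits. Division, also by 0,
    does not increase absolute values. *)
Fixpoint bit_factor (e : expr) : nat :=
  match e with
  | Const z => `|z|%N
  | Read _ _ => 1
  | Bin Defs.Add e1 e2 | Bin Defs.Sub e1 e2 => (bit_factor e1 + bit_factor e2).+1
  | Bin Defs.Mul e1 e2 => bit_factor e1 + bit_factor e2
  | Bin Defs.Div e1 e2 => bit_factor e1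
  end.

Fixpoint cost_factor (e : expr) : nat :=
  ((bit_factor e).+1 +
   match e with
   | Const _ => 0
   | Read _ e1 => cost_factor e1
   | Bin _ e1 e2 => cost_factor e1 + cost_factor e2
   end)%N.

Lemma bounded_mono b c z : (b <= c)%N -> bounded b z -> bounded c z.
Proof. by move=> bc /leq_trans; apply; rewrite leq_pexp2l. Qed.

Lemma boundedM b c x y : bounded b x -> bounded c y -> bounded (b + c) (x * y).
Proof. by move=> xb yc; rewrite /bounded abszM expnD; exact: leq_mul. Qed.

Lemma boundedN b x : bounded b (- x) = bounded b x.
Proof. by rewrite /bounded abszN. Qed.

Lemma absz_addr (x y : int) : (absz (x + y)%R <= absz x + absz y)%N.
Proof. lia. Qed.

Lemma boundedD b c x y : bounded b x -> bounded c y -> bounded (maxn b c).+1 (x + y).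
Proof.
move=> xb yc; apply: leq_trans (absz_addr x y) _.
rewrite expnS mul2n -addnn; apply: leq_add.
  by apply: leq_trans xb _; rewrite leq_pexp2l// leq_maxl.
by apply: leq_trans yc _; rewrite leq_pexp2l// leq_maxr.
Qed.

Lemma bounded_eval b s e : bounded_memory b s ->
  bounded (bit_factor e * b.+1) (Defs.eval s e).
Proof.
move=> sb; elim: e => [z|a e IH|o e1 IH1 e2 IH2] /=.
- apply: (@bounded_mono `|z|); first exact: leq_pmulr.
  by rewrite /bounded ltnW// ltn_expl.
- by rewrite mul1n; apply: bounded_mono (sb _ _).
- have maxD : ((maxn (bit_factor e1 * b.+1) (bit_factor e2 * b.+1)).+1 <=
      (bit_factor e1 + bit_factor e2).+1 * b.+1)%N.
    rewrite mulSn mulnDl -addn1 addnC leq_add// geq_max leq_addr leq_addl.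
    by [].
  case: o => /=.
  + by apply: bounded_mono maxD _; exact: boundedD.
  + by apply: bounded_mono maxD _; apply: boundedD => //; rewrite boundedN.
  + by rewrite mulnDl; exact: boundedM.
  + by apply: leq_trans IH1; exact: lez_div.
Qed.

Lemma bitsize_le b z : bounded b z -> (bitsize z <= b.+1)%N.
Proof.
move=> zb; rewrite /bitsize ltnS.
by apply: (@leq_trans (trunc_log 2 (2 ^ b))); [exact: leq_trunc_log|rewrite trunc_expnK].
Qed.

Lemma cost_le b s e : bounded_memory b s -> (cost s e <= cost_factor e * b.+1)%N.
Proof.
move=> sb; have H e' : (bitsize (Defs.eval s e') <= (bit_factor e').+1 * b.+1)%N.
  apply: leq_trans (bitsize_le (bounded_eval e' sb)) _.
  by rewrite mulSn addSn ltnS leq_addl.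
elim: e => [z|a e IH|o e1 IH1 e2 IH2].
- by move: (H (Const z)); rewrite /= !addn0.
- by rewrite /= mulnDl; apply: leq_add IH; exact: H (Read a e).
- rewrite /= !mulnDl; apply: leq_add; first exact: H (Bin o e1 e2).
  exact: leq_add.
Qed.

(** Only written values and loop counts are constrained; the intermediate values of an expression
    are covered by [bit_factor]. *)
Fixpoint safe (b M : nat) (p : prog) (s : memory) : Prop :=
  match p with
  | PWrite a _ e2 => bounded b (Defs.eval s e2)
  | PSeq p1 p2 => safe b M p1 s /\ safe b M p2 (run p1 s)
  | PIf e p1 => 0 < Defs.eval s e -> safe b M p1 s
  | PFor v e p1 => (loop_count s e <= M)%N /\
      forall k, (k < loop_count s e)%N -> safe b M p1 (loop_state v p1 s k)
  end.

Lemma bounded_update b s a x y :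
  bounded_memory b s -> bounded b y -> bounded_memory b (update s a x y).
Proof. by move=> sb yb c z; rewrite /update; case: ifP. Qed.

Lemma bounded_run b M p s : (M <= 2 ^ b)%N -> bounded_memory b s ->
  safe b M p s -> bounded_memory b (run p s).
Proof.
move=> Mb; elim: p s => [a e1 e2|p1 IH1 p2 IH2|e p1 IH|v e p1 IH] s sb /=.
- exact: bounded_update.
- by move=> [s1 s2]; apply: IH2 => //; exact: IH1.
- by case: ifP => // h s1; apply: IH => //; exact: s1.
- move=> [NM sf]; rewrite -[iteri _ _ _]/(loop_state v p1 s _).
  have H k : (k <= loop_count s e)%N -> bounded_memory b (loop_state v p1 s k).
    elim: k => [|k IHk] kN; first by apply: bounded_update; rewrite // /bounded.
    apply: bounded_update; last by rewrite /bounded (leq_trans _ Mb)// (leq_trans kN).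
    by apply: IH; [exact: IHk (ltnW kN)|exact: sf].
  exact: H.
Qed.

Fixpoint time_factor (p : prog) (M : nat) : nat :=
  match p with
  | PWrite _ e1 e2 => cost_factor e1 + cost_factor e2
  | PSeq p1 p2 => time_factor p1 M + time_factor p2 M
  | PIf e p1 => cost_factor e + (time_factor p1 M).+1
  | PFor v e p1 =>
      let c := (cost_factor (Bin Defs.Sub e (var v)) + cost_factor (Const 0) +
        cost_factor (Bin Defs.Add (var v) (Const 1)))%N in
      cost_factor (Const 0) + cost_factor (Const 0) +
      M * (c + time_factor p1 M) + c
  end%N.

Lemma time_le b M p s : (M <= 2 ^ b)%N -> bounded_memory b s -> safe b M p s ->
  (time p s <= time_factor p M * b.+1)%N.
Proof.
move=> Mb; elim: p s => [a e1 e2|p1 IH1 p2 IH2|e p1 IH|v e p1 IH] s sb.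
- by move=> _; rewrite /= mulnDl leq_add// cost_le.
- move=> [s1 s2]; rewrite /= mulnDl leq_add ?IH1//.
  by apply: IH2 => //; exact: bounded_run s1.
- move=> s1; rewrite /= mulnDl.
  apply: leq_add; first exact: cost_le.
  case: ifP => h; last by rewrite mulSn ltn_addr.
  by apply: leq_trans (IH _ sb (s1 h)) _; rewrite leq_mul2r leqnSn orbT.
- move=> [NM sf].
  have stb k : (k <= loop_count s e)%N -> bounded_memory b (loop_state v p1 s k).
    elim: k => [|k IHk] kN; first by apply: bounded_update; rewrite // /bounded.
    apply: bounded_update; last by rewrite /bounded (leq_trans _ Mb)// (leq_trans kN).
    by apply: bounded_run; [exact: Mb|exact: IHk (ltnW kN)|exact: sf].
  set c := (cost_factor (Bin Defs.Sub e (var v)) + cost_factor (Const 0) +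
        cost_factor (Bin Defs.Add (var v) (Const 1)))%N.
  have -> : time_factor (PFor v e p1) M = (cost_factor (Const 0) +
      cost_factor (Const 0) + M * (c + time_factor p1 M) + c)%N by [].
  have -> : time (PFor v e p1) s = (cost s (Const 0) + cost s (Const 0) +
      (\sum_(k < loop_count s e)
         (cost (loop_state v p1 s k) (Bin Defs.Sub e (var v)) +
          (time p1 (loop_state v p1 s k) +
           (cost (run p1 (loop_state v p1 s k)) (Const 0) +
            cost (run p1 (loop_state v p1 s k)) (Bin Defs.Add (var v) (Const 1))))) +
       cost (loop_state v p1 s (loop_count s e)) (Bin Defs.Sub e (var v))))%N by [].
  rewrite -[in leqRHS]addnA [in leqRHS]mulnDl; apply: leq_add.
    by rewrite mulnDl; apply: leq_add; exact: cost_le.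
  rewrite mulnDl; apply: leq_add; last first.
    apply: leq_trans (cost_le _ (stb _ (leqnn _))) _.
    by rewrite leq_mul2r /c -addnA leq_addr orbT.
  apply: (@leq_trans (\sum_(k < loop_count s e) (c + time_factor p1 M) * b.+1)); last first.
    by rewrite sum_nat_const card_ord -mulnA leq_mul2r NM orbT.
  apply: leq_sum => k _; have kb := stb k (ltnW (ltn_ord k)).
  have sk := sf k (ltn_ord k).
  have rk : bounded_memory b (run p1 (loop_state v p1 s k)) by exact: bounded_run sk.
  have t1 := cost_le (Bin Defs.Sub e (var v)) kb.
  have t2 := cost_le (Const 0) rk.
  have t3 := cost_le (Bin Defs.Add (var v) (Const 1)) rk.
  have t4 := IH _ kb sk.
  have key (a1 a2 a3 a4 c1 c2 c3 c4 B : nat) : (a1 <= c1 * B -> a2 <= c2 * B ->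
      a3 <= c3 * B -> a4 <= c4 * B -> a1 + (a4 + (a2 + a3)) <= (c1 + c2 + c3 + c4) * B)%N.
    by move=> h1 h2 h3 h4; rewrite !mulnDl; lia.
  exact: key.
Qed.

Fixpoint loop_depth (p : prog) : nat :=
  match p with
  | PWrite _ _ _ => 0
  | PSeq p1 p2 => maxn (loop_depth p1) (loop_depth p2)
  | PIf _ p1 => loop_depth p1
  | PFor _ _ p1 => (loop_depth p1).+1
  end.

Lemma time_factor_le p M : (0 < M)%N ->
  (time_factor p M <= time_factor p 1 * M ^ loop_depth p)%N.
Proof.
move=> M0; have M1 d : (0 < M ^ d)%N by rewrite expn_gt0 M0.
elim: p => [a e1 e2|p1 IH1 p2 IH2|e p1 IH|v e p1 IH].
- by rewrite expn0 muln1.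
- rewrite /= mulnDl; apply: leq_add.
    by apply: leq_trans IH1 _; rewrite leq_mul2l leq_pexp2l ?leq_maxl ?orbT.
  by apply: leq_trans IH2 _; rewrite leq_mul2l leq_pexp2l ?leq_maxr ?orbT.
- have key (a t t' X : nat) : (t <= t' * X -> 0 < X -> a + t.+1 <= (a + t'.+1) * X)%N.
    by nia.
  exact: key.
- have key (a c t t' X : nat) : (t <= t' * X -> 0 < X ->
      a + M * (c + t) + c <= (a + 1 * (c + t') + c) * (M * X))%N.
    move=> h X0; have MX : (0 < M * X)%N by rewrite muln_gt0 M0.
    rewrite mul1n !mulnDl; apply: leq_add; last exact: leq_pmulr.
    apply: leq_add; first exact: leq_pmulr.
    rewrite mulnDr; apply: leq_add; last by rewrite mulnCA leq_mul2l h orbT.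
    by rewrite mulnC leq_mul2l leq_pmulr ?orbT.
  by rewrite -[loop_depth _]/(loop_depth p1).+1 expnS; apply: key.
Qed.

(** * Rules for loops *)

Lemma run_write a e1 e2 s :
  run (PWrite a e1 e2) s = update s a (Defs.eval s e1) (Defs.eval s e2).
Proof. by []. Qed.

Lemma run_seq p q s : run (PSeq p q) s = run q (run p s).
Proof. by []. Qed.

Lemma run_if e p s : run (PIf e p) s = if 0 < Defs.eval s e then run p s else s.
Proof. by []. Qed.

Lemma safe_seq b M p q s :
  safe b M p s -> safe b M q (run p s) -> safe b M (PSeq p q) s.
Proof. by []. Qed.

(** A Hoare rule that proves safety and an invariant together; arrays that the body does not write
    may be assumed unchanged since the start of the loop. *)
Lemma for_rule b M v e p s (N : nat) (I : nat -> memory -> Prop) :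
  v \notin writes p -> Defs.eval s e = N%:Z -> (N <= M)%N ->
  I 0%N (update s v 0 0) ->
  (forall k s', (k < N)%N -> s' v 0 = k%:Z ->
     (forall a, a \notin v :: writes p -> s' a = s a) -> I k s' ->
     safe b M p s' /\ I k.+1 (update (run p s') v 0 k.+1%:Z)) ->
  safe b M (PFor v e p) s /\ I N (run (PFor v e p) s).
Proof.
move=> vp eN NM I0 IS.
have NE : loop_count s e = N.
  by rewrite /loop_count eN; move: (leq0n N); rewrite -lez_nat => /max_idPr ->.
have H k : (k <= N)%N -> I k (loop_state v p s k).
  elim: k => [//|k IH] kN; have kI := IH (ltnW kN).
  have [] := IS k (loop_state v p s k) kN _ _ kI => //.
    exact: loop_state_counter.
  by move=> a; exact: loop_state_frame.
split; last first.
  by rewrite /= NE -[iteri _ _ _]/(loop_state v p s N); exact: H.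
split; first by rewrite NE.
rewrite NE => k kN; have [] := IS k (loop_state v p s k) kN _ _ (H k (ltnW kN)) => //.
  exact: loop_state_counter.
by move=> a; exact: loop_state_frame.
Qed.

Lemma bounded_sum q d k (f : nat -> int) :
  (k <= 2 ^ d)%N -> (forall r, (r < k)%N -> bounded q (f r)) ->
  bounded (d + q) (\sum_(r < k) f r).
Proof.
move=> kd fq; rewrite /bounded expnD.
apply: (@leq_trans (k * 2 ^ q)); last by rewrite leq_mul2r kd orbT.
elim: k fq {kd} => [|k IH] fq; first by rewrite big_ord0.
rewrite big_ord_recr/= mulSn addnC; apply: leq_trans (absz_addr _ _) _.
by apply: leq_add; [apply: IH => r rk; apply: fq; exact: leqW|exact: fq].
Qed.

Definition psum v t bound e : prog :=
  PSeq (PWrite t (Const 0) (Const 0))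
    (PFor v bound (PWrite t (Const 0) (Bin Defs.Add (var t) e))).

Lemma psum_spec b M v t bound e s (N q d : nat) (f : nat -> int) :
  v != t -> t \notin reads bound -> Defs.eval s bound = N%:Z -> (N <= M)%N ->
  (forall k s', (k < N)%N -> s' v 0 = k%:Z ->
     (forall a, a \notin [:: v; t] -> s' a = s a) -> Defs.eval s' e = f k) ->
  (forall k, (k < N)%N -> bounded q (f k)) -> (N <= 2 ^ d)%N -> (d + q <= b)%N ->
  safe b M (psum v t bound e) s /\
  run (psum v t bound e) s t 0 = \sum_(k < N) f k.
Proof.
move=> vt tb eN NM ef fq Nd dq; set s1 := update s t 0 0.
have [||||s2 r2] := @for_rule b M v bound
    (PWrite t (Const 0) (Bin Defs.Add (var t) e)) s1 N
    (fun k s' => s' t 0 = \sum_(r < k) f r) _ _ NM.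
- by rewrite inE.
- rewrite -eN; apply: eval_ext => a ar; rewrite /s1 update_array//.
  by apply: contraNneq tb => <-.
- by rewrite big_ord0 update_array 1?eq_sym// /s1 updateE.
- move=> k s' kN vk fr tk.
  have ek : Defs.eval s' e = f k.
    apply: ef => // a; rewrite !inE negb_or => /andP[av at_].
    by rewrite fr ?inE ?negb_or ?av// /s1 update_array.
  have val : Defs.eval s' (Bin Defs.Add (var t) e) = \sum_(r < k.+1) f r.
    by rewrite /= tk ek big_ord_recr.
  split; last by rewrite update_array 1?eq_sym// run_write updateE val.
  change (bounded b (Defs.eval s' (Bin Defs.Add (var t) e))); rewrite val.
  apply: bounded_mono dq _; apply: bounded_sum => [|r rk].
    exact: leq_trans kN Nd.
  by apply: fq; exact: leq_trans rk kN.
by split.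
Qed.

(** The assigned expression may read the very entry about to be overwritten, which by injectivity of
    [ix] still has its initial value. This permits updating the matrix, the weights and the vector
    in place. *)
Lemma pmap_spec b M v a bound idx e s (N : nat) (ix f : nat -> int) :
  v != a -> a \notin reads bound -> Defs.eval s bound = N%:Z -> (N <= M)%N ->
  (forall k r, (k < N)%N -> (r < N)%N -> ix k = ix r -> k = r) ->
  (forall k s', (k < N)%N -> s' v 0 = k%:Z ->
     (forall c, c \notin [:: v; a] -> s' c = s c) ->
     s' a (ix k) = s a (ix k) ->
     Defs.eval s' idx = ix k /\ Defs.eval s' e = f k) ->
  (forall k, (k < N)%N -> bounded b (f k)) ->
  let s' := run (PFor v bound (PWrite a idx e)) s in
  safe b M (PFor v bound (PWrite a idx e)) s /\
  (forall k, (k < N)%N -> s' a (ix k) = f k) /\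
  (forall z, (forall k, (k < N)%N -> z <> ix k) -> s' a z = s a z).
Proof.
move=> va ab eN NM inj ef fb.
have [|||s2 [r1 r2]] := @for_rule b M v bound (PWrite a idx e) s N
    (fun k s' => (forall r, (r < k)%N -> s' a (ix r) = f r) /\
       (forall z, (forall r, (r < k)%N -> z <> ix r) -> s' a z = s a z)) _ eN NM.
- by rewrite inE.
- by split => // z _; rewrite update_array 1?eq_sym.
- move=> k s' kN vk fr [h1 h2].
  have [||ei ee] := ef k s' kN vk.
  + by move=> c; rewrite !inE => h; apply: fr; rewrite !inE.
  + by apply: h2 => r rk /(inj _ _ kN (ltn_trans rk kN)) E; rewrite E ltnn in rk.
  split; first by rewrite /= ee fb.
  rewrite update_array 1?eq_sym// run_write ei ee; split.
    move=> r; rewrite ltnS leq_eqVlt => /orP[/eqP ->|rk]; first exact: updateE.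
    rewrite /update eqxx andTb; case: eqP => [/(inj _ _ (ltn_trans rk kN) kN) E|_].
      by rewrite E ltnn in rk.
    exact: h1.
  move=> z hz; rewrite /update eqxx andTb; case: eqP => [/(hz k (ltnSn k))//|_].
  by apply: h2 => r rk; apply: hz; exact: leqW.
by split.
Qed.

(* For each v, the sum of e1 over k is accumulated in t, and a[v] := e2. *)
Definition pmapsum v bound k t bound1 e1 a e2 : prog :=
  PFor v bound (PSeq (psum k t bound1 e1) (PWrite a (var v) e2)).

Lemma pmapsum_spec b M v bound k t bound1 e1 a e2 s (N N1 q d : nat)
    (f : nat -> nat -> int) (g : nat -> int) :
  uniq [:: v; k; t; a] -> all (fun c => c \notin [:: v; k; t; a]) (reads bound) ->
  all (fun c => c \notin [:: v; k; t; a]) (reads bound1) ->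
  Defs.eval s bound = N%:Z -> (N <= M)%N ->
  Defs.eval s bound1 = N1%:Z -> (N1 <= M)%N -> (N1 <= 2 ^ d)%N -> (d + q <= b)%N ->
  (forall r c s', (r < N)%N -> (c < N1)%N -> s' v 0 = r%:Z -> s' k 0 = c%:Z ->
     (forall h, h \notin [:: v; k; t; a] -> s' h = s h) -> Defs.eval s' e1 = f r c) ->
  (forall r c, (r < N)%N -> (c < N1)%N -> bounded q (f r c)) ->
  (forall r s', (r < N)%N -> s' v 0 = r%:Z -> s' t 0 = \sum_(c < N1) f r c ->
     (forall h, h \notin [:: v; k; t; a] -> s' h = s h) -> Defs.eval s' e2 = g r) ->
  (forall r, (r < N)%N -> bounded b (g r)) ->
  safe b M (pmapsum v bound k t bound1 e1 a e2) s /\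
  (forall r : nat, (r < N)%N -> run (pmapsum v bound k t bound1 e1 a e2) s a r%:Z = g r).
Proof.
move=> un rb rb1 eN NM eN1 N1M N1d dq ef fq eg gb.
have /and4P[] := un; rewrite !inE !negb_or => /and3P[vk vt va] /andP[kt ka] ta _.
have [|||s2 r2] := @for_rule b M v bound
    (PSeq (psum k t bound1 e1) (PWrite a (var v) e2)) s N
    (fun r s' => forall r', (r' < r)%N -> s' a r'%:Z = g r') _ eN NM.
- by rewrite /= !inE !negb_or vt vk va.
- by [].
- move=> r s' rN vr fr Ir.
  have fr' h : h \notin [:: v; k; t; a] -> s' h = s h.
    move=> hh; apply: fr; move: hh; rewrite /= !inE !negb_or => /and4P[a1 a2 a3 a4].
    by rewrite a1 a2 a3 a4.
  have [||||sp rp] := @psum_spec b M k t bound1 e1 s' N1 q d (f r) kt _ _ N1M _ _ N1d dq.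
  + apply/negP => tr; move/allP: rb1 => /(_ _ tr); by rewrite !inE eqxx !orbT.
  + by rewrite -eN1; apply: eval_ext => c /(allP rb1) h; rewrite fr'.
  + move=> c s3 cN kc fr3; apply: ef => //.
      by rewrite fr3// !inE negb_or vk.
    move=> h hh; rewrite fr3; first exact: fr'.
    by move: hh; rewrite !inE !negb_or => /and4P[_ -> -> _].
  + by move=> c cN; exact: fq.
  set s1 := run (psum k t bound1 e1) s' in rp.
  have fr1 h : h \notin [:: k; t] -> s1 h = s' h.
    move=> hh; apply: run_frame; move: hh; rewrite /= !inE !negb_or => /andP[a1 a2].
    by rewrite a1 a2.
  have v1 : s1 v 0 = r%:Z by rewrite fr1// !inE negb_or vk.
  have e1E : Defs.eval s1 e2 = g r.
    apply: eg => // h hh; rewrite fr1; first exact: fr'.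
    by move: hh; rewrite !inE !negb_or => /and4P[_ -> -> _].
  split; first by split => //=; rewrite -/s1 e1E gb.
  have -> : run (PSeq (psum k t bound1 e1) (PWrite a (var v) e2)) s' =
      update s1 a r%:Z (g r) by rewrite -e1E -v1.
  rewrite update_array 1?eq_sym// => r'; rewrite ltnS leq_eqVlt => /orP[/eqP ->|rr].
    exact: updateE.
  rewrite /update eqxx andTb; case: eqP => [[E]|_]; first by rewrite E ltnn in rr.
  by rewrite fr1 ?Ir// !inE negb_or eq_sym ka eq_sym ta.
by split.
Qed.

(** * Bit lengths in the integer projection *)

Section Sizes.
Variable R : realType.

Lemma gram_rep_entry n (S : 'M[int]_n * int) k l : gram_rep S -> `|S.1 k l| <= S.2.
Proof.
move=> Sg; have [Pt PP] := gram_rep_proj (F := R) Sg.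
have d0 : 0 < S.2 by case: Sg => ? [? []].
have dR : 0 < S.2%:~R :> R by rewrite ltr0z.
have := proj_entry_le1 Pt PP k l.
rewrite /rproj !mxE normrM normfV (gtr0_norm dR) mulrC ler_pdivrMr// mul1r.
by rewrite -intr_norm ler_int.
Qed.

(** One step of Hadamard's inequality: the Gram determinant is multiplied by [|P v|^2 <= |v|^2]. *)
Lemma proj_step_det n (S : 'M[int]_n * int) v (B : int) :
  gram_rep S -> idot v v <= B -> 1 <= B -> (proj_step S v).2 <= S.2 * B.
Proof.
move=> Sg vB B1; have [Pt PP] := gram_rep_proj (F := R) Sg.
have d0 : 0 < S.2 by case: Sg => ? [? []].
have dR : 0 < S.2%:~R :> R by rewrite ltr0z.
have [_ _ e0S egt0S] := proj_step_spec (F := R) v Sg.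
move: e0S egt0S; set P := rproj S in Pt PP *; set w : 'cV[R]_n := _^T.
set e := (w^T *m P *m w) 0 0 => e0S egt0S.
have eE : e = dot (P *m w)^T (P *m w)^T by exact: quad_proj_ge0.
have [e0|ne0] := eqVneq e 0.
  by rewrite e0S// ler_peMr// ltW.
have egt0 : 0 < e by rewrite lt_def ne0 eE dot_ge0.
have [_ dE] := egt0S egt0.
rewrite -(@ler_int R) dE intrM ler_pM2l//; apply: (@le_trans _ _ (idot v v)%:~R).
  rewrite -dot_intr -[cst_mx v]trmxK -/w; apply: le_trans (proj_norm_le Pt PP w^T).
  rewrite eE le_eqVlt; apply/orP; left; apply/eqP; apply: eq_bigr => k _.
  by rewrite trmx_mul Pt expr2.
by rewrite ler_int.
Qed.

End Sizes.

Lemma divz_norm_le (a d D : int) : 0 < d -> 0 <= D -> `|a| <= D * d -> `|(a %/ d)%Z| <= D.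
Proof.
move=> d0 D0; rewrite !ler_norml => /andP[h1 h2]; apply/andP; split.
  by rewrite lez_divRL// mulNr.
rewrite -ltzD1 ltz_divLR//; apply: le_lt_trans h2 _.
by rewrite mulrDl mul1r ltrDl.
Qed.

Lemma column_size n D (S : 'M[int]_n * int) l k : 0 < S.2 ->
  (forall k l, `|S.1 k l| <= S.2) -> `|column D S l 0 k| <= D%:Z.
Proof.
move=> d0 NS; rewrite /column; case: insubP => [l' _ _|_]/=; last by rewrite mxE.
rewrite mxE; apply: divz_norm_le => //.
by rewrite normrM ler_wpM2l.
Qed.

(** * The program *)

Local Notation "a [+] b" := (Bin Defs.Add a b) (at level 50, left associativity).
Local Notation "a [-] b" := (Bin Defs.Sub a b) (at level 50, left associativity).
Local Notation "a [*] b" := (Bin Defs.Mul a b) (at level 40, left associativity).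
Local Notation "a [/] b" := (Bin Defs.Div a b) (at level 40, left associativity).

(* Arrays: 0 input, 1 output vectors, 2 g, 3 D, 4 K, 5-7 computation of K,
   8 i, 9 j, 10 weights, 11 gain coefficients, 12 round, 13 squared norm,
   14 and 15 numerator and denominator of the projection, 16 and 17 coordinate
   indices, 18 dot product, 19 and 20 projected frozen vector and its squared
   norm, 21 column, 22 gains, 23 total gain, 24 sign, 25 column index. *)
Definition dim : expr := Read 0 (Const 1).

Definition coord (i k : expr) : expr := Read 1 (i [*] dim [+] k).

Definition proj_prog : prog :=
  PSeq (pmapsum 16 dim 17 18 dim
          (Read 14 (var 16 [*] dim [+] var 17) [*] coord (var 9) (var 17)) 19 (var 18))
  (PSeq (psum 16 20 dim (Read 19 (var 16) [*] coord (var 9) (var 16)))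
  (PIf (var 20)
    (PSeq
      (PFor 16 (dim [*] dim) (PWrite 14 (var 16)
        ((var 20 [*] Read 14 (var 16) [-]
          Read 19 (var 16 [/] dim) [*] Read 19 (var 16 [-] var 16 [/] dim [*] dim))
         [/] var 15)))
      (PWrite 15 (Const 0) (var 20))))).

Definition frozen_prog : prog :=
  PSeq (PFor 16 (dim [*] dim) (PWrite 14 (var 16) (Const 0)))
  (PSeq (PFor 16 dim (PWrite 14 (var 16 [*] dim [+] var 16) (Const 1)))
  (PSeq (PWrite 15 (Const 0) (Const 1))
  (PFor 9 (var 8)
    (PSeq (psum 16 18 dim (coord (var 9) (var 16) [*] coord (var 8) (var 16)))
    (PIf (var 2 [*] var 18 [-]
          (var 4 [*] var 4 [*] dim [+] Const 4 [*] (var 2 [*] var 2)) [*]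
          (var 3 [*] var 3))
      proj_prog))))).

Definition substep_prog : prog :=
  PSeq (PFor 16 dim (PWrite 21 (var 16)
         (var 3 [*] Read 14 (var 16 [*] dim [+] var 25) [/] var 15)))
  (PSeq (pmapsum 9 (var 8 [+] Const 1) 16 18 dim
          (coord (var 9) (var 16) [*] Read 21 (var 16)) 22 (Read 11 (var 9) [*] var 18))
  (PSeq (psum 9 23 (var 8 [+] Const 1) (Read 10 (var 9) [*] Read 22 (var 9)))
  (PSeq (PWrite 24 (Const 0) (Const 1))
  (PSeq (PIf (var 23) (PWrite 24 (Const 0) (Const (-1))))
  (PSeq (PFor 9 (var 8 [+] Const 1) (PWrite 10 (var 9)
          (Read 10 (var 9) [*] (var 2 [*] var 2 [*] (var 3 [*] var 3) [+]
             var 24 [*] Read 22 (var 9)))))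
  (PFor 16 dim (PWrite 1 (var 8 [*] dim [+] var 16)
     (coord (var 8) (var 16) [+] var 24 [*] Read 21 (var 16))))))))).

Definition norm_prog : prog :=
  psum 16 13 dim (coord (var 8) (var 16) [*] coord (var 8) (var 16)).

Definition round_prog : prog :=
  PSeq norm_prog
  (PIf (dim [*] var 4 [*] (var 3 [*] var 3) [-] var 13)
    (PSeq frozen_prog (PFor 25 dim substep_prog))).

(** The walk runs in place in row [i] of array 1, which is still 0 from the input memory, so the
    starting point needs no code. *)
Definition vector_prog : prog :=
  PSeq (PFor 9 (var 8 [+] Const 1) (PWrite 10 (var 9) (Const 1)))
  (PSeq (PWrite 10 (var 8) (var 0))
  (PSeq (PFor 9 (var 8 [+] Const 1) (PWrite 11 (var 9) (var 2)))
  (PSeq (PWrite 11 (var 8) (Const 0 [-] var 4))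
  (PSeq (PFor 12 (var 4) round_prog)
  (PSeq norm_prog
  (PIf (Const 1 [-] var 13) (PWrite 1 (var 8 [*] dim) (Const 1)))))))).

Definition count_prog : prog :=
  PFor 7 (var 2)
    (PIf (var 6 [-] var 5)
      (PSeq (PWrite 5 (Const 0) (var 5 [*] (Const 2 [*] (var 2 [*] var 2) [+]
              (Const 2 [*] var 4 [+] Const 1) [*] dim)))
      (PSeq (PWrite 6 (Const 0) (var 6 [*] (Const 2 [*] (var 2 [*] var 2))))
            (PWrite 4 (Const 0) (var 4 [+] Const 1))))).

Definition main_prog : prog :=
  PSeq (PWrite 2 (Const 0) (var 0 [*] var 0 [*] (var 0 [*] var 0)))
  (PSeq (PWrite 3 (Const 0) (var 2 [*] (var 0 [*] var 0)))
  (PSeq (PWrite 4 (Const 0) (Const 0))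
  (PSeq (PWrite 5 (Const 0) dim)
  (PSeq (PWrite 6 (Const 0) (var 0))
  (PSeq count_prog (PFor 8 (var 0) vector_prog)))))).

Lemma wf_main : wf main_prog. Proof. by []. Qed.

(** * Correctness of the program *)

Section Coordinates.
Variable n : nat.

Definition co (x : 'rV[int]_n) (k : nat) : int := oapp (x 0) 0 (insub k).

Definition cm (N : 'M[int]_n) (k l : nat) : int := oapp (fun k' => co (row k' N) l) 0 (insub k).

Lemma coE (x : 'rV[int]_n) (k : 'I_n) : co x k = x 0 k.
Proof. by rewrite /co valK. Qed.

Lemma cmE (N : 'M[int]_n) (k l : 'I_n) : cm N k l = N k l.
Proof. by rewrite /cm valK/= coE mxE. Qed.

Lemma idot_co (x y : 'rV[int]_n) : \sum_(k < n) co x k * co y k = idot x y.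
Proof. by apply: eq_bigr => k _; rewrite !coE. Qed.

Definition rowv (s : memory) (a off : nat) (x : 'rV[int]_n) : Prop :=
  forall k, (k < n)%N -> s a (off + k)%N%:Z = co x k.

Definition matv (s : memory) (N : 'M[int]_n) : Prop :=
  forall k l, (k < n)%N -> (l < n)%N -> s 14 (k * n + l)%N%:Z = cm N k l.


End Coordinates.

Lemma modn_divz (k n : nat) : k%:Z - (k%:Z %/ n%:Z)%Z * n%:Z = (k %% n)%N%:Z.
Proof. by rewrite divz_nat; have := divn_eq k n; lia. Qed.

Lemma matv_flat n s (N : 'M[int]_n) : (0 < n)%N ->
  (forall r, (r < n * n)%N -> s 14 r%:Z = cm N (r %/ n) (r %% n)) <-> matv s N.
Proof.
move=> n0; split => [h k l kn ln|h r rn].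
  rewrite h; first by rewrite divnMDl// divn_small// addn0 modnMDl modn_small.
  by apply: (@leq_trans (k.+1 * n)); [rewrite mulSn addnC ltn_add2r|rewrite leq_mul2r kn orbT].
by rewrite {1}(divn_eq r n) h// ?ltn_mod// ltn_divLR.
Qed.

Section Correctness.
Variable R : realType.
Variables (m n b M : nat).
Hypothesis n0 : (0 < n)%N.
Hypothesis n2m : (n <= 2 ^ m)%N.
Hypothesis nM : (n * n <= M)%N.

Let nM1 : (n <= M)%N. Proof. by apply: leq_trans nM; exact: leq_pmulr. Qed.

(** Bit count: entries of the matrix have [q] bits, those of [v] have [12 m], and a sum of [n] terms
    adds [m]. The projected vector has [q + 13 m] bits and its inner product with [v] has
    [q + 26 m]. *)
Lemma proj_prog_spec s (S : 'M[int]_n * int) v j q :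
  s 0 1 = n%:Z -> s 9 0 = j%:Z -> rowv s 1 (j * n) v -> matv s S.1 ->
  s 15 0 = S.2 -> gram_rep S -> (forall k, bounded (12 * m) (v 0 k)) ->
  bounded q S.2 -> (q + 26 * m <= b)%N ->
  [/\ safe b M proj_prog s, matv (run proj_prog s) (proj_step S v).1 &
      run proj_prog s 15 0 = (proj_step S v).2].
Proof.
move=> sn sj sv sN sd Sg vb qb qb'.
have d0 : 0 < S.2 by case: Sg => ? [? []].
have Nb k l : (k < n)%N -> (l < n)%N -> bounded q (cm S.1 k l).
  move=> kn ln; rewrite -[k]/(val (Ordinal kn)) -[l]/(val (Ordinal ln)) cmE.
  apply: leq_trans qb; rewrite -lez_nat !abszE (gtr0_norm d0).
  exact: gram_rep_entry.
have cvb k : (k < n)%N -> bounded (12 * m) (co v k).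
  by move=> kn; rewrite -[k]/(val (Ordinal kn)) coE.
set u := proj_vec S.1 v.
have uE k : (k < n)%N -> \sum_(l < n) cm S.1 k l * co v l = co u k.
  move=> kn; rewrite -[k]/(val (Ordinal kn)) coE mxE.
  by apply: eq_bigr => l _; rewrite cmE coE.
have ub k : (k < n)%N -> bounded (m + (q + 12 * m)) (co u k).
  move=> kn; rewrite -uE//.
  apply: (bounded_sum (f := fun l => cm S.1 k l * co v l)) => // l ln.
  by apply: boundedM; [exact: Nb|exact: cvb].
have [|||||sf1 r1] := @pmapsum_spec b M 16 dim 17 18 dim
    (Read 14 (var 16 [*] dim [+] var 17) [*] coord (var 9) (var 17)) 19 (var 18)
    s n n (q + 12 * m) m (fun k l => cm S.1 k l * co v l) (co u)
    isT isT isT sn nM1 sn nM1 n2m _ _ _ _ _.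
- by apply: leq_trans qb'; lia.
- move=> k l s' kn ln k16 l17 fr /=.
  rewrite !k16 !l17 !(fr 0%N) // (fr 14%N) // (fr 1%N) // (fr 9%N) // sn sj.
  by rewrite -!PoszM -!PoszD sN // sv.
- by move=> k l kn ln; apply: boundedM; [exact: Nb|exact: cvb].
- by move=> k s' kn _ h _; rewrite /= h uE.
- by move=> k kn; apply: bounded_mono (ub k kn); lia.
set p1 := pmapsum _ _ _ _ _ _ _ _ in sf1 r1; set s1 := run p1 s in r1.
have f1 a : a \notin writes p1 -> s1 a = s a by exact: run_frame.
have [||||sf2 r2] := @psum_spec b M 16 20 dim
    (Read 19 (var 16) [*] coord (var 9) (var 16)) s1 n (q + 25 * m) m
    (fun k => co u k * co v k) isT isT _ nM1 _ _ n2m _.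
- by rewrite /= f1.
- move=> k s' kn k16 fr /=.
  rewrite !k16 (fr 19%N) // (fr 1%N) // (fr 9%N) // (fr 0%N) //.
  rewrite !(f1 1%N) // !(f1 9%N) // !(f1 0%N) // sn sj.
  by rewrite -PoszM -PoszD r1 // sv.
- move=> k kn; apply: (@bounded_mono (m + (q + 12 * m) + 12 * m)); first by lia.
  by apply: boundedM; [exact: ub|exact: cvb].
- by apply: leq_trans qb'; lia.
set p2 := psum _ _ _ _ in sf2 r2; set s2 := run p2 s1 in r2.
have f2 a : a \notin writes p2 -> s2 a = s1 a by exact: run_frame.
rewrite (idot_co u v) in r2; set e := idot u v in r2.
rewrite /proj_prog -/p1 -/p2.
set p3 := PSeq (PFor _ _ _) _.
have sE : run (PSeq p1 (PSeq p2 (PIf (var 20) p3))) s = if 0 < e then run p3 s2 else s2.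
  by rewrite !run_seq run_if -/s1 -/s2 -r2.
have sfE : (0 < e -> safe b M p3 s2) -> safe b M (PSeq p1 (PSeq p2 (PIf (var 20) p3))) s.
  by move=> h; apply: safe_seq => //; apply: safe_seq => //; rewrite -/s1 -/s2 -r2 in h *.
rewrite sE /proj_step -/u -/e; case: (boolP (0 < e)) => [e0|/negbTE e0]; last first.
  split; [by apply: sfE; rewrite e0|move=> k l kn ln|];
    by rewrite f2 // f1 //; exact: sN.
have S'g : gram_rep (proj_step S v) by case: (proj_step_spec (F := R) v Sg).
set N' := (\matrix_(_, _) _ : 'M[int]_n).
have SE : proj_step S v = (N', e) by rewrite /proj_step -/u -/e e0.
have Neb k l : (k < n)%N -> (l < n)%N -> bounded b (cm N' k l).
  move=> kn ln; rewrite -[k]/(val (Ordinal kn)) -[l]/(val (Ordinal ln)) cmE.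
  have eb : bounded (m + (q + 25 * m)) e.
    rewrite /e -idot_co.
    apply: (bounded_sum (f := fun k => co u k * co v k)) => // r rn.
    apply: (@bounded_mono (m + (q + 12 * m) + 12 * m)); first by lia.
    by apply: boundedM; [exact: ub|exact: cvb].
  apply: (@bounded_mono (m + (q + 25 * m))); first by lia.
  apply: leq_trans eb; rewrite -lez_nat !abszE (gtr0_norm e0).
  by have := gram_rep_entry R (Ordinal kn) (Ordinal ln) S'g; rewrite SE.
have s2n : s2 0%N 1 = n%:Z by rewrite f2 // f1.
have s2N : matv s2 S.1 by move=> k l kn ln; rewrite f2 // f1 // sN.
have s2d : s2 15 0 = S.2 by rewrite f2 // f1.
have s2u k : (k < n)%N -> s2 19 k%:Z = co u k by move=> kn; rewrite f2 // r1.
have s2nn : Defs.eval s2 (dim [*] dim) = (n * n)%N%:Z by rewrite /= s2n PoszM.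
have [|||sf3 [r3 _]] := @pmap_spec b M 16 14 (dim [*] dim) (var 16)
    ((var 20 [*] Read 14 (var 16) [-]
          Read 19 (var 16 [/] dim) [*] Read 19 (var 16 [-] var 16 [/] dim [*] dim))
         [/] var 15) s2 (n * n) (fun r => r%:Z)
    (fun r => cm N' (r %/ n) (r %% n)) isT isT s2nn nM.
- by move=> k r _ _ [].
- move=> r s' rn k16 fr r14; rewrite /= k16; split => //.
  have dn : (r %/ n < n)%N by rewrite ltn_divLR.
  have mn : (r %% n < n)%N by rewrite ltn_mod.
  rewrite r14 (fr 20%N) // (fr 19%N) // (fr 15%N) // (fr 0%N) // s2n r2 s2d.
  rewrite modn_divz divz_nat !s2u // {1}(divn_eq r n) s2N //.
  rewrite -[(r %/ n)%N]/(val (Ordinal dn)) -[(r %% n)%N]/(val (Ordinal mn)).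
  by rewrite !cmE !coE [RHS]mxE.
- by move=> r rn; apply: Neb; rewrite ?ltn_divLR ?ltn_mod.
rewrite /p3; set p4 := PFor _ _ _ in sf3 r3 *; set s3 := run p4 s2 in r3.
have f3 a : a \notin writes p4 -> s3 a = s2 a by exact: run_frame.
have s3e : Defs.eval s3 (var 20) = e by rewrite /= f3.
split.
- apply: sfE => _; apply: safe_seq => //.
  change (bounded b (Defs.eval s3 (var 20))); rewrite s3e.
  rewrite /e -idot_co; apply: (@bounded_mono (m + (q + 25 * m))); first by lia.
  apply: (bounded_sum (f := fun k => co u k * co v k)) => // r rn.
  apply: (@bounded_mono (m + (q + 12 * m) + 12 * m)); first by lia.
  by apply: boundedM; [exact: ub|exact: cvb].
- have r3' : matv s3 N' by apply/(matv_flat _ _ n0).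
  by rewrite run_seq run_write => k l kn ln; rewrite update_array //; exact: r3'.
- by rewrite run_seq run_write -/s3 s3e updateE.
Qed.
End Correctness.

Section Environment.
Variables (m n b M g D K : nat).

Lemma frame_sub p (L : seq nat) s a : all [in L] (writes p) -> a \notin L -> run p s a = s a.
Proof. by move=> /allP pL aL; apply: run_frame; apply: contra aL; exact: pL. Qed.

Definition env (i : nat) (s : memory) : Prop :=
  [/\ s 0 1 = n%:Z, s 2 0 = g%:Z, s 3 0 = D%:Z, s 4 0 = K%:Z & s 8 0 = i%:Z].

Lemma cobounded q (x : 'rV[int]_n) : (forall k, bounded q (x 0 k)) ->
  forall k, (k < n)%N -> bounded q (co x k).
Proof. by move=> xb k kn; rewrite -[k]/(val (Ordinal kn)) coE. Qed.

(* The memory represents st after q substeps, each adding at most D to the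
   coordinates of the vector and 24 m bits to the weights. *)
Definition state (i q : nat) (st : 'rV[int]_n * (nat -> int)) (s : memory) : Prop :=
  [/\ rowv s 1 (i * n) st.1, forall j, (j < i.+1)%N -> s 10 j%:Z = st.2 j,
      forall k, `|st.1 0 k| <= (q * D)%N%:Z &
      forall j, (j < i.+1)%N -> bounded (m + 24 * m * q) (st.2 j)].

Definition rows (V : nat -> 'rV[int]_n) (i : nat) (s : memory) : Prop :=
  forall j, (j < i)%N -> rowv s 1 (j * n) (V j) /\ forall k, bounded (12 * m) (V j 0 k).

Lemma rows_frame V i s s' : rows V i s ->
  (forall z, (forall k, (k < n)%N -> z <> (i * n + k)%N%:Z) -> s' 1 z = s 1 z) ->
  rows V i s'.
Proof.
move=> sV fr j ji; have [sj Vb] := sV j ji; split => // k kn.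
rewrite fr ?sj // => k' k'n [] E; have : (j.+1 * n <= i * n)%N by rewrite leq_mul2r ji orbT.
by rewrite mulSn; lia.
Qed.

Lemma state_ext i q st s s' : s' 1 = s 1 -> s' 10 = s 10 ->
  state i q st s -> state i q st s'.
Proof.
by move=> e1 e2 [h1 h2 h3 h4]; split => // [k kn|j ji]; rewrite ?e1 ?e2 ?h1 ?h2.
Qed.

Lemma state_mono i q q' st s : (q <= q')%N -> state i q st s -> state i q' st s.
Proof.
move=> qq [h1 h2 h3 h4]; split => // [k|j ji].
  by apply: le_trans (h3 k) _; rewrite lez_nat leq_mul2r qq orbT.
by apply: bounded_mono (h4 j ji); rewrite leq_add2l leq_mul2l qq orbT.
Qed.

Lemma idot_le0 (x : 'rV[int]_n) k : idot x x <= 0 -> x 0 k = 0.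
Proof.
rewrite /idot (bigD1 k) //= => h; apply/eqP; rewrite -sqrf_eq0 expr2.
rewrite eq_le -expr2 sqr_ge0 andbT expr2; apply: le_trans h; rewrite lerDl.
by apply: sumr_ge0 => j _; rewrite -expr2 sqr_ge0.
Qed.

Variable R : realType.
Hypothesis n0 : (0 < n)%N.
Hypothesis n2m : (n <= 2 ^ m)%N.
Hypothesis nM : (n * n <= M)%N.
Hypothesis mM : (m <= M)%N.
Hypothesis KM : (K <= M)%N.
Hypothesis Kb : (K <= 2 ^ (4 * m))%N.
Hypothesis gb : (g <= 2 ^ (4 * m))%N.
Hypothesis Db : (D <= 2 ^ (6 * m))%N.
Hypothesis KDb : (K * n * D <= 2 ^ (12 * m))%N.
Hypothesis bb : (40 * m * (K * n + m + g + 2) <= b)%N.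

Let nM1 : (n <= M)%N. Proof. by apply: leq_trans nM; exact: leq_pmulr. Qed.

Lemma idot_bounded p q (x y : 'rV[int]_n) : (forall k, bounded p (x 0 k)) ->
  (forall k, bounded q (y 0 k)) -> bounded (m + (p + q)) (idot x y).
Proof.
move=> xb yb; rewrite -idot_co.
apply: (bounded_sum (f := fun k => co x k * co y k)) => // k kn.
by apply: boundedM; exact: cobounded.
Qed.

Lemma matv_id s : (forall k, (k < n)%N -> s 14 (k * n + k)%N%:Z = 1) ->
  (forall z, (forall k, (k < n)%N -> z <> (k * n + k)%N%:Z) ->
     0 <= z < (n * n)%N%:Z -> s 14 z = 0) ->
  matv s (1%:M : 'M[int]_n).
Proof.
move=> h1 h2 k l kn ln.
rewrite -[in RHS](erefl : val (Ordinal kn) = k) -[in RHS](erefl : val (Ordinal ln) = l).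
rewrite cmE mxE -val_eqE /=; have [->|kl] := eqVneq k l; first exact: h1.
apply: h2.
  move=> r rn [] E.
  have e1 : ((k * n + l) %/ n = (r * n + r) %/ n)%N by rewrite E.
  have e2 : ((k * n + l) %% n = (r * n + r) %% n)%N by rewrite E.
  move: e1 e2; rewrite !divnMDl // !modnMDl !divn_small // !modn_small // !addn0.
  by move=> e1 e2; rewrite e1 e2 eqxx in kl.
rewrite lez_nat ltz_nat /=; apply: (@leq_trans (k.+1 * n)).
  by rewrite mulSn addnC ltn_add2r.
by rewrite leq_mul2r kn orbT.
Qed.

(** Every frozen vector has squared norm of at most [m + 24 m] bits, so by [proj_step_det] the
    determinant grows by [25 m] bits for each. *)
Lemma frozen_prog_spec s (V : nat -> 'rV[int]_n) (x : 'rV[int]_n) i :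
  env i s -> (i <= m)%N -> (forall j, (j < i)%N -> rowv s 1 (j * n) (V j)) ->
  rowv s 1 (i * n) x ->
  (forall j, (j < i)%N -> forall k, bounded (12 * m) (V j 0 k)) ->
  (forall k, bounded (12 * m) (x 0 k)) ->
  [/\ safe b M frozen_prog s,
      matv (run frozen_prog s) (frozen_proj K g D V i x).1 &
      run frozen_prog s 15 0 = (frozen_proj K g D V i x).2].
Proof.
move=> [sn sg sD sK si] im sV sx Vb xb.
have snn : Defs.eval s (dim [*] dim) = (n * n)%N%:Z by rewrite /= sn PoszM.
have [|||sf1 [r1 _]] := @pmap_spec b M 16 14 (dim [*] dim) (var 16) (Const 0) s
   (n * n) (fun r => r%:Z) (fun=> 0) isT isT snn nM.
- by move=> k r _ _ [].
- by move=> k s' _ k16 _ _; rewrite /= k16.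
- by [].
set p1 := PFor _ _ _ in sf1 r1; set s1 := run p1 s in r1.
have f1 a : a \notin writes p1 -> s1 a = s a by exact: run_frame.
have s1n : Defs.eval s1 dim = n%:Z by rewrite /= f1.
have [|||sf2 [r2 r2']] := @pmap_spec b M 16 14 dim (var 16 [*] dim [+] var 16) (Const 1) s1
   n (fun r => (r * n + r)%N%:Z) (fun=> 1) isT isT s1n nM1.
- move=> k r kn rn [] E.
  have e1 : ((k * n + k) %/ n = (r * n + r) %/ n)%N by rewrite E.
  by move: e1; rewrite !divnMDl // !divn_small // !addn0.
- by move=> k s' _ k16 fr _; rewrite /= k16 fr // f1 // sn PoszD PoszM.
- by move=> k _; rewrite /bounded expn_gt0.
set p2 := PFor _ _ _ in sf2 r2 r2'; set s2 := run p2 s1 in r2 r2'.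
have f2 a : a \notin writes p2 -> s2 a = s1 a by exact: run_frame.
rewrite /frozen_prog -/p1 -/p2; set p3 := PWrite 15 _ _; set s3 := run p3 s2.
have f3 a : a \notin writes p3 -> s3 a = s2 a by exact: run_frame.
have s3E a : a \notin [:: 9; 14; 15; 16; 17; 18; 19; 20]%N -> s3 a = s a.
  by move=> ha; rewrite /s3 /s2 /s1 !(frame_sub (L := [:: 9; 14; 15; 16; 17; 18; 19; 20]%N)).
set p4 := PSeq (psum _ _ _ _) _.
have s3i : Defs.eval s3 (var 8) = i%:Z by rewrite /= s3E.
have p3sf : safe b M p3 s2 by rewrite /= /bounded expn_gt0.
have [||sf4 r4] := @for_rule b M 9 (var 8) p4 s3 i
    (fun j s' => matv s' (frozen_proj K g D V j x).1 /\
                 s' 15 0 = (frozen_proj K g D V j x).2 /\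
                 bounded (25 * m * j) (frozen_proj K g D V j x).2) isT s3i (leq_trans im mM).
- split; last by split; [rewrite update_array // /s3 run_write updateE|rewrite /bounded muln0].
  have -> : (frozen_proj K g D V 0 x).1 = 1%:M by [].
  apply: matv_id => [k kn|z hz zn]; rewrite update_array // f3 //; first exact: r2.
  rewrite r2' //; case: z hz zn => // z hz; rewrite lez_nat ltz_nat /= => zn.
  exact: r1.
- move=> j s' ji j9 fr [Nj [dj bj]].
  have fr' a : a \notin [:: 9; 14; 15; 16; 17; 18; 19; 20]%N -> s' a = s a.
    move=> ha; rewrite fr ?s3E //; move: ha.
    by rewrite !inE !negb_or => /and5P[-> -> -> -> /and4P[-> -> -> ->]].
  set S := frozen_proj K g D V j x in Nj dj bj.
  have s'n : Defs.eval s' dim = n%:Z by rewrite /= fr'.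
  have [|||sf5 r5] := @psum_spec b M 16 18 dim
     (coord (var 9) (var 16) [*] coord (var 8) (var 16)) s' n (24 * m) m
     (fun k => co (V j) k * co x k) isT isT s'n nM1 _ _ n2m.
  + move=> k s4 kn k16 fr4; rewrite /= k16 !(fr4 1%N) // !(fr4 9%N) // !(fr4 8%N) // !(fr4 0%N) //.
    rewrite j9 !(fr' 1%N) // !(fr' 8%N) // !(fr' 0%N) // sn si.
    by rewrite -!PoszM -!PoszD sV // sx.
  + move=> k kn; apply: (@bounded_mono (12 * m + 12 * m)); first by lia.
    by apply: boundedM; [exact: cobounded (Vb j ji) _ kn|exact: cobounded].
  + by apply: leq_trans bb; nia.
  rewrite idot_co in r5; rewrite /p4; set p5 := psum _ _ _ _ in sf5 r5 *.
  set s5 := run p5 s' in r5.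
  have f5 a : a \notin writes p5 -> s5 a = s' a by exact: run_frame.
  set e := _ [-] _.
  have eE : Defs.eval s5 e = g%:Z * idot (V j) x -
      (K%:Z * K%:Z * n%:Z + 4 * (g%:Z * g%:Z)) * (D%:Z * D%:Z).
    by rewrite /= !(f5 2%N) // !(f5 3%N) // !(f5 4%N) // !(f5 0%N) // !fr' // r5 sn sg sD sK.
  have S1 : frozen_proj K g D V j.+1 x =
    if frozen K g D (V j) x then proj_step S (V j) else S by [].
  have [|||||||||sf6 r6 r6'] := @proj_prog_spec R m n b M n0 n2m nM s5 S (V j) j (25 * m * j).
  + by rewrite f5 // fr'.
  + by rewrite f5.
  + by move=> k kn; rewrite f5 // fr' // sV.
  + by move=> k l kn ln; rewrite f5 // Nj.
  + by rewrite f5.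
  + by case: (frozen_projP (R := R) K g D V j x).
  + exact: Vb.
  + exact: bj.
  + by apply: leq_trans bb; nia.
  split.
    apply: safe_seq => //; change (0 < Defs.eval s5 e -> safe b M proj_prog s5) => _; exact: sf6.
  rewrite run_seq run_if -/s5 eE -/(frozen K g D (V j) x) S1.
  case: ifP => _; last first.
    split; first by move=> k l kn ln; rewrite update_array // f5 // Nj.
    split; first by rewrite update_array // f5.
    by apply: bounded_mono bj; nia.
  split; first by move=> k l kn ln; rewrite update_array // r6.
  split; first by rewrite update_array.
  have Sg : gram_rep S by case: (frozen_projP (R := R) K g D V j x).
  have S'g : gram_rep (proj_step S (V j)) by case: (proj_step_spec (F := R) (V j) Sg).
  have d0 : 0 < S.2 by case: Sg => ? [? []].
  have d'0 : 0 < (proj_step S (V j)).2 by case: S'g => ? [? []].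
  rewrite mulnS /bounded -lez_nat abszE (gtr0_norm d'0) addnC expnD PoszM.
  apply: le_trans (proj_step_det R Sg (B := (2 ^ (25 * m))%N) _ _) _.
  + have := idot_bounded (Vb j ji) (Vb j ji); rewrite /bounded -lez_nat abszE.
    have -> : (m + (12 * m + 12 * m) = 25 * m)%N by lia.
    by apply: le_trans; exact: ler_norm.
  + by rewrite lez_nat expn_gt0.
  by apply: ler_wpM2r => //; move: bj; rewrite /bounded -lez_nat abszE (gtr0_norm d0).
have [sf4N [r4d _]] := r4.
by split.
Qed.

Lemma state_bounded i q st s : (q <= K * n)%N -> state i q st s ->
  forall k, bounded (12 * m) (st.1 0 k).
Proof.
move=> qK [_ _ h _] k; rewrite /bounded; apply: leq_trans KDb.
by rewrite -lez_nat abszE; apply: le_trans (h k) _; rewrite lez_nat leq_mul2r qK orbT.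
Qed.

Lemma substep_prog_spec s (V : nat -> 'rV[int]_n) i (S : 'M[int]_n * int) l q st :
  env i s -> (i < m)%N -> rows V i s ->
  (forall j, (j < i)%N -> s 11 j%:Z = g%:Z) -> s 11 i%:Z = - K%:Z ->
  matv s S.1 -> s 15 0 = S.2 -> 0 < S.2 -> (forall k l, `|S.1 k l| <= S.2) ->
  s 25 0 = l%:Z -> (l < n)%N -> (q < K * n)%N -> state i q st s ->
  [/\ safe b M substep_prog s,
      state i q.+1 (substep K g D V i S l st) (run substep_prog s) &
      forall z, (forall k, (k < n)%N -> z <> (i * n + k)%N%:Z) ->
        run substep_prog s 1 z = s 1 z].
Proof.
move=> [sn sg sD sK si] im sV sC sCi sN sd d0 NS sl ln qK st0.
have xb := state_bounded (ltnW qK) st0.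
have [sx sW xD Wb] := st0.
have i1M : (i.+1 <= M)%N by exact: leq_trans mM.
have i1m : (i.+1 <= 2 ^ m)%N by apply: leq_trans im _; exact: ltnW (ltn_expl m (ltnSn 1)).
set y := column D S l.
have yD k : `|y 0 k| <= D%:Z by exact: column_size.
have yb k : bounded (6 * m) (y 0 k).
  by apply: leq_trans Db; rewrite -lez_nat abszE.
have [|||sf1 [r1 _]] := @pmap_spec b M 16 21 dim (var 16)
   (var 3 [*] Read 14 (var 16 [*] dim [+] var 25) [/] var 15) s n (fun r => r%:Z) (co y)
   isT isT sn nM1.
- by move=> k r _ _ [].
- move=> k s' kn k16 fr _; rewrite /= k16; split=> //.
  rewrite (fr 3%N) // (fr 14%N) // (fr 0%N) // (fr 25%N) // (fr 15%N) // sD sn sl sd.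
  rewrite -PoszM -PoszD sN // (cmE _ (Ordinal kn) (Ordinal ln)) (coE _ (Ordinal kn)).
  by rewrite /y /column insubT /= mxE.
- by move=> k kn; apply: (@bounded_mono (6 * m)); [nia|exact: cobounded].
rewrite /substep_prog; set p1 := PFor 16 _ (PWrite 21 _ _) in sf1 r1 *; set s1 := run p1 s in r1.
have f1 a : a \notin writes p1 -> s1 a = s a by exact: run_frame.
pose row j := if j == i then st.1 else V j.
have rowb j : (j < i.+1)%N -> forall k, bounded (12 * m) (row j 0 k).
  rewrite ltnS leq_eqVlt /row; case: eqVneq => [_ _|_ /= ji] //.
  by have [] := sV j ji.
have rowE j : (j < i.+1)%N -> rowv s 1 (j * n) (row j).
  rewrite ltnS leq_eqVlt /row; case: eqVneq => [-> _|_ /= ji] //.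
  by have [] := sV j ji.
set z := gain K g V i st.1 y.
have zb j : (j < i.+1)%N -> bounded (23 * m) (z j).
  move=> ji; apply: (@bounded_mono (4 * m + (m + (12 * m + 6 * m)))); first by lia.
  rewrite /z /gain; have := rowb j ji; rewrite /row; case: ifP => _ rb.
    apply: boundedM; last exact: idot_bounded.
    by rewrite boundedN.
  by apply: boundedM; [exact: gb|exact: idot_bounded].
have s1i : Defs.eval s1 (var 8 [+] Const 1) = i.+1%:Z by rewrite /= f1 // si -(addn1 i) PoszD.
have s1n : Defs.eval s1 dim = n%:Z by rewrite /= f1.
have [|||||sf2 r2] := @pmapsum_spec b M 9 (var 8 [+] Const 1) 16 18 dim
    (coord (var 9) (var 16) [*] Read 21 (var 16)) 22 (Read 11 (var 9) [*] var 18)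
    s1 i.+1 n (18 * m) m (fun j k => co (row j) k * co y k) z
    isT isT isT s1i i1M s1n nM1 n2m _ _ _ _ _.
- by apply: leq_trans bb; nia.
- move=> j k s' ji kn j9 k16 fr /=.
  rewrite !k16 !j9 !(fr 0%N) // (fr 1%N) // (fr 21%N) // r1 // !f1 // sn.
  by rewrite -!PoszM -!PoszD rowE.
- move=> j k ji kn; apply: (@bounded_mono (12 * m + 6 * m)); first by lia.
  by apply: boundedM; apply: cobounded => //; exact: rowb.
- move=> j s' ji j9 h fr /=; rewrite h idot_co j9 (fr 11%N) // f1 // /z /gain /row.
  move: ji; rewrite ltnS leq_eqVlt; case: eqVneq => [-> _|_ /= ji]; first by rewrite sCi.
  by rewrite sC.
- by move=> j ji; apply: bounded_mono (zb j ji); nia.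
set p2 := pmapsum _ _ _ _ _ _ _ _ in sf2 r2 *; set s2 := run p2 s1 in r2.
have f2 a : a \notin writes p2 -> s2 a = s1 a by exact: run_frame.
have s2i : Defs.eval s2 (var 8 [+] Const 1) = i.+1%:Z by rewrite -s1i /= f2.
have [|||sf3 r3] := @psum_spec b M 9 23 (var 8 [+] Const 1)
    (Read 10 (var 9) [*] Read 22 (var 9)) s2 i.+1 (m + 24 * m * q + 23 * m) m
    (fun j => st.2 j * z j) isT isT s2i i1M _ _ i1m.
- move=> j s' ji j9 fr /=; rewrite j9 (fr 10%N) // (fr 22%N) // r2 //.
  by rewrite f2 // f1 // sW.
- by move=> j ji; apply: boundedM; [exact: Wb|exact: zb].
- by apply: leq_trans bb; nia.
set p3 := psum _ _ _ _ in sf3 r3 *; set s3 := run p3 s2 in r3.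
have f3 a : a \notin writes p3 -> s3 a = s2 a by exact: run_frame.
set p4 := PWrite 24 _ (Const 1); set s4 := run p4 s3.
have f4 a : a \notin writes p4 -> s4 a = s3 a by exact: run_frame.
set p5 := PIf _ _; set s5 := run p5 s4.
have f5 a : a \notin writes p5 -> s5 a = s4 a by exact: run_frame.
set sg' := (if 0 < \sum_(j < i.+1) st.2 j * z j then -1 else 1) : int.
have r5 : s5 24 0 = sg'.
  rewrite /s5 /p5 run_if /= f4 // r3 /sg'; case: ifP => _; last exact: updateE.
  exact: updateE.
have sgb : bounded 0 sg' by rewrite /sg'; case: ifP.
have sE5 a : a \notin [:: 9; 16; 18; 21; 22; 23; 24]%N -> s5 a = s a.
  by move=> ha; rewrite /s5 /s4 /s3 /s2 /s1 !(frame_sub (L := [:: 9; 16; 18; 21; 22; 23; 24]%N)).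
have s5z j : (j < i.+1)%N -> s5 22 j%:Z = z j by move=> ji; rewrite f5 // f4 // f3 // r2.
have s5y k : (k < n)%N -> s5 21 k%:Z = co y k.
  by move=> kn; rewrite f5 // f4 // f3 // f2 // r1.
have s5i : Defs.eval s5 (var 8 [+] Const 1) = i.+1%:Z.
  by rewrite -s2i /= f5 // f4 // f3.
have scb : bounded (20 * m) (scale g D).
  rewrite /scale; apply: (@bounded_mono (4 * m + 4 * m + (6 * m + 6 * m))); first by lia.
  by apply: boundedM; apply: boundedM.
have m0 : (0 < m)%N by apply: leq_ltn_trans im.
(* The scale has [20 m] bits and a gain [23 m]; the carry of their sum is covered by [24 m] because
   [m] is positive. *)
have W'b j : (j < i.+1)%N -> bounded (m + 24 * m * q.+1) (st.2 j * (scale g D + sg' * z j)).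
  move=> ji; apply: (@bounded_mono (m + 24 * m * q + (maxn (20 * m) (0 + 23 * m)).+1)).
    by rewrite /maxn; case: ifP; lia.
  by apply: boundedM; [exact: Wb|apply: boundedD => //; apply: boundedM => //; exact: zb].
have [|||sf6 [r6 _]] := @pmap_spec b M 9 10 (var 8 [+] Const 1) (var 9)
   (Read 10 (var 9) [*] (var 2 [*] var 2 [*] (var 3 [*] var 3) [+]
             var 24 [*] Read 22 (var 9))) s5 i.+1 (fun r => r%:Z)
   (fun j => st.2 j * (scale g D + sg' * z j)) isT isT s5i i1M.
- by move=> k r _ _ [].
- move=> j s' ji j9 fr h; rewrite /= j9; split => //.
  by rewrite h (fr 2%N) // (fr 3%N) // (fr 24%N) // (fr 22%N) // r5 s5z // !sE5 // sg sD sW.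
- by move=> j ji; apply: bounded_mono (W'b j ji); apply: leq_trans bb; nia.
set p6 := PFor 9 _ _ in sf6 r6 *; set s6 := run p6 s5 in r6.
have f6 a : a \notin writes p6 -> s6 a = s5 a by exact: run_frame.
have s6n : Defs.eval s6 dim = n%:Z by rewrite /= f6 // sE5.
have x'b k : `|(st.1 + sg' *: y) 0 k| <= (q.+1 * D)%N%:Z.
  rewrite !mxE; apply: le_trans (ler_normD _ _) _.
  rewrite mulSn PoszD addrC lerD // normrM.
  have -> : `|sg'| = 1 by rewrite /sg'; case: ifP.
  by rewrite mul1r.
have x'b2 k : bounded b ((st.1 + sg' *: y) 0 k).
  apply: (@bounded_mono (12 * m)); first by apply: leq_trans bb; nia.
  apply: leq_trans KDb; rewrite -lez_nat abszE; apply: le_trans (x'b k) _.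
  by rewrite lez_nat leq_mul2r qK orbT.
have [|||sf7 [r7 r7']] := @pmap_spec b M 16 1 dim (var 8 [*] dim [+] var 16)
   (coord (var 8) (var 16) [+] var 24 [*] Read 21 (var 16)) s6 n
   (fun k => (i * n + k)%N%:Z) (co (st.1 + sg' *: y)) isT isT s6n nM1.
- by move=> k r _ _ [] /addnI.
- move=> k s' kn k16 fr; rewrite /= k16 (fr 8%N) // (fr 0%N) // (fr 24%N) // (fr 21%N) //.
  rewrite !f6 // r5 s5y // !sE5 // si sn -PoszM -PoszD => ->; split => //.
  by rewrite sx // !(coE _ (Ordinal kn)) !mxE.
- by move=> k kn; exact: cobounded.
set p7 := PFor 16 _ _ in sf7 r7 r7' *; set s7 := run p7 s6 in r7 r7'.
have f7 a : a \notin writes p7 -> s7 a = s6 a by exact: run_frame.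
have -> : run (PSeq p1 (PSeq p2 (PSeq p3 (PSeq p4 (PSeq p5 (PSeq p6 p7)))))) s = s7.
  by rewrite (run_seq p1) (run_seq p2) (run_seq p3) (run_seq p4) (run_seq p5) (run_seq p6).
have subE : substep K g D V i S l st =
  (st.1 + sg' *: y, fun j => st.2 j * (scale g D + sg' * z j)) by [].
split.
- apply: safe_seq => //; apply: safe_seq => //; apply: safe_seq => //.
  apply: safe_seq; first by rewrite /= /bounded expn_gt0.
  apply: safe_seq; first by move=> _; rewrite /= /bounded expn_gt0.
  by apply: safe_seq.
- rewrite subE; split => //.
  by move=> j ji; rewrite f7 // r6.
- by move=> t ht; rewrite r7' // f6 // sE5.
Qed.

Lemma norm_prog_spec s (x : 'rV[int]_n) i : env i s -> (0 < m)%N ->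
  rowv s 1 (i * n) x -> (forall k, bounded (12 * m) (x 0 k)) ->
  safe b M norm_prog s /\ run norm_prog s 13 0 = idot x x.
Proof.
move=> [sn _ _ _ si] m0 sx xb; rewrite -idot_co.
apply: (@psum_spec _ _ _ _ _ _ _ _ (24 * m) m (fun k => co x k * co x k)) => //.
- move=> k s' kn k16 fr; rewrite /= k16 (fr 1%N) // (fr 8%N) // (fr 0%N) // si sn.
  by rewrite -PoszM -PoszD sx.
- move=> k kn; apply: (@bounded_mono (12 * m + 12 * m)); first by lia.
  by apply: boundedM; exact: cobounded.
- by apply: leq_trans bb; nia.
Qed.

Lemma round_prog_spec s V i q st :
  env i s -> (i < m)%N -> rows V i s ->
  (forall j, (j < i)%N -> s 11 j%:Z = g%:Z) -> s 11 i%:Z = - K%:Z ->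
  (q + n <= K * n)%N -> state i q st s ->
  [/\ safe b M round_prog s,
      state i (q + n) (round K g D V i st) (run round_prog s) &
      forall z, (forall k, (k < n)%N -> z <> (i * n + k)%N%:Z) ->
        run round_prog s 1 z = s 1 z].
Proof.
move=> es im sV sC sCi qK st0.
have m0 : (0 < m)%N by apply: leq_ltn_trans im.
have qK' : (q <= K * n)%N by apply: leq_trans qK; exact: leq_addr.
have xb := state_bounded qK' st0.
have [sx sW xD Wb] := st0; have [sn sg sD sK si] := es.
have [sf1 r1] := norm_prog_spec es m0 sx xb.
rewrite /round_prog; set s1 := run norm_prog s in r1.
have f1 a : a \notin writes norm_prog -> s1 a = s a by exact: run_frame.
have st1 : state i q st s1 by apply: state_ext st0; rewrite f1.
set p2 := PSeq frozen_prog _; set e := _ [-] _.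
have eE : Defs.eval s1 e = n%:Z * K%:Z * (D%:Z * D%:Z) - idot st.1 st.1.
  by rewrite /= r1 !f1 // sn sK sD.
have runE : run (PSeq norm_prog (PIf e p2)) s =
    if 0 < n%:Z * K%:Z * (D%:Z * D%:Z) - idot st.1 st.1 then run p2 s1 else s1.
  by rewrite (run_seq norm_prog) (run_if e) eE.
have safeE : (0 < n%:Z * K%:Z * (D%:Z * D%:Z) - idot st.1 st.1 -> safe b M p2 s1) ->
    safe b M (PSeq norm_prog (PIf e p2)) s.
  by move=> h; split => //; change (0 < Defs.eval s1 e -> safe b M p2 s1); rewrite eE.
rewrite runE /round; case: ifP => act; last first.
  split; [by apply: safeE; rewrite act| |by move=> z _; rewrite f1].
  exact: state_mono (leq_addr _ _) st1.
have es1 : env i s1 by split; rewrite f1.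
have [||||sf2 N2 d2] := @frozen_prog_spec s1 V st.1 i es1 (ltnW im).
- by move=> j ji k kn; rewrite f1 //; case: (sV j ji) => + _; apply.
- by move=> k kn; rewrite f1 // sx.
- by move=> j ji; case: (sV j ji).
- exact: xb.
set S := frozen_proj K g D V i st.1 in N2 d2 *.
set s2 := run frozen_prog s1 in N2 d2.
have f2 a : a \notin writes frozen_prog -> s2 a = s1 a by exact: run_frame.
have Sg : gram_rep S by case: (frozen_projP (R := R) K g D V i st.1).
have s2n : Defs.eval s2 dim = n%:Z by rewrite /= f2 // f1.
have [||sf3 [r3 r3']] := @for_rule b M 25 dim substep_prog s2 n
  (fun l s' => state i (q + l) (iteri l (substep K g D V i S) st) s' /\
     forall z, (forall k, (k < n)%N -> z <> (i * n + k)%N%:Z) -> s' 1 z = s 1 z)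
  isT s2n nM1.
- split; last by move=> z _; rewrite update_array // f2 // f1.
  by rewrite addn0; apply: state_ext st1; rewrite update_array // f2.
- move=> l s' ln sl fr [stl frl].
  have [|||||||||||||sf4 r4 r4'] := @substep_prog_spec s' V i S l
    (q + l) (iteri l (substep K g D V i S) st).
  + by split; rewrite fr // f2 // f1.
  + exact: im.
  + exact: rows_frame frl.
  + by move=> j ji; rewrite fr // f2 // f1 // sC.
  + by rewrite fr // f2 // f1.
  + by move=> k l' kn ln'; rewrite fr // N2.
  + by rewrite fr.
  + by case: Sg => ? [? []].
  + by move=> k l'; exact: gram_rep_entry.
  + exact: sl.
  + exact: ln.
  + by apply: leq_trans qK; rewrite ltn_add2l.
  + exact: stl.
  split; first exact: sf4.
  rewrite addnS; split; first by apply: state_ext r4; rewrite update_array.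
  by move=> z hz; rewrite update_array // r4' // frl.
rewrite /p2 (run_seq frozen_prog) -/s2; split => //.
Qed.

Lemma vector_prog_spec s V i :
  env i s -> s 0 0 = m%:Z -> (i < m)%N -> rows V i s ->
  (forall k, (k < n)%N -> s 1 (i * n + k)%N%:Z = 0) ->
  [/\ safe b M vector_prog s,
      rowv (run vector_prog s) 1 (i * n) (new_vector K g D V i m),
      forall k, bounded (12 * m) (new_vector K g D V i m 0 k) &
      forall z, (forall k, (k < n)%N -> z <> (i * n + k)%N%:Z) ->
        run vector_prog s 1 z = s 1 z].
Proof.
move=> es sm im sV s0; have [sn sg sD sK si] := es.
have i1M : (i.+1 <= M)%N by exact: leq_trans mM.
have m0 : (0 < m)%N by apply: leq_ltn_trans im.
have s1i t : t 8 0 = i%:Z -> Defs.eval t (var 8 [+] Const 1) = i.+1%:Z.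
  by move=> h; rewrite /= h -(addn1 i) PoszD.
have [|||sf1 [r1 _]] := @pmap_spec b M 9 10 (var 8 [+] Const 1) (var 9) (Const 1) s
   i.+1 (fun r => r%:Z) (fun=> 1) isT isT (s1i s si) i1M.
- by move=> k r _ _ [].
- by move=> k s' _ k16 _ _; rewrite /= k16.
- by move=> k _; rewrite /bounded expn_gt0.
rewrite /vector_prog; set p1 := PFor 9 _ (PWrite 10 _ _) in sf1 r1 *; set s1 := run p1 s in r1.
have f1 a : a \notin writes p1 -> s1 a = s a by exact: run_frame.
set p2 := PWrite 10 (var 8) _; set s2 := run p2 s1.
have f2 a : a \notin writes p2 -> s2 a = s1 a by exact: run_frame.
have sf2 : safe b M p2 s1.
  change (bounded b (Defs.eval s1 (var 0))); rewrite /= f1 // sm.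
  apply: (@bounded_mono m); first by apply: leq_trans bb; nia.
  by rewrite /bounded ltnW // ltn_expl.
have s2E : s2 = update s1 10 i%:Z m%:Z by rewrite /s2 run_write /= !f1 // si sm.
have s2i : s2 8 0 = i%:Z by rewrite f2 // f1.
have [|||sf3 [r3 _]] := @pmap_spec b M 9 11 (var 8 [+] Const 1) (var 9) (var 2) s2
   i.+1 (fun r => r%:Z) (fun=> g%:Z) isT isT (s1i s2 s2i) i1M.
- by move=> k r _ _ [].
- by move=> k s' _ k16 fr _; rewrite /= k16 fr // f2 // f1.
- by move=> k _; apply: (@bounded_mono (4 * m)); [apply: leq_trans bb; nia|exact: gb].
set p3 := PFor 9 _ (PWrite 11 _ _) in sf3 r3 *; set s3 := run p3 s2 in r3.
have f3 a : a \notin writes p3 -> s3 a = s2 a by exact: run_frame.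
set p4 := PWrite 11 (var 8) _; set s4 := run p4 s3.
have f4 a : a \notin writes p4 -> s4 a = s3 a by exact: run_frame.
have sf4 : safe b M p4 s3.
  change (bounded b (Defs.eval s3 (Const 0 [-] var 4))).
  rewrite /= f3 // f2 // f1 // sK sub0r boundedN.
  by apply: (@bounded_mono (4 * m)); [apply: leq_trans bb; nia|exact: Kb].
have s4E : s4 = update s3 11 i%:Z (- K%:Z).
  by rewrite /s4 run_write /= !f3 // !f2 // !f1 // si sK sub0r.
have sE4 a : a \notin [:: 9; 10; 11]%N -> s4 a = s a.
  by move=> ha; rewrite /s4 /s3 /s2 /s1 !(frame_sub (L := [:: 9; 10; 11]%N)).
pose st0 : 'rV[int]_n * (nat -> int) := (0, fun j => if j == i then m%:Z else 1).
have st4 : state i 0 st0 s4.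
  split => [k kn|j ji|k|j ji] /=.
  - by rewrite sE4 // s0 // (coE _ (Ordinal kn)) mxE.
  - rewrite f4 // f3 // s2E /update eqxx andTb eqz_nat; case: ifP => // _.
    by rewrite r1.
  - by rewrite mxE normr0.
  - case: ifP => _; last by rewrite /bounded expn_gt0.
    by rewrite /bounded muln0 addn0 ltnW // ltn_expl.
have C4 j : (j < i)%N -> s4 11 j%:Z = g%:Z.
  move=> ji; rewrite s4E /update eqxx andTb eqz_nat (ltn_eqF ji) r3 //.
  exact: leqW.
have C4i : s4 11 i%:Z = - K%:Z by rewrite s4E updateE.
have s4K : Defs.eval s4 (var 4) = K%:Z by rewrite /= sE4.
have [||sf5 [r5 r5']] := @for_rule b M 12 (var 4) round_prog s4 K
  (fun r s' => state i (r * n) (iter r (round K g D V i) st0) s' /\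
     forall z, (forall k, (k < n)%N -> z <> (i * n + k)%N%:Z) -> s' 1 z = s 1 z)
  isT s4K KM.
- split; last by move=> z _; rewrite update_array // sE4.
  by apply: state_ext st4; rewrite update_array.
- move=> r s' rK _ fr [str frr].
  have [|||||||sf6 r6 r6'] := @round_prog_spec s' V i (r * n) (iter r (round K g D V i) st0).
  + by split; rewrite fr // sE4.
  + exact: im.
  + exact: rows_frame frr.
  + by move=> j ji; rewrite fr // C4.
  + by rewrite fr.
  + by rewrite -mulSnr leq_mul2r rK orbT.
  + exact: str.
  split; first exact: sf6.
  rewrite mulSnr; split; first by apply: state_ext r6; rewrite update_array.
  by move=> z hz; rewrite update_array // r6' // frr.
rewrite -[iter K _ _]/(walk K g D V i m) in r5.
set p5 := PFor 12 _ _ in sf5 r5 r5' *; set s5 := run p5 s4 in r5 r5'.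
set x := (walk K g D V i m).1.
have xb : forall k, bounded (12 * m) (x 0 k) := state_bounded (leqnn _) r5.
have [sx _ _ _] := r5; rewrite -/x in sx.
have f5 a : a \notin writes p5 -> s5 a = s4 a by exact: run_frame.
have es5 : env i s5 by split; rewrite f5 // sE4.
have [sf6 r6] := norm_prog_spec es5 m0 sx xb.
set s6 := run norm_prog s5 in r6.
have f6 a : a \notin writes norm_prog -> s6 a = s5 a by exact: run_frame.
set e := Const 1 [-] var 13; set p7 := PWrite 1 _ _.
have runE : run (PSeq p1 (PSeq p2 (PSeq p3 (PSeq p4 (PSeq p5 (PSeq norm_prog (PIf e p7))))))) s =
    if 0 < idot x x then s6 else update s6 1 (i * n)%N%:Z 1.
  rewrite (run_seq p1) (run_seq p2) (run_seq p3) (run_seq p4) (run_seq p5) (run_seq norm_prog).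
  rewrite (run_if e) -/s6 [Defs.eval _ _]/= r6 subr_gt0.
  have -> : (idot x x < 1) = ~~ (0 < idot x x) by rewrite -leNgt -ltzD1.
  rewrite if_neg; case: ifP => // _.
  by rewrite run_write /= f6 // f6 // !f5 // !sE4 // si sn PoszM.
have sf : safe b M (PSeq p1 (PSeq p2 (PSeq p3 (PSeq p4 (PSeq p5 (PSeq norm_prog (PIf e p7))))))) s.
  do 6 (apply: safe_seq; first by []).
  by move=> _; rewrite /= /bounded expn_gt0.
rewrite runE /new_vector -/x.
have [x0|x0] := boolP (0 < idot x x).
  by split => //; [rewrite /rowv f6|move=> z hz; rewrite f6 // r5'].
rewrite -leNgt in x0; split => // [k kn|k|z hz].
- rewrite /update eqxx andTb (coE _ (Ordinal kn)) mxE eqz_nat -[X in _ == X]addn0 eqn_add2l.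
  rewrite [RHS]/=; case: (k == 0)%N => //.
  by rewrite f6 // sx // (coE _ (Ordinal kn)) idot_le0.
- by rewrite mxE; case: (_ == _); rewrite /bounded ?expn_gt0.
- rewrite /update eqxx andTb; case: eqP => [E|_]; last by rewrite f6 // r5'.
  by case: (hz 0%N n0); rewrite addn0.
Qed.

End Environment.

Section Count.
Variables (m n b M g : nat).
Hypothesis m0 : (0 < m)%N.
Hypothesis n2m : (n <= 2 ^ m)%N.
Hypothesis gM : (g <= M)%N.
Hypothesis gb : (g <= 2 ^ (4 * m))%N.
Hypothesis bb : (20 * m * (g + 2) <= b)%N.

(** Both factors are at most [4 * 2^(8 m) <= 2^(14 m)]. *)
Lemma kstep_size t A B k : (t < g)%N -> (A <= 2 ^ (m + 14 * m * t))%N ->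
  (B <= 2 ^ (m + 14 * m * t))%N -> (k <= t)%N ->
  (A * (2 * (g * g) + (2 * k + 1) * n) <= 2 ^ (m + 14 * m * t.+1))%N /\
  (B * (2 * (g * g)) <= 2 ^ (m + 14 * m * t.+1))%N.
Proof.
move=> tg Ab Bb kt.
have gg : (g * g <= 2 ^ (8 * m))%N.
  have -> : (8 * m = 4 * m + 4 * m)%N by lia.
  by rewrite expnD; exact: leq_mul.
have kn : ((2 * k + 1) * n <= 2 * 2 ^ (8 * m))%N.
  apply: (@leq_trans ((2 * 2 ^ (4 * m)) * 2 ^ m)).
    by apply: leq_mul => //; move: gb; lia.
  by rewrite -mulnA -expnD leq_mul2l leq_pexp2l //=; lia.
have c : (4 * 2 ^ (8 * m) <= 2 ^ (14 * m))%N.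
  by rewrite -[4%N]/(2 ^ 2)%N -expnD leq_pexp2l //; lia.
have -> : (m + 14 * m * t.+1 = (m + 14 * m * t) + 14 * m)%N by nia.
by rewrite expnD; split; apply: leq_mul => //; lia.
Qed.

Lemma count_prog_spec (s : memory) :
  s 0 1 = n%:Z -> s 2 0 = g%:Z -> s 4 0 = 0 -> s 5 0 = n%:Z -> s 6 0 = m%:Z ->
  safe b M count_prog s /\ run count_prog s 4 0 = (round_count m n g)%:Z.
Proof.
move=> sn sg s4 s5 s6.
rewrite /count_prog; set pb := PSeq _ _; set p := PIf _ pb.
have [||sf r4] := @for_rule b M 7 (var 2) p s g (fun t s' =>
   let: (A, B, k) := iter t (kstep n g) (n, m, 0%N) in
   [/\ s' 5 0 = A%:Z, s' 6 0 = B%:Z, s' 4 0 = k%:Z &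
     [/\ (A <= 2 ^ (m + 14 * m * t))%N, (B <= 2 ^ (m + 14 * m * t))%N & (k <= t)%N]])
   isT sg gM.
- rewrite /= muln0 addn0; split; rewrite ?update_array //; split => //.
  exact: ltnW (ltn_expl _ _).
- move=> t s' tg _ fr; rewrite iterS.
  case: (iter t _ _) => -[A B] k [s'A s'B s'k [Ab Bb kt]].
  have [A'b B'b] := kstep_size tg Ab Bb kt.
  have tb : (m + 14 * m * t.+1 <= b)%N by apply: leq_trans bb; nia.
  have AB : (0 < Defs.eval s' (var 6 [-] var 5)) = (A < B)%N.
    by rewrite /= s'A s'B subr_gt0 ltz_nat.
  have sn' : s' 0%N 1 = n%:Z by rewrite fr.
  have sg' : s' 2 0 = g%:Z by rewrite fr.
  rewrite /p run_if AB /kstep; case: ifP => AltB; last first.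
    split; first by change (0 < Defs.eval s' (var 6 [-] var 5) -> safe b M pb s'); rewrite AB AltB.
    split; rewrite ?update_array //.
    by split; [apply: leq_trans Ab _|apply: leq_trans Bb _|exact: leqW]; rewrite leq_pexp2l //; nia.
  rewrite /pb; set q1 := PWrite 5 _ _; set q2 := PWrite 6 _ _; set q3 := PWrite 4 _ _.
  set A' := (A * _)%N in A'b *; set B' := (B * _)%N in B'b *.
  have r1 : run q1 s' = update s' 5 0 A'%:Z.
    by rewrite run_write /= s'A sg' s'k sn' /A' !(PoszM, PoszD).
  set s1 := update s' 5 0 A'%:Z in r1.
  have r2 : run q2 s1 = update s1 6 0 B'%:Z.
    rewrite run_write; congr update.
    by rewrite /= /s1 !update_array // s'B sg' /B' !(PoszM, PoszD).
  set s2 := update s1 6 0 B'%:Z in r2.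
  have r3 : run q3 s2 = update s2 4 0 k.+1%:Z.
    rewrite run_write; congr update.
    by rewrite /= /s2 /s1 !update_array // s'k -(addn1 k) PoszD.
  rewrite (run_seq q1) r1 (run_seq q2) r2 r3; split.
    have e1 : Defs.eval s' (var 5 [*] (Const 2 [*] (var 2 [*] var 2) [+]
              (Const 2 [*] var 4 [+] Const 1) [*] dim)) = A'%:Z.
      by rewrite /= s'A sg' s'k sn' /A' !(PoszM, PoszD).
    have e2 : Defs.eval s1 (var 6 [*] (Const 2 [*] (var 2 [*] var 2))) = B'%:Z.
      by rewrite /= /s1 !update_array // s'B sg' /B' !(PoszM, PoszD).
    have e3 : Defs.eval s2 (var 4 [+] Const 1) = k.+1%:Z.
      by rewrite /= /s2 /s1 !update_array // s'k -(addn1 k) PoszD.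
    move=> _; apply: safe_seq.
      change (bounded b (Defs.eval s' (var 5 [*] (Const 2 [*] (var 2 [*] var 2) [+]
              (Const 2 [*] var 4 [+] Const 1) [*] dim)))).
      by rewrite e1; apply: bounded_mono tb _.
    rewrite r1; apply: safe_seq.
      change (bounded b (Defs.eval s1 (var 6 [*] (Const 2 [*] (var 2 [*] var 2))))).
      by rewrite e2; apply: bounded_mono tb _.
    rewrite r2; change (bounded b (Defs.eval s2 (var 4 [+] Const 1))).
    rewrite e3; apply: (@bounded_mono (4 * m)); first by apply: leq_trans bb; nia.
    by apply: leq_trans gb; apply: leq_ltn_trans tg.
  split.
  - by rewrite update_array // update_array // /s2 update_array // updateE.
  - by rewrite update_array // update_array // updateE.
  - by rewrite update_array // updateE.
  by split.
split; first exact: sf.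
by move: r4; rewrite /round_count; case: (iter g _ _) => -[A B] k [_ _ -> _].
Qed.

End Count.

(** The weights determine the bit length [100 m^6]: the walk of one vector has [K n <= m^5]
    substeps, each adding [24 m] bits. *)
Lemma main_prog_spec (R : realType) (m n : nat) : (0 < n)%N -> (16 * n <= m)%N ->
  safe (100 * m ^ 6) (m ^ 4) main_prog (input m n) /\
  forall i, (i < m)%N -> rowv (run main_prog (input m n)) 1 (i * n) (vectors m n i).
Proof.
move=> n0 nm; set b := (100 * m ^ 6)%N; set M := (m ^ 4)%N.
set K := rounds m n; set g := (m ^ 4)%N; set D := (m ^ 6)%N.
have m16 : (16 <= m)%N by lia.
have m2m : (m <= 2 ^ m)%N by rewrite ltnW // ltn_expl.
have pow r : (m ^ r <= 2 ^ (r * m))%N by rewrite mulnC expnM; case: r => // r; rewrite leq_exp2r.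
have nm1 : (n <= m)%N by lia.
have n2m : (n <= 2 ^ m)%N by exact: leq_trans m2m.
have nM : (n * n <= M)%N.
  apply: (@leq_trans (m ^ 2)); first by rewrite expnS expn1; exact: leq_mul.
  by rewrite leq_pexp2l //; lia.
have mM : (m <= M)%N by rewrite -{1}(expn1 m) leq_pexp2l //; lia.
have KM : (K <= M)%N by exact: round_count_le.
have gb : (g <= 2 ^ (4 * m))%N by exact: pow.
have Kb : (K <= 2 ^ (4 * m))%N by exact: leq_trans gb.
have Db : (D <= 2 ^ (6 * m))%N by exact: pow.
have KDb : (K * n * D <= 2 ^ (12 * m))%N.
  apply: (@leq_trans (m ^ 11)).
    by rewrite (_ : 11 = 4 + 1 + 6)%N // !expnD expn1; apply: leq_mul => //; exact: leq_mul.
  by apply: leq_trans (pow 11) _; rewrite leq_pexp2l //; lia.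
have m1 : (1 <= m ^ 4)%N by rewrite expn_gt0; lia.
have Kn : (K * n <= m ^ 5)%N by rewrite expnSr; exact: leq_mul.
have b1 : (100 * m ^ 6 = 100 * m * m ^ 5)%N by rewrite expnS mulnA.
have b2 : (m ^ 5 = m * m ^ 4)%N by rewrite expnS.
have bb : (40 * m * (K * n + m + g + 2) <= b)%N.
  rewrite /b b1; have : (40 * (K * n + m + g + 2) <= 100 * m ^ 5)%N.
    by move: Kn m1; rewrite b2 /g; move: (m ^ 4)%N => X; nia.
  by move=> h; rewrite mulnAC -[leqRHS]mulnAC leq_mul2r h orbT.
have bc : (20 * m * (g + 2) <= b)%N.
  by apply: leq_trans bb; nia.
have bm x : (x <= m ^ 6)%N -> bounded b x%:Z.
  move=> xm; rewrite /bounded /=; apply: leq_trans xm _; apply: leq_trans Db _.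
  rewrite leq_pexp2l // /b b1; move: (m ^ 5)%N b2 => X; nia.
have gD : (g <= D)%N by rewrite leq_pexp2l //; lia.
set s0 := input m n.
have s0m : s0 0%N 0 = m%:Z by [].
have s0n : s0 0%N 1 = n%:Z by rewrite /s0 /input updateE.
rewrite /main_prog.
set p1 := PWrite 2 _ _; set s1 := run p1 s0.
have f1 a : a \notin writes p1 -> s1 a = s0 a by exact: run_frame.
have e1 : Defs.eval s0 (var 0 [*] var 0 [*] (var 0 [*] var 0)) = g%:Z.
  by rewrite /= s0m -!PoszM /g expnS expnS expnS expn1 !mulnA.
have s1g : s1 2 0 = g%:Z by rewrite /s1 run_write updateE e1.
have sf1 : safe b M p1 s0.
  change (bounded b (Defs.eval s0 (var 0 [*] var 0 [*] (var 0 [*] var 0)))).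
  by rewrite e1; exact: bm.
set p2 := PWrite 3 _ _; set s2 := run p2 s1.
have f2 a : a \notin writes p2 -> s2 a = s1 a by exact: run_frame.
have e2 : Defs.eval s1 (var 2 [*] (var 0 [*] var 0)) = D%:Z.
  by rewrite /= s1g f1 // s0m -!PoszM /g /D (_ : 6 = 4 + 2)%N // expnD -mulnn.
have s2D : s2 3 0 = D%:Z by rewrite /s2 run_write updateE e2.
have sf2 : safe b M p2 s1.
  change (bounded b (Defs.eval s1 (var 2 [*] (var 0 [*] var 0)))).
  by rewrite e2; exact: bm.
set p3 := PWrite 4 _ _; set s3 := run p3 s2.
have f3 a : a \notin writes p3 -> s3 a = s2 a by exact: run_frame.
set p4 := PWrite 5 _ _; set s4 := run p4 s3.
have f4 a : a \notin writes p4 -> s4 a = s3 a by exact: run_frame.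
set p5 := PWrite 6 _ _; set s5 := run p5 s4.
have f5 a : a \notin writes p5 -> s5 a = s4 a by exact: run_frame.
have s4n : s4 5 0 = n%:Z by rewrite /s4 run_write updateE /= f3 // f2 // f1.
have s5m : s5 6 0 = m%:Z by rewrite /s5 run_write updateE /= f4 // f3 // f2 // f1.
have s30 : s3 4 0 = 0 by rewrite /s3 run_write updateE.
have sE5 a : a \notin [:: 2; 3; 4; 5; 6]%N -> s5 a = s0 a.
  by move=> ha; rewrite /s5 /s4 /s3 /s2 /s1 !(frame_sub (L := [:: 2; 3; 4; 5; 6]%N)).
have sf3 : safe b M p3 s2 by [].
have sf4 : safe b M p4 s3.
  change (bounded b (Defs.eval s3 dim)); rewrite /= f3 // f2 // f1 // s0n; apply: bm.
  by apply: leq_trans gD; exact: leq_trans mM.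
have sf5 : safe b M p5 s4.
  change (bounded b (Defs.eval s4 (var 0))); rewrite /= f4 // f3 // f2 // f1 // s0m; apply: bm.
  exact: leq_trans gD.
have s5g : s5 2 0 = g%:Z by rewrite f5 // f4 // f3 // f2.
have s5D : s5 3 0 = D%:Z by rewrite f5 // f4 // f3.
have m0 : (0 < m)%N by lia.
have [|||||sf6 r6] := @count_prog_spec m n b M g m0 n2m (leqnn _) gb bc s5.
- by rewrite sE5.
- by [].
- by rewrite f5 // f4.
- by rewrite f5.
- by [].
set s6 := run count_prog s5 in r6.
have f6 a : a \notin writes count_prog -> s6 a = s5 a by exact: run_frame.
set p7 := PFor 8 (var 0) vector_prog.
have s6m : Defs.eval s6 (var 0) = m%:Z by rewrite /= f6 // sE5.
have [||sf7 [r7 _]] := @for_rule b M 8 (var 0) vector_prog s6 m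
  (fun i s' => rows m (vectors m n) i s' /\
     forall q, (i * n <= q)%N -> s' 1 q%:Z = 0) isT s6m mM.
- by split => // q _; rewrite update_array // f6 // sE5.
- move=> i s' im si fr [rs z0].
  set V := code n K g D m i.
  have rV : rows m V i s' by move=> j ji; rewrite /V codeE //; exact: rs.
  have [|||||sf8 r8 xb r8'] := @vector_prog_spec m n b M g D K R
    n0 n2m nM mM KM Kb gb Db KDb bb s' V i.
  + split; [by rewrite fr // f6 // sE5|by rewrite fr // f6|by rewrite fr // f6| |by []].
    by rewrite fr.
  + by rewrite fr // f6 // sE5.
  + exact: im.
  + exact: rV.
  + by move=> k kn; rewrite z0 // leq_addr.
  rewrite -/(vectors m n i) in r8 xb.
  split; first exact: sf8.
  split.
    move=> j; rewrite ltnS leq_eqVlt => /orP[/eqP ->|ji].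
      split; last exact: xb.
      by move=> k kn; rewrite update_array //; exact: r8.
    have [a1 a2] := rows_frame rs r8' ji.
    split; last exact: a2.
    by move=> k kn; rewrite update_array //; exact: a1.
  move=> q qi; rewrite update_array // r8'.
    by apply: z0; apply: leq_trans qi; rewrite leq_mul2r leqnSn orbT.
  by move=> k kn [] E; move: qi; rewrite E mulSn; lia.
set p6 := count_prog.
rewrite (run_seq p1) (run_seq p2) (run_seq p3) (run_seq p4) (run_seq p5) (run_seq p6).
split; first by do 6 (apply: safe_seq; first by []).
by move=> i im; case: (r7 i im).
Qed.

(** * Output and running time *)

Section Output.
Variables (m n : nat).
Hypothesis n0 : (0 < n)%N.
Hypothesis nm : (16 * n <= m)%N.

Lemma vectors_gt0 i : 0 < idot (vectors m n i) (vectors m n i).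
Proof.
rewrite /vectors /new_vector; case: ifP => // _.
rewrite /idot (bigD1 (Ordinal n0)) //= !mxE /= ltr_pwDl // sumr_ge0 // => k _.
by rewrite -expr2 sqr_ge0.
Qed.

Lemma code_point_sphere (R : realType) i : sphere (code_point m n R i).
Proof.
have w0 : 0 < norm2 (cst_mx (vectors m n i) : 'rV[R]_n).
  by rewrite sqrtr_gt0 dot_intr ltr0z vectors_gt0.
apply/sphereP; rewrite /code_point dotZl dotZr -norm2_sqr.
by rewrite mulrA -expr2 exprVn mulVf // expf_neq0 // gt_eqF.
Qed.

Lemma row_output (R : realType) i : (i < m)%N ->
  \row_(j < n) (run main_prog (input m n) 1%N (i * n + j)%N%:Z)%:~R =
  cst_mx (vectors m n i) :> 'rV[R]_n.
Proof.
move=> im; have [_ h] := main_prog_spec R n0 nm.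
by apply/rowP => j; rewrite !mxE h // coE.
Qed.

Lemma outputs_code (R : realType) :
  outputs (compile main_prog) (time main_prog (input m n))
    (fun i : 'I_m => code_point m n R i).
Proof.
exists (run main_prog (input m n)); split; first exact: exec_compile wf_main.
by move=> i w; rewrite /w row_output.
Qed.

Lemma outputs_unique (R : realType) t (v : 'I_m -> 'rV[R]_n) :
  outputs (compile main_prog) t v -> v = fun i => code_point m n R i.
Proof.
move=> [s [es vE]]; apply/funext => i; rewrite vE.
have [-> _] := exec_deterministic es (exec_compile (input m n) wf_main).
by rewrite row_output.
Qed.

(** Five nested loops of at most [m^4] iterations give [m^20], and the bit length contributes
    [m^6]. *)
Lemma time_main (R : realType) :
  (time main_prog (input m n) <= time_factor main_prog 1 * 101 * m ^ 26)%N.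
Proof.
have [sf _] := main_prog_spec R n0 nm.
have m16 : (16 <= m)%N by lia.
have m2m : (m <= 2 ^ m)%N by rewrite ltnW // ltn_expl.
have m6 : (0 < m ^ 6)%N by rewrite expn_gt0; lia.
have m6m : (m <= m ^ 6)%N by rewrite -{1}(expn1 m) leq_pexp2l //; lia.
have Mb : (m ^ 4 <= 2 ^ (100 * m ^ 6))%N.
  apply: (@leq_trans (2 ^ (4 * m))); first by rewrite mulnC expnM leq_exp2r.
  by rewrite leq_pexp2l //; lia.
have ib : bounded_memory (100 * m ^ 6) (input m n).
  have mb : bounded (100 * m ^ 6) m%:Z.
    by apply: leq_trans m2m _; rewrite leq_pexp2l //; lia.
  apply: bounded_update; last by apply: leq_trans mb; rewrite /=; lia.
  by apply: bounded_update.
apply: leq_trans (time_le Mb ib sf) _.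
have m4 : (0 < m ^ 4)%N by rewrite expn_gt0; lia.
have := time_factor_le main_prog m4.
have -> : loop_depth main_prog = 5%N by [].
move: (time_factor main_prog (m ^ 4)) (time_factor main_prog 1) => t t1.
rewrite -expnM -[(4 * 5)%N]/20%N => h; rewrite -[26%N]/(20 + 6)%N expnD.
move: (m ^ 20)%N (m ^ 6)%N h m6 => x y h y0.
rewrite -mulnA (mulnCA 101%N) mulnA; apply: leq_mul => //; lia.
Qed.

End Output.

(** * The asymptotic statement *)

Section Final.
Context {R : realType}.

(** From [m <= 2^f] follows [ln(m/n) <= |f|]. The little-o is applied with the constant [10^-4], and
    [10^7 * 10^-8 <= 1]. *)
Lemma log_ratio_small (f : nat -> R) (m : nat -> nat) :
  f =o_\oo (fun n => Num.sqrt n%:R : R) ->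
  (\forall n \near \oo, (16 * n <= m n)%N /\ (m n)%:R <= 2 `^ (f n)) ->
  \forall n \near \oo, [/\ (10 ^ 6 <= n)%N, (16 * n <= m n)%N &
    10 ^+ 7 * ln ((m n)%:R / n%:R) ^+ 2 <= n%:R :> R].
Proof.
move=> /eqoP fo mf; have e0 : 0 < (10 ^+ 4)^-1 :> R by rewrite invr_gt0 exprn_gt0.
near=> n.
have n6 : (10 ^ 6 <= n)%N by near: n; exact: nbhs_infty_ge.
have [nm mfn] : (16 * n <= m n)%N /\ (m n)%:R <= 2 `^ (f n) by near: n.
have fn : `|f n| <= (10 ^+ 4)^-1 * `|Num.sqrt n%:R : R|.
  by near: n; exact: fo.
have n0 : (0 < n)%N by apply: leq_trans n6; rewrite expn_gt0.
have m0 : (0 < m n)%N by apply: leq_trans nm; rewrite muln_gt0.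
split => //; set L := ln _.
have L0 : 0 <= L.
  rewrite ln_ge0 // ler_pdivlMr ?ltr0n // mul1r ler_nat.
  by apply: leq_trans nm; rewrite leq_pmull.
have Lf : L <= `|f n|.
  apply: (@le_trans _ _ (ln (m n)%:R)).
    rewrite ler_ln ?posrE ?divr_gt0 ?ltr0n // ler_pdivrMr ?ltr0n //.
    by rewrite ler_peMr ?ler1n // ler0n.
  apply: (@le_trans _ _ (f n * ln 2)).
    by rewrite -ln_powR ler_ln ?posrE ?ltr0n ?powR_gt0.
  apply: (@le_trans _ _ (`|f n| * ln 2)).
    by rewrite ler_wpM2r ?ln_ge0 ?ler_norm // ler1n.
  rewrite ler_piMr // -ler_expR lnK ?posrE //.
  by have := expR_ge1Dx (1 : R); lra.
have := le_trans Lf fn; rewrite (ger0_norm (sqrtr_ge0 _)) => Ln.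
have : L ^+ 2 <= ((10 ^+ 4)^-1 * Num.sqrt n%:R) ^+ 2.
  by rewrite lerXn2r ?nnegrE // mulr_ge0 ?sqrtr_ge0 // ltW.
rewrite exprMn sqr_sqrtr ?ler0n //.
have : 0 <= n%:R :> R by [].
move: (n%:R : R) (L ^+ 2) => x y x0 h.
have e : 10 ^+ 7 * ((10 ^+ 4)^-1 ^+ 2 * x) <= x by lra.
by apply: le_trans e; rewrite ler_pM2l // exprn_gt0.
Unshelve. all: by end_near. Qed.

(** Brings the inner products below the 1/200 that [caps_disjoint] tolerates: the root is at most
    1/2000 and the other factor at most 6. *)
Lemma small_dot (L n : R) : 27 / 10 <= L -> 10 ^+ 7 * L ^+ 2 <= n ->
  Num.sqrt (2 * L / n) * (1 + 12 / L) <= 1 / 200.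
Proof.
move=> L1 Ln; have L0 : 0 < L by lra.
have n0 : 0 < n by apply: lt_le_trans Ln; rewrite mulr_gt0 ?exprn_gt0.
have h1 : 1 + 12 / L <= 6.
  by rewrite -lerBrDl ler_pdivrMr //; lra.
have h2 : Num.sqrt (2 * L / n) <= 1 / 2000.
  have c0 : 0 <= 1 / 2000 :> R by lra.
  rewrite -[leRHS](ger0_norm c0) -sqrtr_sqr; apply: ler_wsqrtr; rewrite ler_pdivrMr //.
  have h : 27 / 10 * L <= L ^+ 2 by rewrite expr2 ler_pM2r.
  by lra.
have : Num.sqrt (2 * L / n) * (1 + 12 / L) <= 1 / 2000 * 6.
  apply: ler_pM; [exact: sqrtr_ge0| |exact: h2|exact: h1].
  by have : 0 < 12 / L; [rewrite divr_gt0|move=> h; lra].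
by lra.
Qed.

End Final.

Theorem theorem9 (R : realType) :
  exists (A : cmd) (k : nat) (C c : R),
    0 < c /\
    (forall m n : nat, (0 < n)%N -> (16 * n <= m)%N ->
       exists (t : nat) (v : 'I_m -> 'rV[R]_n),
         outputs A t v /\ (t <= k * (m + n) ^ k)%N /\
         forall i, sphere (v i)) /\
    (forall (m : nat -> nat) (f : nat -> R),
       f =o_\oo (fun n => Num.sqrt n%:R : R) ->
       (\forall n \near \oo,
          (16 * n <= m n)%N /\ (m n)%:R <= 2 `^ (f n)) ->
       \forall n \near \oo,
         forall (t : nat) (v : 'I_(m n) -> 'rV[R]_n), outputs A t v ->
           (forall i j, i != j ->
              dot (v i) (v j) <=
                Num.sqrt (2 * ln ((m n)%:R / n%:R) / n%:R) *
                (1 + C / log2 ((m n)%:R / n%:R))) /\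
           (forall i,
              c * (n%:R / (2 ^+ n * Num.sqrt (log2 ((m n)%:R / n%:R)))) <=
                (m n)%:R * normalized_volume (cap (v i) (max_radius v)))).
Proof.
(* The same [k] serves as factor and as exponent, hence the sum of both. [C = 20] comes from
   [12 / L] and [20 ln 2 >= 12]; [c = 1/2] is the constant of [density_ge]. *)
exists (compile main_prog), (time_factor main_prog 1 * 101 + 26)%N, 20, 2^-1.
split; first by rewrite invr_gt0.
split=> [m n n0 nm|m f fo mf].
  exists (time main_prog (input m n)), (fun i => code_point m n R i).
  split; first exact: outputs_code.
  split; last by move=> i; exact: code_point_sphere.
  apply: leq_trans (time_main n0 nm R) _; apply: leq_mul; first exact: leq_addr.
  have m1 : (0 < m)%N by lia.
  apply: (@leq_trans ((m + n) ^ 26)); first by rewrite leq_exp2r // leq_addr.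
  by rewrite leq_pexp2l ?leq_addl // addn_gt0 m1.
near=> n => t v.
have [n6 nm hL] : [/\ (10 ^ 6 <= n)%N, (16 * n <= m n)%N &
    10 ^+ 7 * ln ((m n)%:R / n%:R) ^+ 2 <= n%:R :> R].
  by near: n; exact: log_ratio_small mf.
have n0 : (0 < n)%N by apply: leq_trans n6; rewrite expn_gt0.
move=> /(outputs_unique n0 nm) ->.
have L1 := log_ratio_ge (R := R) n0 nm.
have bound (i j : 'I_(m n)) (ij : i != j) :=
  code_dot_le n0 nm hL (ltn_ord i) (ltn_ord j) ij.
split=> [i j ij|i]; last first.
  apply: density_ge => // [j|j j' jj]; first exact: code_point_sphere.
  exact: le_trans (bound _ _ jj) (small_dot L1 hL).
apply: le_trans (bound _ _ ij) _; rewrite ler_wpM2l ?sqrtr_ge0 // lerD2l.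
have L0 : 0 < ln ((m n)%:R / n%:R) :> R by apply: lt_le_trans L1; lra.
rewrite /log2 invf_div mulrA ler_pM2r ?invr_gt0 //.
by have := ln2_ge (R := R); lra.
Unshelve. all: by end_near. Qed.
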